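(* Let $d\ge 1$, let $\mathbf{w}=(w_1,\dots,w_d)$ be a weight in $\mathbb{R}^d$, and let $\boldsymbol\theta:\mathbb{R}^d\to\mathbb{R}^d$ be of the form $\boldsymbol\theta(\mathbf{x})=(\theta_1(x_1),\dots,\theta_d(x_d))$, where each $\theta_i:\mathbb{R}\to\mathbb{R}$ is a Lipschitz function. Then $\mathbf{Bad}_{\boldsymbol\theta}(\mathbf{w})\subset\mathbb{R}^d$ is hyperplane absolute winning; in particular, it is winning in the sense of Schmidt's game.
   Context: A weight in $\mathbb{R}^d$ is a vector $\mathbf{w}=(w_1,\dots,w_d)$ with $w_i\ge 0$ for all $i$ and $\sum_{i=1}^d w_i=1$. For $x\in\mathbb{R}$, $|x|_{\mathbb{Z}}$ is the distance from $x$ to the nearest integer. For $\boldsymbol\theta(\mathbf{x})=(\theta_i(x_i))_{i=1}^d$, $$\mathbf{Bad}_{\boldsymbol\theta}(\mathbf{w}):=\Big\{\mathbf{x}\in\mathbb{R}^d:\ \liminf_{q\in\mathbb{Z}\setminus\{0\},\,|q|\to\infty}\ \max_{1\le i\le d}|qx_i-\theta_i(x_i)|_{\mathbb{Z}}^{1/w_i}\,|q|>0\Big\},$$ with the convention $|x|_{\mathbb{Z}}^{1/w_i}:=0$ if $w_i=0$. Hyperplane absolute game on $\mathbb{R}^d$: Bob fixes $0<\beta<1/3$ and chooses a closed ball $B_0$ of radius $r_0>0$. At stage $n\ge 0$, given the ball $B_n$ of radius $r_n$, Alice chooses an affine hyperplane $H_n$ and $0<\varepsilon_n\le\beta r_n$,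 and then Bob chooses a closed ball $B_{n+1}\subset B_n$ of radius $r_{n+1}\ge\beta r_n$ disjoint from the $\varepsilon_n$-neighbourhood of $H_n$. A set $S\subset\mathbb{R}^d$ is hyperplane absolute winning if for every $0<\beta<1/3$ Alice has a strategy guaranteeing $\bigcap_n B_n\cap S\neq\emptyset$. Schmidt's $(\alpha,\beta)$-game ($0<\alpha,\beta<1$): Bob chooses a closed ball $B_0$, then the players alternate choosing closed balls $B_0\supset A_0\supset B_1\supset A_1\supset\cdots$ ($A_n$ chosen by Alice, $B_n$ by Bob) such that $A_n$ has radius $\alpha$ times that of $B_n$ and $B_{n+1}$ has radius $\beta$ times that of $A_n$. $S$ is winning if there is $\alpha\in(0,1)$ such that for every $\beta\in(0,1)$ Alice has a strategy guaranteeing that the point of $\bigcap_n B_n$ lies in $S$. *)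

(* Defs.v *)
From HB Require Import structures.
From mathcomp Require Import all_boot all_order all_algebra.
From mathcomp Require Import all_classical all_reals all_analysis.

Set Implicit Arguments.
Unset Strict Implicit.
Unset Printing Implicit Defensive.

Import Order.TTheory GRing.Theory Num.Theory.
Import numFieldNormedType.Exports.

Local Open Scope classical_set_scope.
Local Open Scope ring_scope.

Definition is_weight (R : realType) (d : nat) (w : 'I_d -> R) : Prop :=
  (forall i, 0 <= w i) /\ \sum_(i < d) w i = 1.

Definition distZ (R : realType) (x : R) : R :=
  inf (range (fun m : int => `|x - m%:~R|)).

(* [powR] does not give the convention |x|_Z^{1/0} := 0: since [0^-1 = 0], it
   would give |x|_Z^0 = 1. Hence the explicit test. *)
Definition distZ_pow (R : realType) (x w : R) : R :=
  if w == 0 then 0 else distZ x `^ w^-1.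

(* [limf_einf] asks for a [filteredType]; as for [nat], integers get the discrete
   topology. The neighbourhoods play no role in the definition of the limit. *)
HB.instance Definition _ := hasNbhs.Build int principal_filter.

(* The basic sets [|q| > N] exclude [q = 0], so a limit along this filter is a
   limit over nonzero integers of either sign. *)
Definition absz_pinfty : set_system int :=
  filter_from [set: nat] (fun N => [set q : int | (N < `|q|)%N]).

(* The terms of the maximum are nonnegative, so starting it at 0 is harmless
   when [0 < d]. *)
Definition Bad (R : realType) (d : nat) (theta : 'I_d -> R -> R)
    (w : 'I_d -> R) : set 'rV[R]_d :=
  [set x | (0 < limf_einf (fun q : int =>
     ((\big[Num.max/0]_(i < d)
         distZ_pow (q%:~R * x ord0 i - theta i (x ord0 i)) (w i))
       * `|q%:~R|)%:E) absz_pinfty)%E].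

(* The library norm on ['rV[R]_d] is the sup norm; the balls and neighbourhoods
   of the games are Euclidean. *)
Definition l2norm (R : realType) (d : nat) (x : 'rV[R]_d) : R :=
  Num.sqrt (\sum_(i < d) x ord0 i ^+ 2).

Record gball (R : realType) (d : nat) := GBall {
  center : 'rV[R]_d;
  radius : R
}.

Definition cball (R : realType) (d : nat) (B : gball R d) : set 'rV[R]_d :=
  [set x | l2norm (x - center B) <= radius B].

Definition affine_hyperplane (R : realType) (d : nat)
    (H : set 'rV[R]_d) : Prop :=
  exists (a : 'rV[R]_d) (c : R),
    a != 0 /\ H = [set x | \sum_(i < d) a ord0 i * x ord0 i = c].

Definition neighbourhood (R : realType) (d : nat) (H : set 'rV[R]_d)
    (e : R) : set 'rV[R]_d :=
  [set x | exists2 y, H y & l2norm (x - y) < e].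

(* Infinite two-player games in which the first player, Bob, plays
   b_0, b_1, ... and Alice answers each b_n by a_n. A strategy for Alice maps
   the sequence [:: b_0; ...; b_n] to a_n (her own earlier moves are determined
   by it). It is winning if, as long as Bob has respected the rules, Alice's
   answer respects them, and every infinite play in which Bob respects them
   satisfies the winning condition. *)
Definition alice_wins (bmove amove : Type) (start : bmove -> Prop)
    (arule : bmove -> amove -> Prop) (brule : bmove -> amove -> bmove -> Prop)
    (win : (nat -> bmove) -> Prop) : Prop :=
  exists sigma : seq bmove -> amove,
  forall b : nat -> bmove, start (b 0%N) ->
    let a n := sigma (mkseq b n.+1) in
    (forall n : nat,
       (forall k : nat, (k < n)%N -> brule (b k) (a k) (b k.+1)) ->
       arule (b n) (a n)) /\
    ((forall k : nat, brule (b k) (a k) (b k.+1)) -> win b).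

(* Alice's move is a pair (H_n, eps_n). *)
Definition hyperplane_absolute_winning (R : realType) (d : nat)
    (S : set 'rV[R]_d) : Prop :=
  forall beta : R, 0 < beta -> beta < 3^-1 ->
  alice_wins
    (fun B : gball R d => 0 < radius B)
    (fun (B : gball R d) (A : set 'rV[R]_d * R) =>
       affine_hyperplane A.1 /\ 0 < A.2 <= beta * radius B)
    (fun (B : gball R d) (A : set 'rV[R]_d * R) (B' : gball R d) =>
       [/\ cball B' `<=` cball B, beta * radius B <= radius B' &
           cball B' `&` neighbourhood A.1 A.2 = set0])
    (fun B : nat -> gball R d => (\bigcap_n cball (B n)) `&` S !=set0).

Definition schmidt_winning (R : realType) (d : nat)
    (S : set 'rV[R]_d) : Prop :=
  exists alpha : R, 0 < alpha < 1 /\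
  forall beta : R, 0 < beta < 1 ->
  alice_wins
    (fun B : gball R d => 0 < radius B)
    (fun B A : gball R d =>
       cball A `<=` cball B /\ radius A = alpha * radius B)
    (fun B A B' : gball R d =>
       cball B' `<=` cball A /\ radius B' = beta * radius A)
    (fun B : nat -> gball R d =>
       exists2 x, \bigcap_n cball (B n) = [set x] & S x).

(* Main.v *)
Require Import Defs.
From HB Require Import structures.
From mathcomp Require Import all_boot all_order all_algebra.
From mathcomp Require Import perm ring lra zify.
From mathcomp Require Import all_classical all_reals all_analysis.
(* Imported again because the analysis library has its own [center] and [radius]. *)
Import Defs.
Import Order.TTheory GRing.Theory Num.Theory.
Import numFieldNormedType.Exports.
Set Implicit Arguments.
Unset Strict Implicit.
Unset Printing Implicit Defensive.
Local Open Scope classical_set_scope.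
Local Open Scope ring_scope.

(* Only the coordinates with positive weight matter; let om and wm be the largest
   and smallest positive weights. In the ball of radius exp(-s) an integer vector
   v = (b, a), seen as the affine form z(y) = b + a.y, is measured by the maximum
   of exp(t) |z(y)| and of exp(-t_i) |a_i|, where t_i = min(w_i t, s - t).

   Homogeneous part: Alice keeps, for all s and t >= s / (1 + om), every nonzero v
   from being shorter than del exp(sig (t - s / (1 + om))). For this she lowers the
   rank of the vectors that are short somewhere on the ball one by one, from n to 0,
   in n rounds that end when the radius reaches exp(-s). If k + 1 independent
   vectors are short, the bound at earlier times and Minkowski's theorem show that
   the lattice they span has a large (k + 1)-volume; it is an affine function of y,
   so it is large off a thin neighbourhood of one hyperplane, which Alice removes.

   Inhomogeneous part: by transference, the homogeneous bound leaves boundedly many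
   pairs (q, p) with |q| of order exp(t), t = s / (1 + om), that can make
   q x - theta(x) - p small somewhere on the ball, and as theta is Lipschitz each
   of them is dangerous only near one hyperplane.

   The hyperplanes to remove have different widths and come in large numbers, so
   Alice plays a potential game: a fixed proportion of the total weight, the sum of
   width^gam over the slabs that meet the ball, can be removed in one move. *)

(** * Minkowski's theorem for independent columns *)

(** At each stage an unbounded range of times t has to be treated with a fixed budget of slabs. This
    is why the bound [del exp (sig (t - s / (1 + om)))] grows with t: a late time is prepared long
    in advance, with a lag proportional to its index j, and its slab is thinner by a factor
    exponential in that lag, so the costs form a geometric series in j. There is room for such
    growth because the covolume of the integer lattice is at least [exp (t - s / (1 + om))]. The
    gain comes from comparing stage s with stage s - m: either the volumes contract on the way back,
    or the way ends at a time for which a larger bound is known. A lag m wins [exp (sig / 2 * m)],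
    and this must pay for the constants, for the width of the slab and for the loss [exp (k m')] of
    working in a ball of radius [exp (m' - s)] instead of [exp (- s)]. Hence the lags of successive
    ranks form a geometric progression of large ratio A. The time [t = s / (1 + om)] is the last at
    which no exponent is cut, as [om t = s - t] there. *)

Lemma normr_det_le (R : realDomainType) k (A : 'M[R]_k) (b : 'I_k -> R) :
  (forall i j, `|A i j| <= b i) -> `|\det A| <= k`!%:R * \prod_i b i.
Proof.
move=> leAb; apply: (le_trans (ler_norm_sum _ _ _)).
have -> : k`!%:R * \prod_i b i = \sum_(s : 'S_k) \prod_i b i.
  by rewrite sumr_const card_Sn mulr_natl.
apply: ler_sum => s _; rewrite normrM normrX normrN1 expr1n mul1r normr_prod.
by apply: ler_prod => i _; rewrite normr_ge0 leAb.
Qed.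

Definition set_row_index k N (f : 'I_k -> 'I_N) (j : 'I_k) (r : 'I_N) :
  'I_k -> 'I_N := fun l => if l == j then r else f l.

Lemma det_set_row_index (R : comPzRingType) N k (X : 'M[R]_(N, k))
    (f : 'I_k -> 'I_N) j r :
  \det (rowsub (set_row_index f j r) X)
    = \sum_l X r l * cofactor (rowsub f X) j l.
Proof.
rewrite (expand_det_row _ j); apply: eq_bigr => l _.
rewrite mxE /set_row_index eqxx; congr (_ * (_ * \det _)).
by apply/matrixP => i i'; rewrite !mxE eq_sym (negPf (neq_lift _ _)).
Qed.

Lemma cramer_rowsub (R : fieldType) N k (X : 'M[R]_(N, k)) (f : 'I_k -> 'I_N) :
  \det (rowsub f X) != 0 ->
  X = (\matrix_(r, j) (\det (rowsub (set_row_index f j r) X)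
                         / \det (rowsub f X))) *m rowsub f X.
Proof.
move=> nz; set A := rowsub f X.
have uA : A \in unitmx by rewrite unitmxE unitfE.
suff -> : \matrix_(r, j) (\det (rowsub (set_row_index f j r) X) / \det A)
          = X *m invmx A by rewrite -mulmxA mulVmx // mulmx1.
apply/matrixP => r j; rewrite mxE det_set_row_index mxE mulr_suml.
by apply: eq_bigr => l _; rewrite /invmx uA !mxE mulrAC -mulrA.
Qed.

Lemma det_row_diag (R : comPzRingType) N k (X : 'M[R]_(N, k)) (mu : 'I_N -> R)
    (f : 'I_k -> 'I_N) :
  \det (rowsub f (\matrix_(r, l) (mu r * X r l)))
    = (\prod_j mu (f j)) * \det (rowsub f X).
Proof.
have -> : rowsub f (\matrix_(r, l) (mu r * X r l))
          = diag_mx (\row_j mu (f j)) *m rowsub f X.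
  by apply/matrixP => i j; rewrite mul_diag_mx !mxE.
by rewrite det_mulmx det_diag; congr (_ * _); apply: eq_bigr => j _; rewrite mxE.
Qed.

Lemma det_rowsub_not_inj (R : comPzRingType) N k (X : 'M[R]_(N, k))
    (f : 'I_k -> 'I_N) : ~ injective f -> \det (rowsub f X) = 0.
Proof.
move=> /injectiveP /injectivePn [i [j ij fij]].
by apply: (determinant_alternate ij) => l; rewrite !mxE fij.
Qed.

(* A box of h+1 integers per coordinate has more points than the index
   |det P| of the lattice P Z^k, which Smith's normal form computes. *)
Lemma integer_minkowski k (P : 'M[int]_k) (h : nat) :
  \det P != 0 -> (`|\det P| < h.+1 ^ k)%N ->
  exists2 c : 'cV[int]_k, c != 0 & forall i, `|(P *m c) i 0| <= h%:Z.
Proof.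
move=> nzP ltP.
have [L uL [R uR [d _ defP]]] := int_Smith_normal_form P.
pose e (i : 'I_k) : int := d`_i.
set D := \matrix_(i, j) _ in defP.
have defD : D = diag_mx (\row_i e i).
  by apply/matrixP => i j; rewrite !mxE; congr (_ *+ _); case: eqP => [->|];
    case: eqP => // [/val_inj|] ->.
have absu (M : 'M[int]_k) : M \in unitmx -> `|\det M|%N = 1%N.
  by rewrite unitmxE qualifE /= => /orP [] /eqP ->.
have detP : `|\det P|%N = (\prod_(i < k) `|e i|)%N.
  rewrite defP !det_mulmx !abszM (absu L uL) (absu R uR) mul1n muln1 defD det_diag.
  by rewrite (big_morph absz abszM absz1); apply: eq_bigr => i _; rewrite mxE.
have dn0 (i : 'I_k) : e i != 0.
  apply/eqP => di; move: nzP; rewrite -absz_eq0 detP (bigD1 i) //= di mul0n.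
  by rewrite eqxx.
pose B := (\max_(i < k) `|e i|)%N.
pose col (y : {ffun 'I_k -> 'I_h.+1}) : 'cV[int]_k := \col_i (y i : nat)%:Z.
(* [g y] is the class of [col y] modulo the lattice [P Z^k], read in Smith coordinates as residues
   modulo the elementary divisors. Two points of the box in one class differ by a lattice vector. *)
pose g y : {ffun 'I_k -> 'I_B.+1} :=
  [ffun i => inord `|((invmx L *m col y) i 0%R %% e i)%Z|%N].
pose Fam (i : 'I_k) := [pred x : 'I_B.+1 | (x < `|e i|)%N].
have dB (i : 'I_k) : (`|e i| <= B)%N by apply: leq_bigmax.
have lt_mod y (i : 'I_k) : (`|((invmx L *m col y) i 0%R %% e i)%Z| < `|e i|)%N.
  by rewrite -ltz_nat gez0_abs ?modz_ge0 // ltz_mod.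
have gFam y : g y \in family Fam.
  apply/familyP => i; rewrite ffunE inE /= inordK ?lt_mod //.
  by rewrite ltnS (leq_trans _ (dB i)) // ltnW // lt_mod.
have cardFam : #|family Fam| = `|\det P|%N.
  rewrite card_family detP foldrE big_map big_enum /=; apply: eq_bigr => i _.
  rewrite -[RHS](card_ord `|e i|) -sum1_card -[RHS]sum1_card.
  by rewrite (big_ord_widen B.+1 (fun=> 1%N)) // leqW.
have /injectivePn [y [y' yy' gyy']] : ~~ injectiveb g.
  apply/negP => /injectiveP injg; move: ltP.
  rewrite -{1}(card_ord h.+1) -[in (_ ^ k)%N](card_ord k) -card_ffun.
  rewrite ltnNge -cardFam -(card_imset predT injg) => /negP; apply.
  by apply: subset_leq_card; apply/fintype.subsetP => _ /imsetP [z _ ->].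
pose z : 'cV[int]_k := col y - col y'.
have dvd_z i : (e i %| (invmx L *m z) i 0%R)%Z.
  move/ffunP: gyy' => /(_ i); rewrite !ffunE => /(congr1 val) /=.
  rewrite !inordK ?ltnS ?(leq_trans (ltnW (lt_mod _ i)) (dB i)) // => eqm.
  have := congr1 Posz eqm; rewrite !gez0_abs ?modz_ge0 // => {}eqm.
  by rewrite mulmxBr mxE [X in _ + X]mxE -eqz_mod_dvd eqm.
pose t : 'cV[int]_k := \col_i ((invmx L *m z) i 0%R %/ e i)%Z.
have Dt : D *m t = invmx L *m z.
  by apply/colP => i; rewrite defD mul_diag_mx 2!mxE [t i 0]mxE mulrC divzK.
have Pz : P *m (invmx R *m t) = z.
  by rewrite defP -!mulmxA (mulmxA R) mulmxV // mul1mx Dt mulmxA mulmxV ?mul1mx.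
exists (invmx R *m t).
  apply: contraNneq yy' => c0; move: Pz; rewrite c0 mulmx0 => /esym/eqP.
  rewrite subr_eq0 => /eqP /colP eqc; apply/eqP/ffunP => i; apply/val_inj.
  by have := eqc i; rewrite !mxE => -[].
move=> i; rewrite Pz !mxE.
have := ltn_ord (y i); have := ltn_ord (y' i).
move: (nat_of_ord (y i)) (nat_of_ord (y' i)) => a b ha hb.
by rewrite ler_norml; apply/andP; split; lia.
Qed.

(* Minkowski's theorem on linear forms, with a crude constant: [A] is replaced
   by the integer matrix of the floors of [q * A] for a large [q]. *)
Lemma real_minkowski (R : realType) k (A : 'M[R]_k) (Y : R) : (0 < k)%N -> 0 <= Y ->
  \det A != 0 -> k`!%:R * 2 ^+ k * `|\det A| <= Y ^+ k ->
  exists2 c : 'cV[int]_k, c != 0 & forall i, `|(A *m map_mx intr c) i 0| <= 2 * Y.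
Proof.
move=> k0 Y0 nzA leY; pose B := invmx A.
have uA : A \in unitmx by rewrite unitmxE unitfE.
pose K := 1 + \sum_i \sum_j `|B i j|.
have K1 : 1 <= K by rewrite lerDl sumr_ge0 // => i _; rewrite sumr_ge0.
have leK i : \sum_j `|B i j| <= K.
  rewrite /K [X in 1 + X](bigD1 i) //= addrCA lerDl addr_ge0 ?ler01 // sumr_ge0 // => j _.
  by rewrite sumr_ge0.
(* The part [k * K] keeps [1 + F] invertible, by a maximal coordinate of a kernel vector; the part
   [2 * K] gives the factor 2 of the conclusion. *)
pose q : R := ((Num.truncn ((2 + k%:R) * K)).+1)%:R.
have ltq : (2 + k%:R) * K < q by apply: truncnS_gt.
have q0 : 0 < q by rewrite ltr0n.
pose P : 'M[int]_k := \matrix_(i, j) Num.floor (q * A i j).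
pose E : 'M[R]_k := map_mx intr P - q *: A.
have leE i j : `|E i j| <= 1.
  rewrite !mxE ler_norml; have /andP [h1 h2] := floor_itv (q * A i j).
  by rewrite intrD in h2; apply/andP; split; lra.
pose F := q^-1 *: (B *m E).
have leF i j : `|F i j| <= K / q.
  rewrite mxE normrM gtr0_norm ?invr_gt0 // mulrC ler_pM2r ?invr_gt0 // mxE.
  apply: le_trans (leK i); apply: (le_trans (ler_norm_sum _ _ _)).
  by apply: ler_sum => l _; rewrite normrM ler_piMr.
have defP : map_mx intr P = q *: (A *m (1%:M + F)).
  rewrite mulmxDr mulmx1 scalerDr -scalemxAr scalerA divff ?gt_eqF // scale1r.
  by rewrite mulmxA mulmxV // mul1mx addrC subrK.
have Kq : K / q <= 1.
  rewrite ler_pdivrMr // mul1r; apply: ltW; apply: le_lt_trans ltq.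
  by rewrite ler_peMl ?(le_trans ler01 K1) //; have := ler0n R k; lra.
have det1F : `|\det (1%:M + F)| <= k`!%:R * 2 ^+ k.
  have -> : 2 ^+ k = \prod_(i < k) (2 : R) by rewrite prodr_const card_ord.
  apply: normr_det_le => i j; rewrite !mxE; apply: (le_trans (ler_normD _ _)).
  apply: lerD; last by have := leF i j; rewrite !mxE => /le_trans; apply.
  by case: (i == j); rewrite ?mulr1n ?mulr0n ?normr1 ?normr0.
have nz1F : \det (1%:M + F) != 0.
  apply/det0P => -[v nzv v0].
  have /existsP [j0 _] : [exists j, v 0 j != 0].
    by apply: contra_neqT nzv => /existsPn v00; apply/rowP => j; rewrite mxE;
      apply/eqP; have := v00 j; rewrite negbK.
  have [j _ maxj] := @arg_maxP _ _ _ j0 predT (fun j => `|v 0 j|) isT.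
  have nzj : 0 < `|v 0 j|.
    rewrite lt_neqAle normr_ge0 andbT eq_sym; apply: contraNneq nzv => vj0.
    apply/eqP/rowP => i; rewrite mxE; apply/eqP; rewrite -normr_le0 -vj0.
    exact: maxj.
  have := congr1 (fun M : 'rV_k => M 0 j) v0.
  rewrite mulmxDr mulmx1 mxE [RHS]mxE => /eqP; rewrite addr_eq0 => /eqP vj.
  have : `|v 0 j| <= `|v 0 j| * (k%:R * (K / q)).
    rewrite {1}vj normrN mxE; apply: (le_trans (ler_norm_sum _ _ _)).
    have -> : `|v 0 j| * (k%:R * (K / q)) = \sum_(i < k) (`|v 0 j| * (K / q)).
      by rewrite sumr_const card_ord mulrCA mulr_natl.
    apply: ler_sum => i _; rewrite normrM.
    by apply: ler_pM => //; exact: maxj.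
  rewrite ler_pMr // mulrA ler_pdivlMr // mul1r leNgt => /negP; apply.
  by apply: le_lt_trans ltq; rewrite ler_wpM2r ?(le_trans ler01 K1) //; lra.
have detP : `|(\det P)%:~R| = q ^+ k * `|\det A| * `|\det (1%:M + F)| :> R.
  by rewrite -det_map_mx defP detZ det_mulmx !normrM normrX (gtr0_norm q0) mulrA.
pose h := Num.truncn (q * Y).
have qY0 : 0 <= q * Y by rewrite mulr_ge0 // ltW.
have [|| c nzc leh] := @integer_minkowski _ P h.
- apply/eqP => P0; move: detP; rewrite P0 normr0 => /esym/eqP.
  by rewrite !mulf_eq0 expf_eq0 !normr_eq0 (negPf nzA) (negPf nz1F) gt_eqF ?andbF.
- rewrite -(ltr_nat R) natrX natr_absz intr_norm detP.
  apply: (@le_lt_trans _ _ ((q * Y) ^+ k)); last first.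
    by rewrite ltrXn2r ?gtn_eqF ?nnegrE //; apply: truncnS_gt.
  rewrite exprMn -mulrA ler_wpM2l ?exprn_ge0 ?(ltW q0) //.
  by apply: le_trans leY; rewrite mulrC ler_wpM2r.
exists c => // i.
pose x : 'cV[R]_k := map_mx intr c.
have [i0 _ maxi0] := @arg_maxP _ _ _ (Ordinal k0) predT
  (fun i => `|(A *m x) i 0|) isT.
apply: le_trans (maxi0 i isT) _; set a := `|_|.
have lex : \sum_j `|x j 0| <= K * a.
  have -> : K * a = a + \sum_i (\sum_j `|B i j|) * a.
    by rewrite /K mulrDl mul1r mulr_suml.
  rewrite ler_wpDl ?normr_ge0 //; apply: ler_sum => l _.
  have -> : x = B *m (A *m x) by rewrite mulmxA mulVmx // mul1mx.
  rewrite mxE mulr_suml; apply: (le_trans (ler_norm_sum _ _ _)).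
  by apply: ler_sum => j _; rewrite normrM ler_wpM2l //; apply: maxi0.
have defA : q * (A *m x) i0 0 = (map_mx intr (P *m c) - E *m x) i0 0.
  suff -> : map_mx intr (P *m c) - E *m x = q *: (A *m x) by rewrite [RHS]mxE.
  by rewrite map_mxM mulmxBl opprB addrC subrK scalemxAl.
have lePc : `|map_mx intr (P *m c) i0 0| <= q * Y.
  have leh' : h%:R <= q * Y by rewrite truncn_le.
  by rewrite mxE -intr_norm; apply: le_trans leh'; rewrite [leRHS]pmulrn ler_int leh.
have leEx : `|(E *m x) i0 0| <= K * a.
  apply: le_trans lex; rewrite mxE; apply: (le_trans (ler_norm_sum _ _ _)).
  by apply: ler_sum => j _; rewrite normrM ler_piMl.
have : q * a <= q * Y + K * a.
  rewrite -(gtr0_norm q0) -normrM defA mxE (gtr0_norm q0).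
  apply: (le_trans (ler_normD _ _)); apply: lerD => //.
  by rewrite mxE normrN.
have a0 : 0 <= a by rewrite normr_ge0.
have : 2 * K * a <= q * a.
  rewrite ler_wpM2r // ltW //; apply: le_lt_trans ltq.
  rewrite ler_wpM2r ?(le_trans ler01 K1) //; have := ler0n R k; lra.
move=> h1 h2; have : q * a <= q * (2 * Y) by lra.
by rewrite ler_pM2l.
Qed.

(* Choosing the rows of a largest minor makes every other row a combination
   of these with coefficients at most 1. *)
Lemma short_vector (R : realType) N k (X : 'M[R]_(N, k)) (D Y : R) :
  (0 < k)%N -> 0 <= Y -> (exists f, \det (rowsub f X) != 0) ->
  (forall f, `|\det (rowsub f X)| <= D) -> k`!%:R * 2 ^+ k * D <= Y ^+ k ->
  exists2 c : 'cV[int]_k, c != 0 &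
    forall r, `|(X *m map_mx intr c) r 0| <= k%:R * (2 * Y).
Proof.
move=> k0 Y0 [f1 nzf1] leD leY.
have [f _ maxf] := @arg_maxP _ _ _ [ffun j => f1 j] predT
  (fun f : {ffun 'I_k -> 'I_N} => `|\det (rowsub f X)|) isT.
have maxf' g : `|\det (rowsub g X)| <= `|\det (rowsub f X)|.
  suff -> : rowsub g X = rowsub [ffun j => g j] X by apply: maxf.
  by apply/matrixP => i j; rewrite !mxE ffunE.
have nzf : \det (rowsub f X) != 0.
  by rewrite -normr_gt0 (lt_le_trans _ (maxf' f1)) // normr_gt0.
have [|c nzc lec] := real_minkowski k0 Y0 nzf.
  apply: le_trans leY; apply: ler_wpM2l; last exact: leD.
  by rewrite mulr_ge0 ?ler0n ?exprn_ge0.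
exists c => // r; rewrite (cramer_rowsub nzf) -mulmxA mxE.
apply: (le_trans (ler_norm_sum _ _ _)).
have -> : k%:R * (2 * Y) = \sum_(i < k) (2 * Y).
  by rewrite sumr_const card_ord mulr_natl.
apply: ler_sum => j _; rewrite normrM -[leRHS]mul1r.
apply: ler_pM => //; rewrite mxE normrM normfV ler_pdivrMr ?normr_gt0 //.
by rewrite mul1r maxf'.
Qed.

(** * Short vectors and their volumes along the flow *)

Section Lattice.
Context {R : realType} (n : nat) (w : 'I_n -> R).

(* The exponent [w i * t] of the weighted flow is cut at [s - t] so that moving y by
   at most exp(-s) changes exp(t) |z(y)| by at most the sum of the exp(-texp i) |a_i|. *)
Definition texp (t s : R) (i : 'I_n) : R := Num.min (w i * t) (s - t).

Definition scale_exp (t s : R) (r : 'I_n.+1) : R :=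
  oapp (fun i => - texp t s i) t (unlift ord0 r).

Definition shear (y : 'I_n -> R) : 'M[R]_n.+1 :=
  \matrix_(r, l) if r == ord0 then oapp y 1 (unlift ord0 l) else (r == l)%:R.

(* Row 0 holds the values at y of the affine forms given by the columns of V, the
   other rows their gradients. *)
Definition flow (t s : R) (y : 'I_n -> R) k (V : 'M[int]_(n.+1, k)) :
    'M[R]_(n.+1, k) :=
  \matrix_(r, l) (expR (scale_exp t s r) * (shear y *m map_mx intr V) r l).

Lemma scale_exp0 t s : scale_exp t s ord0 = t.
Proof. by rewrite /scale_exp unlift_none. Qed.

Lemma scale_exp_lift t s i : scale_exp t s (lift ord0 i) = - texp t s i.
Proof. by rewrite /scale_exp liftK. Qed.

Lemma flow_scale t s t' s' y k (V : 'M[int]_(n.+1, k)) :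
  flow t' s' y V = \matrix_(r, l)
    (expR (scale_exp t' s' r - scale_exp t s r) * flow t s y V r l).
Proof.
apply/matrixP => r l; rewrite !mxE mulrA; congr (_ * _).
by rewrite -expRD subrK.
Qed.

Lemma flow_mul t s y k l (V : 'M[int]_(n.+1, k)) (c : 'M[int]_(k, l)) :
  flow t s y (V *m c) = flow t s y V *m map_mx intr c.
Proof.
apply/matrixP => r j; rewrite mxE map_mxM mulmxA mxE mulr_sumr [RHS]mxE.
by apply: eq_bigr => i _; rewrite [flow _ _ _ _ _ _]mxE mulrA.
Qed.

(** At most n distinct indices out of n + 1 miss some [r0], and the omitted terms are
    nonnegative. *)
Lemma sum_inj_le (nu : 'I_n.+1 -> R) k (f : 'I_k -> 'I_n.+1) (B : R) :
  (k <= n)%N -> injective f -> (forall r, 0 <= nu r) ->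
  (forall r0, \sum_(r | r != r0) nu r <= B) -> \sum_j nu (f j) <= B.
Proof.
move=> kn injf nu0 leB.
have [r0 r0f] : exists r0, r0 \notin codom f.
  apply/existsP; rewrite -negb_forall; apply/negP => /forallP cf.
  suff : n.+1 = k by move=> nk; move: kn; rewrite -nk ltnn.
  rewrite -[RHS]card_ord -(card_codom injf) -[LHS]card_ord.
  by apply: eq_card => r; rewrite cf.
have -> : \sum_j nu (f j) = \sum_(r in codom f) nu r.
  by rewrite -big_uniq ?big_image //= codomE map_inj_uniq ?enum_uniq.
apply: le_trans (leB r0).
rewrite [leRHS](bigID (mem (codom f))) /=.
rewrite [X in _ <= X + _](eq_bigl (mem (codom f))); last first.
  move=> r /=; case: (boolP (r \in codom f)); rewrite ?andbF ?andbT //= => rf.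
  by apply: contraNneq r0f => <-.
by rewrite lerDl sumr_ge0.
Qed.

(* The k-volumes of the lattice spanned by V, measured at (t, s), are at most M;
   they are at most M exp(- kap m) if the coordinate 0 is not involved. Along
   the path (t - kap m t / s, s - m) all of them contract. *)
Section Contraction.
Context (k : nat) (V : 'M[int]_(n.+1, k)) (y : 'I_n -> R) (t s m M : R).
Hypotheses (s0 : 0 < s) (m0 : 0 < m) (ms : m <= s) (t0 : 0 <= t) (ts : t <= s).
Hypothesis w0 : forall i, 0 <= w i.
Let X := flow t s y V.
Hypothesis M0 : 0 <= M.
Hypothesis XM : forall f, `|\det (rowsub f X)| <= M.
Hypothesis XMg : forall f j i, (forall l, f l != ord0) -> f j = lift ord0 i ->
  `|\det (rowsub f X)| * expR (texp t s i + t - (s - m)) <= M.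

(** On the full way back, to [t - m * t / s] and [s - m], the exponent of row r rises by at most
    [m / s * nu r], less m if r is row 0. By [sum_nu_le] the sum of [nu] over any k rows leaves a
    margin [c0 * s] below s. *)
Let nu (r : 'I_n.+1) : R := oapp (fun i => texp t s i + m) (s - t) (unlift ord0 r).

Let texp_ge0 i : 0 <= texp t s i.
Proof. by rewrite le_min mulr_ge0 //= subr_ge0. Qed.

(** A minor through row 0 gets the factor [exp (- m)] from the lowered time in that row; the minors
    off row 0 have it by hypothesis. *)
Lemma contraction_scaled :
  (forall f, (forall l, f l != ord0) -> `|\det (rowsub f X)| <= M * expR (- m)) ->
  forall f, `|\det (rowsub f (flow (t - m * t / s) (s - m) y V))|
    <= M * expR (- m + m / s * \sum_j nu (f j)).
Proof.
move=> small f; rewrite (flow_scale t s) det_row_diag normrM normr_prod.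
under eq_bigr do rewrite gtr0_norm ?expR_gt0 //.
have sc r : scale_exp (t - m * t / s) (s - m) r - scale_exp t s r
            <= m / s * nu r - m *+ (r == ord0).
  case: (unliftP ord0 r) => [i|] ->; rewrite ?scale_exp0 ?scale_exp_lift /nu.
    rewrite liftK /= mulr0n subr0 opprK.
    have -> : texp (t - m * t / s) (s - m) i = (1 - m / s) * texp t s i.
      rewrite /texp minr_pMr ?subr_ge0 ?ler_pdivrMr ?mul1r //.
      by congr Num.min; field; rewrite gt_eqF.
    rewrite mulrDr mulrBl mul1r opprB subrK lerDl.
    by rewrite mulr_ge0 ?divr_ge0 // ltW.
  rewrite unlift_none /= mulr1n le_eqVlt; apply/orP; left; apply/eqP.
  by field; rewrite gt_eqF.
have prodE : \prod_j expR (scale_exp (t - m * t / s) (s - m) (f j)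
    - scale_exp t s (f j)) <= expR (m / s * \sum_j nu (f j) - m *+ [exists j, f j == ord0]).
  rewrite -expR_sum ler_expR; apply: (le_trans (ler_sum _ (fun j _ => sc (f j)))).
  rewrite big_split /= -mulr_sumr lerD2l sumrN lerN2.
  case: existsP => [[j fj]|_]; rewrite ?mulr1n ?mulr0n.
    rewrite (bigD1 j) //= fj mulr1n lerDl sumr_ge0 // => l _.
    by rewrite mulrn_wge0 // ltW.
  by rewrite sumr_ge0 // => l _; rewrite mulrn_wge0 // ltW.
have [j0|no0] := boolP [exists j, f j == ord0].
  rewrite j0 mulr1n in prodE; rewrite mulrC; apply: ler_pM => //.
  - exact: prodr_ge0.
  - by rewrite (addrC (- m)).
rewrite (negPf no0) mulr0n subr0 in prodE.
rewrite expRD mulrA [leRHS]mulrC; apply: ler_pM => //; first exact: prodr_ge0.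
by apply: small => l; apply: contraNneq no0 => fl; apply/existsP; exists l; rewrite fl.
Qed.

(** The lattice is written as a graph over the rows of its largest minor W off row 0. Cramer's
    coefficients are at most 1 off row 0 and at most [M / W = exp (kap * m)] on row 0; the time is
    lowered just enough to compensate this last factor. *)
Lemma contraction_graph (kap : R) (g : {ffun 'I_k -> 'I_n}) :
  0 <= kap <= 1 ->
  (forall g' : {ffun 'I_k -> 'I_n}, `|\det (rowsub (lift ord0 \o g') X)|
     <= `|\det (rowsub (lift ord0 \o g) X)|) ->
  0 < M -> `|\det (rowsub (lift ord0 \o g) X)| = M * expR (- (kap * m)) ->
  forall f, `|\det (rowsub f (flow (t - kap * m * t / s) (s - m) y V))|
    <= k`!%:R * (M * expR (- (kap * m) + kap * m / s * \sum_j nu (f j))).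
Proof.
move=> /andP [kap0 kap1] maxg Mpos defW f.
pose f0 : 'I_k -> 'I_n.+1 := lift ord0 \o g.
set W := `|\det (rowsub (lift ord0 \o g) X)| in maxg defW.
have Wpos : 0 < W by rewrite defW mulr_gt0 ?expR_gt0.
have nzf0 : \det (rowsub f0 X) != 0 by rewrite -normr_gt0.
set mu := fun r => expR (scale_exp (t - kap * m * t / s) (s - m) r - scale_exp t s r).
pose C := \matrix_(r, j) (\det (rowsub (set_row_index f0 j r) X) / \det (rowsub f0 X)).
have -> : rowsub f (flow (t - kap * m * t / s) (s - m) y V)
    = (\matrix_(j, l) (mu (f j) * C (f j) l)) *m rowsub f0 X.
  rewrite (flow_scale t s) -/X [X in LHS](cramer_rowsub nzf0) -/C.
  apply/matrixP => j l; rewrite !mxE mulr_sumr.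
  by apply: eq_bigr => l' _; rewrite [in RHS]mxE mulrA.
have leC r l : `|mu r * C r l| <= expR (kap * m / s * nu r).
  rewrite normrM gtr0_norm ?expR_gt0 // mxE normrM normfV -/W -/f0.
  set Z := `|\det (rowsub (set_row_index f0 l r) X)|.
  have MW : M / W = expR (kap * m).
    by rewrite defW invfM mulrA divff ?gt_eqF // mul1r expRN invrK.
  rewrite /mu; case: (unliftP ord0 r) => [i|] er; last first.
    rewrite er scale_exp0 scale_exp0 /nu unlift_none /=.
    have ZM : Z / W <= expR (kap * m).
      by rewrite -MW ler_pM2r ?invr_gt0 // /Z XM.
    apply: le_trans (ler_wpM2l (expR_ge0 _) ZM) _.
    rewrite -expRD ler_expR le_eqVlt; apply/orP; left; apply/eqP.
    by field; rewrite gt_eqF.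
  have Z1 : Z / W <= 1.
    rewrite ler_pdivrMr // mul1r.
    have := maxg [ffun j => if j == l then i else g j].
    suff -> : rowsub (lift ord0 \o [ffun j => if j == l then i else g j]) X
              = rowsub (set_row_index f0 l r) X by [].
    apply/matrixP => j j'; rewrite !mxE /= ffunE /set_row_index er /f0 /=.
    by case: (j == l).
  have Zg : Z / W <= expR (kap * m - (texp t s i + t - (s - m))).
    rewrite expRD -MW expRN mulrAC ler_pM2r ?invr_gt0 //.
    rewrite ler_pdivlMr ?expR_gt0 //.
    apply: (XMg (j := l)) => [j|]; rewrite /set_row_index ?eqxx //.
    by case: (j == l); rewrite ?er /f0 /=.
  have Z0 : 0 <= Z / W by rewrite divr_ge0 ?normr_ge0 // ltW.
  rewrite er !scale_exp_lift /nu liftK /= opprK.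
  have km0 : 0 <= kap * m by rewrite mulr_ge0 // ltW.
  have kms : kap * m / s <= 1.
    by rewrite ler_pdivrMr // mul1r (le_trans _ ms) // ler_piMl // ltW.
  have kms0 : 0 <= kap * m / s by rewrite divr_ge0 // ltW.
  have tms : kap * m * t / s = kap * m / s * t by rewrite mulrAC.
  have stE : kap * m - kap * m / s * t = kap * m / s * (s - t).
    by field; rewrite gt_eqF.
  have ti0 := texp_ge0 i.
  have tiw : texp t s i <= w i * t by rewrite ge_min lexx.
  rewrite [texp (t - _) _ _]/texp minElt tms; case: ifP => _.
    apply: le_trans (ler_wpM2l (expR_ge0 _) Z1) _; rewrite mulr1 ler_expR.
    have : kap * m / s * (w i * t - texp t s i) <= w i * t - texp t s i.
      by rewrite ler_piMl // subr_ge0.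
    have : 0 <= kap * m / s * m by rewrite mulr_ge0 // ltW.
    rewrite !mulrDr !mulrN; have -> : w i * (kap * m / s * t) = kap * m / s * (w i * t) by ring.
    lra.
  (* Here the cut is active. The radius goes back by the full m, the time only by [kap * m * t / s],
     so the cut may have become stronger than the coefficient bound 1 allows; the bound [Zg], which
     comes from [XMg], compensates for it. *)
  have [le_st|lt_st] := leP (s - t) (texp t s i + m).
    apply: le_trans (ler_wpM2l (expR_ge0 _) Zg) _; rewrite -expRD ler_expR.
    apply: (@le_trans _ _ (kap * m / s * (s - t))); first by rewrite -stE; lra.
    by rewrite ler_wpM2l.
  apply: le_trans (ler_wpM2l (expR_ge0 _) Z1) _; rewrite mulr1 ler_expR.
  have : 0 <= kap * m / s * (texp t s i + m) by rewrite mulr_ge0 ?addr_ge0 // ltW.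
  have : 0 <= kap * m / s * t by rewrite mulr_ge0.
  lra.
rewrite det_mulmx normrM -/f0 -/W.
have leD : `|\det (\matrix_(j, l) (mu (f j) * C (f j) l))|
    <= k`!%:R * expR (kap * m / s * \sum_j nu (f j)).
  rewrite mulr_sumr expR_sum; apply: normr_det_le => j l.
  by rewrite mxE leC.
apply: le_trans (ler_wpM2r (ltW Wpos) leD) _.
by rewrite expRD [M * _]mulrA -defW; rewrite le_eqVlt; apply/orP; left; apply/eqP; ring.
Qed.
(** One row can be left out. Without row 0 the sum is at most [t + n m]. Without row i, the [- t] in
    [nu] of row 0 cancels the sum of all [w l * t], and what remains is at most [s + n m - w i * t].
    The two hypotheses treat these two cases. *)
Lemma sum_nu_le (c0 : R) (f : 'I_k -> 'I_n.+1) : injective f -> (k <= n)%N -> \sum_i w i = 1 ->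
  t + n%:R * m <= s - c0 * s -> (forall i, c0 * s + n%:R * m <= w i * t) ->
  \sum_j nu (f j) <= s - c0 * s.
Proof.
move=> injf kn w1 tns c0w; apply: sum_inj_le => // r.
  rewrite /nu; case: (unliftP ord0 r) => [i|] _ /=.
    by rewrite addr_ge0 // ltW.
  by rewrite subr_ge0.
have sumw : \sum_i (w i * t + m) = t + n%:R * m.
  by rewrite big_split /= -mulr_suml w1 mul1r sumr_const card_ord mulr_natl.
have texp_le i : texp t s i + m <= w i * t + m by rewrite lerD2r ge_min lexx.
case: (unliftP ord0 r) => [i|] ->.
  have -> : \sum_(r0 | r0 != lift ord0 i) nu r0 = \sum_r0 nu r0 - nu (lift ord0 i).
    by rewrite [in RHS](bigD1 (lift ord0 i)) //= addrAC subrr add0r.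
  rewrite lerBlDl.
  rewrite big_ord_recl /nu unlift_none liftK /=.
  under eq_bigr do rewrite liftK /=.
  rewrite (bigD1 i) //= addrCA lerD2l.
  have : \sum_(l | l != i) (texp t s l + m) <= \sum_(l | l != i) (w l * t + m).
    by apply: ler_sum => l _; apply: texp_le.
  move: sumw; rewrite (bigD1 i) //= => sumw.
  by have := c0w i; have := m0; lra.
rewrite big_mkcond big_ord_recl /= add0r.
under eq_bigr do rewrite /nu liftK /=.
by apply: le_trans tns; rewrite -sumw; apply: ler_sum => i _; apply: texp_le.
Qed.
(** The extent kap of the way back is dictated by the largest volume W off row 0: it solves
    [W = M exp (- kap m)], and it is 1 if W is even smaller than [M exp (- m)]. *)
Lemma contraction (c0 : R) : (k <= n)%N -> \sum_i w i = 1 ->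
  t + n%:R * m <= s - c0 * s -> (forall i, c0 * s + n%:R * m <= w i * t) ->
  exists2 kap, 0 <= kap <= 1 &
    forall f, `|\det (rowsub f (flow (t - kap * m * t / s) (s - m) y V))|
      <= k`!%:R * (M * expR (- (c0 * (kap * m)))).
Proof.
move=> kn w1 tns c0w.
suff [kap kap01 le_det] : exists2 kap, 0 <= kap <= 1 &
    forall f, `|\det (rowsub f (flow (t - kap * m * t / s) (s - m) y V))|
    <= k`!%:R * (M * expR (- (kap * m) + kap * m / s * \sum_j nu (f j))).
  exists kap => // f; case/andP: (kap01) => kap0 _.
  have [injf|ninjf] := pselect (injective f); last first.
    rewrite (det_rowsub_not_inj _ ninjf) normr0.
    by rewrite mulr_ge0 // mulr_ge0 ?expR_ge0.
  apply: le_trans (le_det f) _; rewrite ler_wpM2l // ler_wpM2l // ler_expR.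
  have km0 : 0 <= kap * m / s by rewrite divr_ge0 ?mulr_ge0 // ltW.
  have := ler_wpM2l km0 (sum_nu_le injf kn w1 tns c0w).
  rewrite [X in _ <= X -> _](_ : _ = kap * m - c0 * (kap * m)); first by lra.
  by field; rewrite gt_eqF.
have [small|] := boolP [forall g : {ffun 'I_k -> 'I_n},
    `|\det (rowsub (lift ord0 \o g) X)| <= M * expR (- m)].
  exists 1; rewrite ?lexx ?ler01 // => f; rewrite mul1r.
  apply: (@le_trans _ _ (M * expR (- m + m / s * \sum_j nu (f j)))).
    apply: contraction_scaled => {}f f0.
    have [g fg] : exists g : {ffun 'I_k -> 'I_n}, f =1 lift ord0 \o g.
      have lf l : exists i : 'I_n, f l == lift ord0 i.
        by case: (unliftP ord0 (f l)) (f0 l) => [i ->|->]; [exists i|rewrite eqxx].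
      exists [ffun l => xchoose (lf l)] => l /=.
      by rewrite ffunE; apply/eqP/(xchooseP (lf l)).
    have := forallP small g; congr (`|\det _| <= _).
    by apply/matrixP => i j; rewrite !mxE fg.
  by rewrite ler_peMl ?mulr_ge0 ?expR_ge0 // ler1n fact_gt0.
rewrite negb_forall => /existsP [g1]; rewrite -ltNge => lt_g1.
have [g _ maxg] := @arg_maxP _ _ _ g1 predT
  (fun g : {ffun 'I_k -> 'I_n} => `|\det (rowsub (lift ord0 \o g) X)|) isT.
set W := `|_| in maxg.
have ltW_ : M * expR (- m) < W by apply: lt_le_trans lt_g1 (maxg _ isT).
have W0 : 0 < W by apply: le_lt_trans ltW_; rewrite mulr_ge0 ?expR_ge0.
have Mpos : 0 < M by apply: lt_le_trans W0 (XM _).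
have kap01 : 0 <= ln (M / W) / m <= 1.
  rewrite divr_ge0 ?ln_ge0 ?ler_pdivlMr ?mul1r ?XM //= ?(ltW m0) //.
  rewrite ler_pdivrMr // mul1r -ler_expR lnK ?posrE ?divr_gt0 //.
  by rewrite ler_pdivrMr // mulrC -ler_pdivrMr ?expR_gt0 // -expRN ltW.
exists (ln (M / W) / m) => //.
have kmE : ln (M / W) / m * m = ln (M / W) by rewrite divfK // gt_eqF.
apply: (contraction_graph (g := g)) => //.
  by move=> g'; apply: maxg.
by rewrite kmE expRN lnK ?posrE ?divr_gt0 // invf_div mulrCA divff ?gt_eqF ?mulr1.
Qed.
End Contraction.
End Lattice.

(** * Lower bounds for volumes from an earlier stage *)

Section Gain.
Context {R : realType} (n : nat) (w : 'I_n -> R).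

Definition small (t s : R) (y : 'I_n -> R) (rho : R) (v : 'cV[int]_n.+1) : Prop :=
  forall r, `|flow w t s y v r 0| <= rho.

(* If the minors were all smaller than M, the columns would span a vector too short
   for the bound at the earlier time [s - m]. *)
Lemma volume_gain k (V : 'M[int]_(n.+1, k)) (y : 'I_n -> R)
    (t s m M del sig om c0 : R) :
  (0 < k <= n)%N -> (forall i, 0 <= w i) -> \sum_i w i = 1 -> 0 <= om <= 1 ->
  0 < s -> 0 < m -> m <= s -> s / (1 + om) <= t -> 0 <= c0 ->
  t + n%:R * m <= s - c0 * s -> (forall i, c0 * s + n%:R * m <= w i * t) ->
  0 <= del -> 0 <= sig -> n.+1%:R * sig <= 2 * c0 ->
  (forall t', (s - m) / (1 + om) <= t' -> forall v, v != 0 ->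
     ~ small t' (s - m) y (del * expR (sig * (t' - (s - m) / (1 + om)))) v) ->
  (exists f, \det (rowsub f (flow w t s y V)) != 0) ->
  0 <= M -> (forall f, `|\det (rowsub f (flow w t s y V))| <= M) ->
  (forall f j i, (forall l, f l != ord0) -> f j = lift ord0 i ->
    `|\det (rowsub f (flow w t s y V))| * expR (texp w t s i + t - (s - m)) <= M) ->
  (del * expR (sig * (t - s / (1 + om))) / (2 * k%:R)) ^+ k * expR (sig / 2 * m)
    <= k`!%:R * 2 ^+ k * k`!%:R * M.
Proof.
move=> /andP [k0 kn] w0 w1 /andP [om0 om1] s0 m0 ms lt c00 tns c0w del0 sig0 sigc.
move=> noP [f0 nzf0] M0 XM XMg.
have om1' : 0 < 1 + om by lra.
have t0 : 0 <= t by apply: le_trans lt; rewrite divr_ge0 // ltW.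
have ts : t <= s.
  by have : 0 <= c0 * s + n%:R * m by [rewrite addr_ge0 // mulr_ge0 // ltW]; lra.
have [kap /andP [kap0 kap1] leD] :=
  contraction s0 m0 ms t0 ts w0 M0 XM XMg kn w1 tns c0w.
set t' := t - kap * m * t / s in leD.
have lt' : (s - m) / (1 + om) <= t'.
  have -> : t' = (s - kap * m) / s * t by rewrite /t'; field; rewrite gt_eqF.
  apply: (@le_trans _ _ ((s - m) / s * (s / (1 + om)))).
    by rewrite mulrA divfK // gt_eqF.
  apply: ler_pM => //; rewrite ?divr_ge0 ?subr_ge0 // ?(ltW s0) ?(ltW om1') //.
  by rewrite ler_pM2r ?invr_gt0 // lerD2l lerN2 ler_piMl // ltW.
set zeta := t' - (s - m) / (1 + om).
(* As [om <= 1], going back by m lowers [s / (1 + om)] by at least [m / 2], while the time drops by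
   at most [kap * m]. *)
have zetaE : t - s / (1 + om) + (m / 2 - kap * m) <= zeta.
  have : m / 2 <= m / (1 + om).
    by rewrite ler_pM2l // lef_pV2 ?posrE //; lra.
  have : kap * m * t / s <= kap * m.
    rewrite ler_pdivrMr // ler_wpM2l //; by rewrite mulr_ge0 // ltW.
  by rewrite /zeta /t' mulrBl; lra.
pose Y := del * expR (sig * zeta) / (2 * k%:R).
have Y0 : 0 <= Y by rewrite divr_ge0 ?mulr_ge0 ?expR_ge0.
have ltY : Y ^+ k < k`!%:R * 2 ^+ k * (k`!%:R * (M * expR (- (c0 * (kap * m))))).
  rewrite ltNge; apply/negP => leY.
  have [|c nzc small_c] := short_vector k0 Y0 _ leD leY.
    exists f0; rewrite (flow_scale w t s) det_row_diag mulf_neq0 //.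
    by apply/prodf_neq0 => j _; rewrite gt_eqF // expR_gt0.
  apply: (noP t' lt' (V *m c)).
    apply: contraNneq nzc => Vc0.
    have Xc0 : flow w t s y V *m map_mx intr c = 0.
      by rewrite -flow_mul Vc0; apply/matrixP => r l; rewrite !mxE big1 ?mulr0 // => i _;
        rewrite !mxE mulr0.
    have uX : rowsub f0 (flow w t s y V) \in unitmx by rewrite unitmxE unitfE.
    have := mulKmx uX (map_mx intr c).
    rewrite mul_rowsub_mx Xc0 (_ : rowsub f0 0 = 0); last by apply/matrixP => ? ?; rewrite !mxE.
    rewrite mulmx0 => /matrixP c0'; apply/eqP/matrixP => i j.
    by have /eqP := c0' i j; rewrite !mxE eq_sym intr_eq0 => /eqP.
  move=> r; rewrite flow_mul; apply: le_trans (small_c r) _.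
  rewrite /Y le_eqVlt; apply/orP; left; apply/eqP; field.
  by rewrite pnatr_eq0 -lt0n.
set Y1 := del * _ / _.
have Y10 : 0 <= Y1 by rewrite divr_ge0 ?mulr_ge0 ?expR_ge0.
have leY1 : Y1 * expR (sig * (m / 2 - kap * m)) <= Y.
  rewrite /Y1 /Y mulrAC ler_pM2r ?invr_gt0 ?mulr_gt0 ?ltr0n //.
  rewrite -mulrA ler_wpM2l // -expRD ler_expR -mulrDr ler_wpM2l //.
have leYk : Y1 ^+ k * expR (k%:R * (sig * (m / 2 - kap * m))) <= Y ^+ k.
  by rewrite expRM_natl -exprMn lerXn2r // nnegrE mulr_ge0 ?expR_ge0.
(* The exponent is affine in kap. At kap = 0 the gain comes from the larger bound known at the
   earlier stage, at kap = 1 from the contraction of the volumes, where [(k + 1) sig <= 2 c0] is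
   needed. *)
have leE : sig / 2 * m <= k%:R * (sig * (m / 2 - kap * m)) + c0 * (kap * m).
  have k1 : 1 <= k%:R :> R by rewrite ler1n.
  have kn' : k%:R <= n%:R :> R by rewrite ler_nat.
  have h1 : (k%:R + 1) * sig <= 2 * c0.
    by apply: le_trans sigc; rewrite ler_wpM2r // -[n.+1%:R]natr1 lerD2r.
  have h2 : 0 <= (2 * c0 - (k%:R + 1) * sig) * (kap * m).
    by rewrite mulr_ge0 ?subr_ge0 ?mulr_ge0 // ltW.
  have h3 : 0 <= (k%:R - 1) * sig * ((1 - kap) * m).
    by rewrite !mulr_ge0 ?subr_ge0 // ltW.
  lra.
apply: (@le_trans _ _ (Y ^+ k * expR (c0 * (kap * m)))).
  apply: (@le_trans _ _ (Y1 ^+ k * expR (k%:R * (sig * (m / 2 - kap * m)) + c0 * (kap * m)))).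
    by rewrite ler_wpM2l ?exprn_ge0 // ler_expR.
  by rewrite expRD mulrA ler_wpM2r ?expR_ge0.
rewrite -ler_pdivlMr ?expR_gt0 // -expRN; apply: le_trans (ltW ltY) _.
by rewrite !mulrA.
Qed.
End Gain.

(** * Escaping from short vectors through a hyperplane *)

Section Obstacle.
Context {R : realType} (n : nat) (w : 'I_n -> R).

Lemma flow_ord0 t s y k (V : 'M[int]_(n.+1, k)) j :
  flow w t s y V ord0 j
    = expR t * ((V ord0 j)%:~R + \sum_i y i * (V (lift ord0 i) j)%:~R).
Proof.
rewrite mxE scale_exp0 mxE big_ord_recl !mxE eqxx unlift_none mul1r.
by congr (_ * (_ + _)); apply: eq_bigr => i _; rewrite !mxE /= liftK.
Qed.

Lemma flow_lift t s y k (V : 'M[int]_(n.+1, k)) i j :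
  flow w t s y V (lift ord0 i) j
    = expR (- texp w t s i) * (V (lift ord0 i) j)%:~R.
Proof.
rewrite mxE scale_exp_lift mxE (bigD1 (lift ord0 i)) //= !mxE eqxx mul1r.
rewrite big1 ?addr0 // => l; rewrite !mxE /= eq_sym => /negPf ->.
by rewrite mul0r.
Qed.

Lemma flow_col t s y k (V : 'M[int]_(n.+1, k)) j r :
  flow w t s y (col j V) r 0 = flow w t s y V r j.
Proof.
rewrite !mxE; congr (_ * _).
by apply: eq_bigr => i _; rewrite !mxE.
Qed.

Lemma flow_shift t s y y' k (V : 'M[int]_(n.+1, k)) j :
  flow w t s y' V ord0 j = flow w t s y V ord0 j + \sum_i (y' i - y i)
    * expR (t + texp w t s i) * flow w t s y V (lift ord0 i) j.
Proof.
rewrite !flow_ord0 !mulrDr -addrA; congr (_ + _).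
rewrite !mulr_sumr -big_split /=; apply: eq_bigr => i _.
rewrite flow_lift; set a := (V _ _)%:~R.
have -> : (y' i - y i) * expR (t + texp w t s i) * (expR (- texp w t s i) * a)
    = (y' i - y i) * a * (expR (t + texp w t s i) * expR (- texp w t s i)) by ring.
by rewrite -expRD addrK; ring.
Qed.

(** Only row 0 depends on y, and affinely. The gradient of a minor through row 0 therefore consists
    of the minors in which row 0 is exchanged for another row; these are the quantities that [XMg]
    weighs in the contraction. *)
Lemma det_flow_shift t s y y' k (V : 'M[int]_(n.+1, k))
    (f : 'I_k -> 'I_n.+1) j0 : injective f -> f j0 = ord0 ->
  \det (rowsub f (flow w t s y' V)) = \det (rowsub f (flow w t s y V))
    + \sum_i (y' i - y i) * (expR (t + texp w t s i)
       * \det (rowsub (set_row_index f j0 (lift ord0 i)) (flow w t s y V))).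
Proof.
move=> injf fj0.
have same X : rowsub f X = rowsub (set_row_index f j0 ord0) X :> 'M[R]_k.
  apply/matrixP => i j; rewrite !mxE /set_row_index.
  by case: eqP => [->|//]; rewrite fj0.
have cof l : cofactor (rowsub f (flow w t s y' V)) j0 l
           = cofactor (rowsub f (flow w t s y V)) j0 l.
  rewrite /cofactor; congr (_ * \det _); apply/matrixP => i j; rewrite !mxE.
  have := neq_lift j0 i; case: (unliftP ord0 (f (lift j0 i))) => [r ->|].
    by rewrite !scale_exp_lift; move=> _; congr (_ * _); apply: eq_bigr => r' _; rewrite !mxE.
  by rewrite -fj0 => /injf ->; rewrite eqxx.
rewrite same det_set_row_index [in RHS]same det_set_row_index.
under [X in _ = _ + X]eq_bigr do rewrite det_set_row_index.
under [LHS]eq_bigr do rewrite cof (flow_shift _ _ y) mulrDl.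
rewrite big_split /=; congr (_ + _).
under [RHS]eq_bigr do rewrite mulrA mulr_sumr.
rewrite exchange_big /=; apply: eq_bigr => l _.
rewrite mulr_suml; apply: eq_bigr => i _; ring.
Qed.

Lemma det_flow_noshift t s y y' k (V : 'M[int]_(n.+1, k))
    (f : 'I_k -> 'I_n.+1) : (forall j, f j != ord0) ->
  \det (rowsub f (flow w t s y' V)) = \det (rowsub f (flow w t s y V)).
Proof.
move=> f0; congr (\det _); apply/matrixP => i j; rewrite mxE [RHS]mxE.
by case: (unliftP ord0 (f i)) (f0 i) => [r -> _|->]; rewrite ?eqxx // !flow_lift.
Qed.

(** The cut gives [t + texp w t s i <= s], so a shift of y by [2 exp (m - s)] changes row 0 by at
    most [2 n exp (m) rho]. *)
Lemma small_transfer t s m y y' rho (v : 'cV[int]_n.+1) :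
  (forall i, `|y' i - y i| <= 2 * expR (- (s - m))) ->
  0 <= m -> small w t s y rho v ->
  small w t s y' ((2 * n%:R + 1) * expR m * rho) v.
Proof.
move=> dy m0 sm; have rho0 : 0 <= rho by apply: le_trans (normr_ge0 _) (sm ord0).
have em1 : 1 <= expR m by rewrite -expR0 ler_expR.
have rho_le : rho <= (2 * n%:R + 1) * expR m * rho.
  rewrite ler_peMl // -[leLHS]mulr1 ler_pM // lerDr.
  by rewrite mulr_ge0.
move=> r; case: (unliftP ord0 r) => [i|] ->.
  by rewrite flow_lift -(flow_lift _ _ y); apply: le_trans (sm _) _.
rewrite (flow_shift _ _ y); apply: (le_trans (ler_normD _ _)).
have -> : (2 * n%:R + 1) * expR m * rho
    = expR m * rho + \sum_(i < n) (2 * expR m * rho).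
  by rewrite sumr_const card_ord -mulr_natr; ring.
apply: lerD.
  by apply: le_trans (sm _) _; rewrite ler_peMl.
apply: (le_trans (ler_norm_sum _ _ _)); apply: ler_sum => i _.
rewrite !normrM (ger0_norm (expR_ge0 _)).
apply: ler_pM => //.
apply: (@le_trans _ _ (2 * expR (- (s - m)) * expR (t + texp w t s i))).
  by rewrite ler_wpM2r ?expR_ge0.
rewrite -mulrA ler_wpM2l // -expRD ler_expR.
by have : texp w t s i <= s - t by [rewrite ge_min lexx orbT]; lra.
Qed.

Lemma minor_le_small t s y rho k (V : 'M[int]_(n.+1, k)) f :
  (forall j, small w t s y rho (col j V)) ->
  `|\det (rowsub f (flow w t s y V))| <= k`!%:R * rho ^+ k.
Proof.
move=> sm; have -> : rho ^+ k = \prod_(i < k) rho by rewrite prodr_const card_ord.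
by apply: normr_det_le => i j; rewrite mxE -flow_col; apply: sm.
Qed.

Lemma det_flow t s y (V : 'M[int]_n.+1) :
  \det (flow w t s y V) = expR (t - \sum_i texp w t s i) * (\det V)%:~R.
Proof.
have -> : flow w t s y V = diag_mx (\row_r expR (scale_exp w t s r))
    *m (shear y *m map_mx intr V).
  by apply/matrixP => i j; rewrite mul_diag_mx !mxE.
rewrite !det_mulmx det_map_mx det_diag; congr (_ * _).
  under eq_bigr do rewrite mxE.
  rewrite -expR_sum big_ord_recl scale_exp0; congr (expR (_ + _)).
  by rewrite -sumrN; apply: eq_bigr => i _; rewrite scale_exp_lift.
rewrite -[RHS]mul1r; congr (_ * _).
rewrite -det_tr det_trig; last first.
  apply/is_trig_mxP => i j ij; rewrite !mxE.
  by case: eqP => [jE|_]; [move: ij; rewrite jE|rewrite gt_eqF].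
rewrite big1 // => i _; rewrite !mxE eqxx.
by case: eqP => // ->; rewrite unlift_none.
Qed.
End Obstacle.

Section Escape.
Context {R : realType} (n : nat) (w : 'I_n -> R).

(* One of the k-volumes is large: either on the whole box around [y0], or it is
   an affine function of [y] with a large gradient, hence large away from a
   hyperplane. *)
Lemma hyperplane_escape k (V : 'M[int]_(n.+1, k)) (y0 : 'I_n -> R)
    (t s m M nu eps : R) : (0 < n)%N -> 0 < M -> nu < M / 2 ->
  2 * n%:R * nu < M * expR (s - m) * eps ->
  ~ ((forall f, `|\det (rowsub f (flow w t s y0 V))| <= M) /\
     (forall f j i, (forall l, f l != ord0) -> f j = lift ord0 i ->
       `|\det (rowsub f (flow w t s y0 V))| * expR (texp w t s i + t - (s - m)) <= M)) ->
  exists (a : 'I_n -> R) (c : R), \sum_i a i ^+ 2 = 1 /\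
    forall y, (forall i, `|y i - y0 i| <= expR (- (s - m))) ->
      eps <= `|\sum_i a i * y i - c| ->
      exists f, nu < `|\det (rowsub f (flow w t s y V))|.
Proof.
move=> n0 M0 nuM nueps big.
have n1 : 1 <= n%:R :> R by rewrite ler1n.
have n2 : 0 < 2 * n%:R :> R by lra.
set D := fun f => \det (rowsub f (flow w t s y0 V)).
have injD f : D f != 0 -> injective f.
  by move=> Df; apply: contrapT => /(det_rowsub_not_inj (flow w t s y0 V)) /eqP; exact/negP.
(* The threshold [M / (2 n)] is such that, if no entry of a gradient exceeds it, the n entries
   together change a minor by at most [M / 2] on the box, and a minor above M stays above
   [M / 2]. *)
have [[f [j [i [f0 fj bigG]]]]|noG] := pselect (exists f j i, [/\ forall l, f l != ord0,
    f j = lift ord0 i & M / (2 * n%:R) < `|D f| * expR (texp w t s i + t - (s - m))]).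
  have Df0 : D f != 0.
    apply: contraTneq bigG => ->; rewrite normr0 mul0r -leNgt.
    by rewrite divr_ge0 // ltW.
  pose f' := set_row_index f j ord0.
  have injf' : injective f'.
    move=> l l'; rewrite /f' /set_row_index.
    case: eqP => [->|_]; case: eqP => [->|_] //.
    - by move=> /esym/eqP; rewrite (negPf (f0 _)).
    - by move=> /eqP; rewrite (negPf (f0 _)).
    - exact: injD Df0 _ _.
  have f'j : f' j = ord0 by rewrite /f' /set_row_index eqxx.
  pose G l := expR (t + texp w t s l)
    * \det (rowsub (set_row_index f' j (lift ord0 l)) (flow w t s y0 V)).
  have Gi : M * expR (s - m) / (2 * n%:R) < `|G i|.
    rewrite /G normrM (ger0_norm (expR_ge0 _)).
    have -> : rowsub (set_row_index f' j (lift ord0 i)) (flow w t s y0 V)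
        = rowsub f (flow w t s y0 V).
      apply/matrixP => l l'; rewrite !mxE /f' /set_row_index.
      by case: eqP => // ->; rewrite fj.
    rewrite -(ltr_pM2r (expR_gt0 (- (s - m)))).
    have -> : M * expR (s - m) / (2 * n%:R) * expR (- (s - m))
      = M / (2 * n%:R) * (expR (s - m) * expR (- (s - m))) by ring.
    rewrite -expRD subrr expR0 mulr1; apply: lt_le_trans bigG _.
    rewrite -/(D f) mulrAC mulrC -expRD.
    by rewrite (addrC t).
  pose N := Num.sqrt (\sum_l G l ^+ 2).
  have GN : `|G i| <= N.
    rewrite -sqrtr_sqr ler_wsqrtr // (bigD1 i) //= lerDl.
    by rewrite sumr_ge0 // => l _; rewrite sqr_ge0.
  have N0 : 0 < N.
    apply: lt_le_trans GN; apply: le_lt_trans Gi.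
    by rewrite divr_ge0 ?mulr_ge0 ?expR_ge0 // ltW.
  have NE : N ^+ 2 = \sum_l G l ^+ 2.
    by rewrite sqr_sqrtr // sumr_ge0 // => l _; rewrite sqr_ge0.
  exists (fun l => G l / N), ((\sum_l G l * y0 l - D f') / N); split.
    under eq_bigr do rewrite expr_div_n.
    by rewrite -mulr_suml -NE divff // expf_neq0 // gt_eqF.
  move=> y _ far; exists f'.
  rewrite (det_flow_shift w t s y0 y V injf' f'j) -/(D f').
  have -> : D f' + \sum_i (y i - y0 i) * (expR (t + texp w t s i) *
      \det (rowsub (set_row_index f' j (lift ord0 i)) (flow w t s y0 V)))
    = N * (\sum_i G i / N * y i - (\sum_l G l * y0 l - D f') / N).
    rewrite mulrBr [N * (_ / N)]mulrC divfK ?gt_eqF // opprB addrCA; congr (_ + _).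
    rewrite mulr_sumr -sumrB; apply: eq_bigr => l _.
    by rewrite /G; field; rewrite gt_eqF.
  rewrite normrM (gtr0_norm N0).
  have eps0 : 0 < eps \/ eps <= 0 by case: (ltP 0 eps); [left|right].
  case: eps0 => eps0; last first.
    apply: (@lt_le_trans _ _ 0); last by rewrite mulr_ge0 ?normr_ge0 // ltW.
    rewrite -(pmulr_rlt0 _ n2); apply: lt_le_trans nueps _.
    by rewrite mulr_ge0_le0 // mulr_ge0 ?expR_ge0 // ltW.
  apply: (@lt_le_trans _ _ (N * eps)); last by rewrite ler_wpM2l // ltW.
  apply: (@lt_le_trans _ _ (M * expR (s - m) / (2 * n%:R) * eps)).
    by rewrite mulrAC ltr_pdivlMr // mulrC.
  by rewrite ler_pM2r // (le_trans (ltW Gi)).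
have Mn : M / (2 * n%:R) <= M.
  by rewrite ler_pdivrMr // ler_peMr; lra.
have [f Df] : exists f, M < `|D f|.
  apply: contrapT => noD; apply: big; split.
    by move=> f; rewrite leNgt; apply/negP => Df; apply: noD; exists f.
  move=> f j i f0 fj; rewrite leNgt; apply/negP => Df; apply: noG.
  by exists f, j, i; split => //; apply: le_lt_trans Df.
have Df0 : D f != 0 by rewrite -normr_gt0 (lt_trans _ Df).
have injf := injD _ Df0.
(* The lower bound holds on the whole box, so any unit normal will do. *)
exists (fun l => (l == Ordinal n0)%:R), 0; split.
  rewrite (bigD1 (Ordinal n0)) //= ?eqxx expr1n big1 ?addr0 // => l /negPf ->.
  by rewrite expr0n.
move=> y dy _; exists f.
have nuM' : nu < M by lra.
have [[j fj]|no0] := pselect (exists j, f j = ord0); last first.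
  rewrite (det_flow_noshift _ _ _ y0) ?(lt_trans nuM') // => j.
  by apply/eqP => fj; apply: no0; exists j.
rewrite (det_flow_shift w t s y0 y V injf fj) -/(D f).
apply: lt_le_trans (lerB_normD _ _).
suff : `|\sum_i (y i - y0 i) * (expR (t + texp w t s i) *
      \det (rowsub (set_row_index f j (lift ord0 i)) (flow w t s y0 V)))| <= M / 2.
  by rewrite -/(D f); lra.
apply: (le_trans (ler_norm_sum _ _ _)).
have -> : M / 2 = \sum_(i < n) (M / (2 * n%:R)).
  by rewrite sumr_const card_ord -mulr_natr; field; lra.
apply: ler_sum => i _; rewrite normrM.
apply: (@le_trans _ _ (expR (- (s - m)) * (expR (t + texp w t s i) *
   `|D (set_row_index f j (lift ord0 i))|))).
  by rewrite normrM (ger0_norm (expR_ge0 (t + _))) ler_wpM2r ?mulr_ge0 ?expR_ge0.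
rewrite mulrA -expRD mulrC leNgt; apply/negP => bigG; apply: noG.
exists (set_row_index f j (lift ord0 i)), j, i; split.
- move=> l; rewrite /set_row_index; case: (l =P j) => // lj.
  by apply/eqP => fl; apply: lj; apply: injf; rewrite fl fj.
- by rewrite /set_row_index eqxx.
- by rewrite (addrC (texp _ _ _ _)) (addrC (t + _)).
Qed.

Definition small_on (B : set ('I_n -> R)) t s rho (v : 'cV[int]_n.+1) : Prop :=
  exists2 y, B y & small w t s y rho v.

(** The vectors of a family may be short at different points of B; [small_transfer] brings them to a
    common point when volumes are compared. *)
Definition small_rank_le (B : set ('I_n -> R)) t s rho k : Prop :=
  forall l (V : 'M[int]_(n.+1, l)), (forall j, small_on B t s rho (col j V)) ->
    (\rank (map_mx intr V : 'M[R]_(n.+1, l)) <= k)%N.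
End Escape.

Lemma rank_colsub (F : fieldType) N l k (A : 'M[F]_(N, l)) :
  \rank A = k -> exists h : 'I_k -> 'I_l, \rank (colsub h A) = k.
Proof.
rewrite -mxrank_tr => <-; exists (maxrankfun A^T).
by rewrite -mxrank_tr trmx_mxsub; apply/eqP/maxrowsub_free.
Qed.

Lemma rank_row_mx_sub (F : fieldType) N k (A : 'M[F]_(N, k)) (u : 'cV[F]_N) :
  (\rank (row_mx A u) <= \rank A)%N -> exists c, u = A *m c.
Proof.
rewrite -mxrank_tr -[in leqRHS]mxrank_tr tr_row_mx => le_rk.
have sub : (A^T <= col_mx A^T u^T)%MS by rewrite -addsmxE addsmxSl.
have /submxP [D uE] : (u^T <= A^T)%MS.
  have : (col_mx A^T u^T <= A^T)%MS.
    by rewrite -(mxrank_leqif_sup sub).2 eqn_leq mxrankS.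
  by rewrite col_mx_sub => /andP [].
by exists D^T; apply: trmx_inj; rewrite trmx_mul trmxK.
Qed.

(** * Lowering the rank of the short vectors *)

Section RankStep.
Context {R : realType} (n : nat) (w : 'I_n -> R).

Lemma flow_mulmx t s y k (V : 'M[int]_(n.+1, k)) : flow w t s y V
  = (diag_mx (\row_r expR (scale_exp w t s r)) *m shear y) *m map_mx intr V.
Proof. by rewrite -mulmxA; apply/matrixP => i j; rewrite mul_diag_mx !mxE. Qed.

Lemma flow_mul_real t s y k (V U : 'M[int]_(n.+1, k)) (C : 'M[R]_k) :
  map_mx intr U = map_mx intr V *m C ->
  flow w t s y U = flow w t s y V *m C.
Proof. by rewrite !flow_mulmx => ->; rewrite mulmxA. Qed.

Lemma full_minor k (A : 'M[R]_(n.+1, k)) :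
  \rank A = k -> exists f, \det (rowsub f A) != 0.
Proof.
move=> rkA; have fA : row_full A by apply/eqP.
by exists (fullrankfun fA); rewrite -unitfE -unitmxE fullrowsub_unit.
Qed.

Lemma flow_full t s y k (V : 'M[int]_(n.+1, k)) :
  \rank (map_mx intr V : 'M[R]_(_, _)) = k ->
  exists f, \det (rowsub f (flow w t s y V)) != 0.
Proof.
move=> rkV; apply: full_minor; rewrite flow_mulmx -[RHS]rkV.
rewrite eqmxMfull // row_full_unit unitmxE unitfE.
have := det_flow w t s y 1%:M; rewrite flow_mulmx map_mx1 mulmx1 => ->.
by rewrite det1 mulr1 gt_eqF // expR_gt0.
Qed.

(** The determinant of n + 1 independent integer vectors is a nonzero integer, so by [det_flow]
    their volume is at least [exp (t - \sum_i texp w t s i)], too large for vectors that are all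
    short. *)
Lemma small_rank_start (B : set ('I_n -> R)) (y0 : 'I_n -> R) t s m rho :
  0 <= m -> (forall y, B y -> forall i, `|y i - y0 i| <= expR (- (s - m))) ->
  n.+1`!%:R * ((2 * n%:R + 1) * expR m * rho) ^+ n.+1
    < expR (t - \sum_i texp w t s i) ->
  small_rank_le w B t s rho n.
Proof.
move=> m0 By0 ltdet l V smallV; rewrite leqNgt; apply/negP => rkV.
have [|h rkh] := @rank_colsub _ _ _ n.+1 (map_mx intr V : 'M[R]_(_, _)).
  by apply/eqP; rewrite eqn_leq rank_leq_row.
pose U := colsub h V.
have detU : \det U != 0.
  apply/eqP => dU; have := rkh; rewrite -map_mxsub => rkU.
  have : (map_mx intr U : 'M[R]_n.+1) \in unitmx by rewrite -row_free_unit -row_leq_rank rkU.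
  by rewrite unitmxE det_map_mx dU unitr0.
have smallU j : small w t s y0 ((2 * n%:R + 1) * expR m * rho) (col j U).
  have [y yB sm] := smallV (h j).
  have -> : col j U = col (h j) V by apply/matrixP => i i'; rewrite !mxE.
  apply: small_transfer sm => // i; rewrite distrC.
  by apply: le_trans (By0 y yB i) _; rewrite ler_peMl ?expR_ge0 // ler1n.
have := minor_le_small id smallU.
rewrite (_ : rowsub id _ = flow w t s y0 U); last by apply/matrixP => i j; rewrite !mxE.
rewrite det_flow normrM (ger0_norm (expR_ge0 _)) leNgt => /negP; apply.
apply: lt_le_trans ltdet _; rewrite ler_peMr ?expR_ge0 // -intr_norm.
by rewrite -[1]/(1%:~R) ler_int -gtz0_ge1 normr_gt0.
Qed.

(** The hyperplane has to be fixed before it is known which vectors remain short on [B']. As the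
    rank on B is at most k + 1, all candidates lie in the span of one family V. A family of least
    volume in this span bounds the volumes of the others from below, so its hyperplane serves for
    all of them. *)
Lemma small_rank_step (B : set ('I_n -> R)) (y0 : 'I_n -> R) t s m m' rho M eps k :
  (0 < n)%N -> 0 <= m' -> 0 < M ->
  (forall y, B y -> forall i, `|y i - y0 i| <= expR (- (s - m))) ->
  small_rank_le w B t s rho k.+1 ->
  (forall V : 'M[int]_(n.+1, k.+1),
    (exists f, \det (rowsub f (flow w t s y0 V)) != 0) ->
    ~ ((forall f, `|\det (rowsub f (flow w t s y0 V))| <= M) /\
     (forall f j i, (forall l, f l != ord0) -> f j = lift ord0 i ->
       `|\det (rowsub f (flow w t s y0 V))| * expR (texp w t s i + t - (s - m)) <= M))) ->
  let nu := k.+1`!%:R * ((2 * n%:R + 1) * expR m' * rho) ^+ k.+1 in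
  nu < M / 2 -> 2 * n%:R * nu < M * expR (s - m) * eps ->
  exists (a : 'I_n -> R) (c : R), \sum_i a i ^+ 2 = 1 /\
    forall B' : set ('I_n -> R), B' `<=` B ->
      (forall y y', B' y -> B' y' -> forall i,
         `|y i - y' i| <= 2 * expR (- (s - m'))) ->
      (exists2 y, B' y & eps <= `|\sum_i a i * y i - c|) ->
      small_rank_le w B' t s rho k.
Proof.
move=> n0 m'0 M0 By0 rkB gain nu nuM nueps.
pose indep (V : 'M[int]_(n.+1, k.+1)) := \rank (map_mx intr V : 'M[R]_(_, _)) = k.+1.
have [[V [smallV indV]]|noV] := pselect (exists V,
    (forall j, small_on w B t s rho (col j V)) /\ indep V); last first.
  exists (fun l => (l == Ordinal n0)%:R), 0; split.
    rewrite (bigD1 (Ordinal n0)) //= ?eqxx expr1n big1 ?addr0 // => l /negPf ->.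
    by rewrite expr0n.
  move=> B' B'B _ _ l V smallV; rewrite -ltnS ltn_neqAle rkB ?andbT; last first.
    by move=> j; have [y /B'B yB sm] := smallV j; exists y.
  apply/eqP => /rank_colsub [h rkh]; apply: noV; exists (colsub h V); split.
    move=> j; have -> : col j (colsub h V) = col (h j) V by apply/matrixP => i i'; rewrite !mxE.
    by have [y /B'B yB sm] := smallV (h j); exists y.
  by rewrite /indep map_mxsub.
have indepP (U : 'M[int]_(n.+1, k.+1)) f : \det (rowsub f U) != 0 -> indep U.
  move=> dU; apply/eqP; rewrite eqn_leq rank_leq_col /=.
  have uU : (map_mx intr (rowsub f U) : 'M[R]_k.+1) \in unitmx.
    by rewrite unitmxE det_map_mx unitfE intr_eq0.
  apply: leq_trans (mxrankS (rowsub_sub f (map_mx intr U))).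
  by rewrite -map_mxsub mxrank_unit.
have [f detVR] := full_minor indV.
have detV : \det (rowsub f V) != 0.
  by move: detVR; rewrite -map_mxsub det_map_mx intr_eq0.
(* Within the span of V all minors of a family scale by the same factor [\det C], so a family with
   the least nonzero minor on the rows f has all its minors least in absolute value. *)
pose S (N : nat) := N != 0%N /\ exists (V' : 'M[int]_(n.+1, k.+1)) (C : 'M[R]_k.+1),
  map_mx intr V' = map_mx intr V *m C /\ `|\det (rowsub f V')|%N = N.
have exS : exists N, `[< S N >].
  exists `|\det (rowsub f V)|%N; apply/asboolP; split; first by rewrite absz_eq0.
  by exists V, 1%:M; rewrite mulmx1.
case: (ex_minnP exS) => N /asboolP [N0 [V' [C' [V'E detV']]]] minN.
have nzV' : \det (rowsub f V') != 0 by rewrite -absz_eq0 detV'.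
have [a [c [a1 far]]] := hyperplane_escape n0 M0 nuM nueps
  (gain V' (flow_full t s y0 (indepP V' f nzV'))).
exists a, c; split => // B' B'B dB' [y By yfar] l U smallU.
rewrite -ltnS ltn_neqAle rkB ?andbT; last first.
  by move=> j; have [y' /B'B yB sm] := smallU j; exists y'.
apply/eqP => /rank_colsub [h rkh]; pose U' := colsub h U.
have colU' j : col j U' = col (h j) U by apply/matrixP => i i'; rewrite !mxE.
have indU' : indep U' by rewrite /indep map_mxsub.
clearbody U'.
have [C U'E] : exists C, map_mx intr U' = map_mx intr V *m C :> 'M[R]_(_, _).
  have colE j : exists c : 'cV[R]_k.+1, map_mx intr (col j U') = map_mx intr V *m c.
    apply: rank_row_mx_sub; rewrite indV -map_row_mx; apply: rkB => i.
    case: (split_ordP i) => i' ->; last first.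
      have -> : col (rshift k.+1 i') (row_mx V (col j U')) = col j U'.
        by rewrite colKr; apply/matrixP => r r'; rewrite !mxE.
      by rewrite colU'; have [y' /B'B yB sm] := smallU (h j); exists y'.
    by rewrite colKl; apply: smallV.
  have [c0 c0E] := choice colE.
  exists (\matrix_(i, j) c0 j i 0); apply/matrixP => i j.
  have := congr1 (fun A : 'cV[R]_n.+1 => A i 0) (c0E j); rewrite !mxE => ->.
  by apply: eq_bigr => r _; rewrite !mxE.
have detU' : \det (rowsub f U') != 0.
  rewrite -(intr_eq0 R) -det_map_mx map_mxsub U'E -mul_rowsub_mx det_mulmx.
  rewrite mulf_neq0 // -unitfE -unitmxE -row_free_unit -row_leq_rank -[leqLHS]indU'.
  by rewrite U'E mxrankM_maxr.
have leC : `|\det C'| <= `|\det C|.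
  have : (N <= `|\det (rowsub f U')|)%N.
    apply: minN; apply/asboolP; split; first by rewrite absz_eq0.
    by exists U', C.
  rewrite -detV' -(ler_nat R) !natr_absz !intr_norm -!det_map_mx !map_mxsub.
  rewrite U'E V'E -!mul_rowsub_mx !det_mulmx !normrM ler_pM2l //.
  by rewrite normr_gt0.
have [g] := far y (By0 y (B'B y By)) yfar; rewrite ltNge => /negP; apply.
rewrite (flow_mul_real t s y V'E) -mul_rowsub_mx det_mulmx normrM.
apply: (@le_trans _ _ `|\det (rowsub g (flow w t s y U'))|).
  by rewrite (flow_mul_real t s y U'E) -mul_rowsub_mx det_mulmx normrM ler_wpM2l.
apply: minor_le_small => j; rewrite colU'; have [y' By' sm] := smallU (h j).
by apply: small_transfer sm => // i; apply: dB'.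
Qed.
End RankStep.

(** * The potential game *)

Section Potential.
Context {R : realType} (d : nat).

(* (normal, offset, width) *)
Definition slab := ('rV[R]_d * R * R)%type.
Definition normal (o : slab) : 'rV[R]_d := o.1.1.
Definition offset (o : slab) : R := o.1.2.
Definition width (o : slab) : R := o.2.

Definition dotp (a x : 'rV[R]_d) : R := \sum_(i < d) a ord0 i * x ord0 i.

Definition unit_slab (o : slab) : Prop := l2norm (normal o) = 1 /\ 0 < width o.

Definition hits (B : gball R d) (o : slab) : bool :=
  `[< exists2 x, cball B x & `|dotp (normal o) x - offset o| < width o >].

Lemma coord_le_l2norm (x : 'rV[R]_d) i : `|x ord0 i| <= l2norm x.
Proof.
rewrite /l2norm -sqrtr_sqr ler_wsqrtr // (bigD1 i) //= lerDl.
by rewrite sumr_ge0 // => l _; rewrite sqr_ge0.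
Qed.

Lemma l2normZ k (x : 'rV[R]_d) : l2norm (k *: x) = `|k| * l2norm x.
Proof.
rewrite /l2norm -sqrtr_sqr -sqrtrM ?sqr_ge0 // mulr_sumr.
by congr Num.sqrt; apply: eq_bigr => i _; rewrite mxE exprMn.
Qed.

Lemma l2norm_sqr (x : 'rV[R]_d) : l2norm x ^+ 2 = \sum_(i < d) x ord0 i ^+ 2.
Proof. by rewrite sqr_sqrtr // sumr_ge0 // => i _; rewrite sqr_ge0. Qed.

Lemma dotpBr a x y : dotp a (x - y) = dotp a x - dotp a y.
Proof. by rewrite /dotp -sumrB; apply: eq_bigr => i _; rewrite !mxE mulrBr. Qed.

Lemma neighbourhood_hyperplane a c e x : l2norm a = 1 -> `|dotp a x - c| < e ->
  neighbourhood [set y | dotp a y = c] e x.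
Proof.
move=> a1 xe; exists (x - (dotp a x - c) *: a).
  rewrite /= dotpBr.
  have -> : dotp a ((dotp a x - c) *: a) = dotp a x - c.
    rewrite {1}/dotp; under eq_bigr do rewrite mxE mulrCA -expr2.
    by rewrite -mulr_sumr -l2norm_sqr a1 expr1n mulr1.
  by rewrite opprB addrC subrK.
by rewrite opprB addrC subrK l2normZ a1 mulr1.
Qed.

Lemma affine_hyperplane_dotp a c : l2norm a = 1 ->
  affine_hyperplane [set y | dotp a y = c].
Proof.
move=> a1; exists a, c; split => //; apply/eqP => a0; move: a1.
rewrite a0 /l2norm big1 ?sqrtr0 => [/eqP|i _]; first by rewrite eq_sym oner_eq0.
by rewrite mxE expr0n.
Qed.

Lemma cball_coord (B : gball R d) x i : cball B x ->
  `|x ord0 i - center B ord0 i| <= radius B.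
Proof.
move=> Bx; apply: le_trans Bx; have := coord_le_l2norm (x - center B) i.
by rewrite !mxE.
Qed.

Lemma hits_sub (B B' : gball R d) o : cball B' `<=` cball B -> hits B' o -> hits B o.
Proof. by move=> sub /asboolP [x xB' xo]; apply/asboolP; exists x => //; apply: sub. Qed.

Lemma truncn_close (kap u v : R) : 0 < kap ->
  Num.truncn (u / kap) = Num.truncn (v / kap) -> 0 <= u -> 0 <= v ->
  `|u - v| <= kap.
Proof.
move=> kap0 uv u0 v0.
have hu := truncn_itv (divr_ge0 u0 (ltW kap0)); have hv := truncn_itv (divr_ge0 v0 (ltW kap0)).
rewrite uv in hu; move: hu hv; set N := Num.truncn _; rewrite -natr1.
rewrite ler_pdivlMr // ltr_pdivrMr // => /andP [h1 h2].
rewrite ler_pdivlMr // ltr_pdivrMr // => /andP [h3 h4].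
by rewrite ler_norml; apply/andP; split; lra.
Qed.

Lemma heavy_class (T : Type) (C : finType) (s : seq T) (P : pred T) (cl : T -> C)
    (wt : T -> R) : (forall o, 0 <= wt o) -> (0 < #|C|)%N ->
  exists c, \sum_(o <- s | P o) wt o
    <= #|C|%:R * \sum_(o <- s | P o && (cl o == c)) wt o.
Proof.
move=> wt0 C0; apply: contrapT => nex.
have lt c : #|C|%:R * \sum_(o <- s | P o && (cl o == c)) wt o < \sum_(o <- s | P o) wt o.
  by rewrite ltNge; apply/negP => le; apply: nex; exists c.
have sumE : \sum_(o <- s | P o) wt o = \sum_c \sum_(o <- s | P o && (cl o == c)) wt o.
  rewrite (exchange_big_dep P) /=; last by move=> c o _ /andP [].
  apply: eq_bigr => o Po; rewrite Po /= (bigD1 (cl o)) //= big1 ?addr0 // => c.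
  by rewrite eq_sym => /andP [/eqP ->]; rewrite eqxx.
have : \sum_(c : C) #|C|%:R * \sum_(o <- s | P o && (cl o == c)) wt o
     < \sum_(c : C) \sum_(o <- s | P o) wt o.
  have /card_gt0P [c0 _] := C0.
  by apply: ltr_sum => [|c _]; [apply/hasP; exists c0; rewrite ?mem_index_enum|apply: lt].
by rewrite -mulr_sumr -sumE sumr_const mulr_natl ltxx.
Qed.
Lemma exists_hyperplane : (0 < d)%N -> exists H : set 'rV[R]_d, affine_hyperplane H.
Proof.
move=> d0; pose a : 'rV[R]_d := delta_mx ord0 (Ordinal d0).
exists [set y | dotp a y = 0]; exists a, 0; split => //.
by apply/eqP => /matrixP /(_ ord0 (Ordinal d0)) /eqP; rewrite !mxE !eqxx oner_eq0.
Qed.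

(* By compactness a fixed proportion of the slabs meeting a ball are so close
   to one hyperplane that they lie in its (beta r)-neighbourhood. *)
Lemma slab_step (beta kap : R) : (0 < d)%N -> 0 < beta <= 1 ->
  kap * (d%:R + 2) = beta ->
  exists2 N0 : nat, (0 < N0)%N & forall (B : gball R d) (L : seq slab) (wt : slab -> R),
    0 < radius B -> (forall o, 0 <= wt o) ->
    (forall o, o \in L -> unit_slab o) ->
    (forall o, o \in L -> hits B o -> width o <= kap * radius B) ->
    exists2 H, affine_hyperplane H & forall B' : gball R d, cball B' `<=` cball B ->
      cball B' `&` neighbourhood H (beta * radius B) = set0 ->
      \sum_(o <- L | hits B' o) wt o
        <= (1 - N0%:R^-1) * \sum_(o <- L | hits B o) wt o.
Proof.
move=> d0 /andP [beta0 beta1] kapE.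
have d2 : 0 < d%:R + 2 :> R by rewrite ltr_wpDl.
have kap0 : 0 < kap by rewrite -(pmulr_lgt0 _ d2) kapE.
pose K := Num.truncn (2 * (d%:R + 2) / kap).
pose C := ({ffun 'I_d -> 'I_K.+1} * 'I_K.+1)%type.
have C0 : (0 < #|{: C}|)%N by apply/card_gt0P; exists ([ffun => ord0], ord0).
exists #|{: C}| => // B L wt r0 wt0 unitL wL.
set r := radius B in r0 wL *; set x0 := center B.
(* In units of the radius, [u o] is the signed distance of the centre from the middle of the slab.
   For two slabs of one class, the width, the d coordinates of the normals and the offsets
   contribute [kap r], [d kap r] and [kap r], together [beta r]. *)
pose u o := (dotp (normal o) x0 - offset o) / r.
pose cl (o : slab) : C :=
  ([ffun i => inord (Num.truncn ((normal o ord0 i + 1) / kap))],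
   inord (Num.truncn ((u o + (d%:R + 2)) / kap))).
have normal_le o i : unit_slab o -> `|normal o ord0 i| <= 1.
  by case=> o1 _; rewrite -o1; apply: coord_le_l2norm.
have dotp_le (a x : 'rV[R]_d) e b : 0 <= e -> (forall i, `|a ord0 i| <= e) ->
    (forall i, `|x ord0 i| <= b) -> `|dotp a x| <= d%:R * (e * b).
  move=> e0 ae xb; apply: (le_trans (ler_norm_sum _ _ _)).
  have -> : d%:R * (e * b) = \sum_(i < d) e * b by rewrite sumr_const card_ord mulr_natl.
  by apply: ler_sum => i _; rewrite normrM ler_pM.
have kap1 : kap <= 1.
  by apply: le_trans beta1; rewrite -kapE ler_peMr ?(ltW kap0) //; have := ler0n R d; lra.
have u_le o : o \in L -> hits B o -> `|u o| <= d%:R + 2.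
  move=> oL oB; have := wL o oL oB; have uo := unitL o oL.
  move: oB => /asboolP [x Bx xo] wo.
  rewrite /u normrM normfV (gtr0_norm r0) ler_pdivrMr //.
  have -> : dotp (normal o) x0 - offset o
      = (dotp (normal o) x - offset o) - dotp (normal o) (x - x0).
    by rewrite dotpBr; ring.
  apply: (le_trans (ler_normB _ _)).
  have : `|dotp (normal o) (x - x0)| <= d%:R * (1 * r).
    apply: dotp_le => // i; first exact: normal_le.
    by have := cball_coord i Bx; rewrite !mxE.
  have : kap * r <= 1 * r by rewrite ler_pM2r.
  rewrite mulrDl; lra.
have inordK' (v : R) : 0 <= v -> v <= 2 * (d%:R + 2) ->
    (inord (Num.truncn (v / kap)) : 'I_K.+1) = Num.truncn (v / kap) :> nat.
  move=> v0 vle; rewrite inordK // ltnS le_truncn // ler_pM2r ?invr_gt0 //.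
have close o o' : o \in L -> hits B o -> o' \in L -> hits B o' -> cl o = cl o' ->
    (forall i, `|normal o ord0 i - normal o' ord0 i| <= kap) /\ `|u o - u o'| <= kap.
  move=> oL oB o'L o'B [/ffunP clN clU]; split.
    move=> i; have := clN i; rewrite !ffunE => /(congr1 val) /=.
    have := normal_le _ i (unitL _ oL); have := normal_le _ i (unitL _ o'L).
    rewrite !ler_norml => /andP [h1 h2] /andP [h3 h4].
    have dR := ler0n R d.
    rewrite !inordK'; [|by clear -h1 h2 h3 h4 dR; lra..] => /(truncn_close kap0).
    have -> : normal o ord0 i + 1 - (normal o' ord0 i + 1)
      = normal o ord0 i - normal o' ord0 i by ring.
    by rewrite ler_norml; apply; clear -h1 h2 h3 h4 dR; lra.
  have := congr1 val clU => /=.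
  have := u_le _ oL oB; have := u_le _ o'L o'B.
  rewrite !ler_norml => /andP [h1 h2] /andP [h3 h4].
  rewrite !inordK'; [|by clear -h1 h2 h3 h4; lra..] => /(truncn_close kap0).
  have -> : u o + (d%:R + 2) - (u o' + (d%:R + 2)) = u o - u o' by ring.
  by rewrite ler_norml; apply; lra.
have [c heavy] := heavy_class L (hits B) cl wt0 C0.
have N0 : 0 < #|{: C}|%:R :> R by rewrite ltr0n.
set tot := \sum_(o <- L | hits B o) wt o in heavy *.
have splitE : tot = \sum_(o <- L | hits B o && (cl o == c)) wt o
    + \sum_(o <- L | hits B o && (cl o != c)) wt o by rewrite -bigID.
have rest : \sum_(o <- L | hits B o && (cl o != c)) wt o <= (1 - #|{: C}|%:R^-1) * tot.
  have : #|{: C}|%:R^-1 * tot <= \sum_(o <- L | hits B o && (cl o == c)) wt o.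
    by rewrite mulrC ler_pdivrMr // mulrC.
  by rewrite mulrBl mul1r; move: splitE; lra.
have sum_sub (B' : gball R d) : cball B' `<=` cball B ->
    (forall o, o \in L -> hits B' o -> cl o != c) ->
    \sum_(o <- L | hits B' o) wt o <= (1 - #|{: C}|%:R^-1) * tot.
  move=> B'B avoid; apply: le_trans rest.
  rewrite big_seq_cond [leRHS]big_seq_cond big_mkcond [leRHS]big_mkcond /=.
  apply: ler_sum => o _; case: (boolP (o \in L)) => //= oL.
  case: (boolP (hits B' o)) => [oB'|_]; last by case: ifP => // _; apply: wt0.
  by rewrite (hits_sub B'B oB') avoid.
have [[sl [slL slB clsl]]|no] := pselect (exists o, [/\ o \in L, hits B o & cl o = c]).
  have [un_o _] := unitL sl slL.
  exists [set y | dotp (normal sl) y = offset sl]; first exact: affine_hyperplane_dotp.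
  move=> B' B'B disj; apply: sum_sub => // o' o'L o'B'; apply/eqP => clo'.
  have o'B := hits_sub B'B o'B'.
  have [clN clU] := close _ _ slL slB o'L o'B (etrans clsl (esym clo')).
  have wo' := wL _ o'L o'B.
  move: o'B' => /asboolP [x B'x xo'].
  have : (cball B' `&` neighbourhood [set y | dotp (normal sl) y = offset sl] (beta * r)) x.
    split => //; apply: neighbourhood_hyperplane => //.
    have -> : dotp (normal sl) x - offset sl = (dotp (normal o') x - offset o')
        + dotp (normal sl - normal o') (x - x0) + (u sl - u o') * r.
      rewrite mulrBl !divfK ?gt_eqF //.
      have -> : dotp (normal sl - normal o') (x - x0) = dotp (normal sl) x - dotp (normal sl) x0
        - (dotp (normal o') x - dotp (normal o') x0).
        rewrite -!dotpBr /dotp -sumrB; apply: eq_bigr => i _; rewrite !mxE; ring.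
      ring.
    have : `|dotp (normal sl - normal o') (x - x0)| <= d%:R * (kap * r).
      apply: dotp_le => [|i|i]; first exact: ltW.
        by have := clN i; rewrite !mxE.
      by have := cball_coord i (B'B _ B'x); rewrite !mxE.
    have : `|(u sl - u o') * r| <= kap * r.
      by rewrite normrM (gtr0_norm r0) ler_pM2r.
    have := ler_normD (dotp (normal o') x - offset o') (dotp (normal sl - normal o') (x - x0)).
    have := ler_normD (dotp (normal o') x - offset o'
      + dotp (normal sl - normal o') (x - x0)) ((u sl - u o') * r).
    rewrite -kapE mulrDr mulrDl; set e1 := `|_|; set e2 := `|_|; lra.
  by rewrite disj.
have [H HH] := exists_hyperplane d0; exists H => // B' B'B _.
apply: sum_sub => // o oL oB'; apply/eqP => clo; apply: no; exists o; split => //.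
exact: hits_sub B'B oB'.
Qed.
End Potential.

Definition hag_bob {R : realType} {d : nat} (beta : R) (B : gball R d)
    (A : set 'rV[R]_d * R) (B' : gball R d) : Prop :=
  [/\ cball B' `<=` cball B, beta * radius B <= radius B' &
      cball B' `&` neighbourhood A.1 A.2 = set0].

Section Strategy.
Context {R : realType} (d : nat).

Let slabs (O : gball R d -> seq (@slab R d)) (h : seq (gball R d)) :=
  flatten [seq O B | B <- h].

(* Alice always plays near the heaviest class of slabs. The sum of width^gam over
   the slabs that meet the ball stays below K radius^gam with K < 1, so that no slab
   as wide as the ball still meets it. *)
Lemma potential_strategy (beta : R) : (0 < d)%N -> 0 < beta < 1 ->
  exists gam kap0 : R, [/\ 0 < gam, 0 < kap0 &
  forall O : gball R d -> seq (@slab R d),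
    (forall B, 0 < radius B -> forall o, o \in O B -> unit_slab o) ->
    (forall B, 0 < radius B ->
      \sum_(o <- O B) (width o / radius B) `^ gam <= kap0) ->
  exists sigma : seq (gball R d) -> set 'rV[R]_d * R,
  forall b : nat -> gball R d, 0 < radius (b 0%N) ->
    let a n := sigma (mkseq b n.+1) in
    forall n, (forall k, (k < n)%N -> hag_bob beta (b k) (a k) (b k.+1)) ->
      [/\ 0 < radius (b n), affine_hyperplane (a n).1,
        (a n).2 = beta * radius (b n) &
        forall k o x, (k <= n)%N -> o \in O (b k) -> radius (b n) <= width o ->
          cball (b n) x -> width o <= `|dotp (normal o) x - offset o|]].
Proof.
move=> d0 /andP [beta0 beta1].
have d2 : 0 < d%:R + 2 :> R by rewrite ltr_wpDl.
pose kap := beta / (d%:R + 2).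
have kapE : kap * (d%:R + 2) = beta by rewrite divfK // gt_eqF.
have kapp : 0 < kap by rewrite divr_gt0.
have kap1 : kap < 1.
  by rewrite ltr_pdivrMr // mul1r (lt_trans beta1) //; have := ler0n R d; lra.
have beta01 : 0 < beta <= 1 by rewrite beta0 ltW.
have [N0 N0p step] := slab_step d0 beta01 kapE.
have N0R : 1 <= N0%:R :> R by rewrite ler1n.
(* A move removes the proportion [1 / N0 = 2 i2] of the weight, and gam is so small that [r^gam]
   loses at most the proportion i2. Since [1 - 2 i2 <= (1 - i2)^2], there is room for new slabs of
   total weight [i2 K r^gam] at every move. *)
pose i2 : R := (2 * N0%:R)^-1.
have i2p : 0 < i2 by rewrite invr_gt0; lra.
have i2E : N0%:R^-1 = 2 * i2 by rewrite /i2; field; lra.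
have i21 : 2 * i2 <= 1 by rewrite -i2E invf_le1 //; lra.
have lnb : ln beta < 0 by rewrite ln_lt0 // beta0.
pose gam := i2 / (- ln beta).
have gamp : 0 < gam by rewrite divr_gt0 // oppr_gt0.
have beta_gam : 1 - i2 <= beta `^ gam.
  rewrite /powR (gt_eqF beta0) /gam -mulrA [X in _ * X](_ : _ = -1); last first.
    by rewrite invrN mulNr mulVf // lt_eqF.
  by rewrite mulrN1; apply: expR_ge1Dx.
pose K := kap `^ gam.
have Kp : 0 < K by apply: powR_gt0.
exists gam, (K * i2); split => //; first exact: mulr_gt0.
move=> O unitO sumO.
pose wt (o : @slab R d) := width o `^ gam.
pose B0 : gball R d := GBall 0 0.
pose spec_at B h (A : set 'rV[R]_d * R) := 0 < radius B ->
  (forall o, o \in slabs O h -> unit_slab o) ->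
  (forall o, o \in slabs O h -> hits B o -> width o <= kap * radius B) ->
  [/\ affine_hyperplane A.1, A.2 = beta * radius B &
   forall B' : gball R d, cball B' `<=` cball B ->
      cball B' `&` neighbourhood A.1 A.2 = set0 ->
      \sum_(o <- slabs O h | hits B' o) wt o
        <= (1 - N0%:R^-1) * \sum_(o <- slabs O h | hits B o) wt o].
have /choice [sigma sigmaP] : forall h, exists A, spec_at (last B0 h) h A.
  move=> h; rewrite /spec_at; set B := last _ _.
  have [[[r0 uL] wL]|no] := pselect ((0 < radius B /\ (forall o, o \in slabs O h -> unit_slab o)) /\
     (forall o, o \in slabs O h -> hits B o -> width o <= kap * radius B)).
    have [H aH HB] := step B (slabs O h) wt r0 (fun o => powR_ge0 _ _) uL wL.
    by exists (H, beta * radius B).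
  by exists (set0, 0) => r0 uL wL; case: no.
exists sigma => b b0 a n.
pose Phi n := \sum_(o <- slabs O (mkseq b n.+1) | hits (b n) o) wt o.
have slabsS m : slabs O (mkseq b m.+1) = slabs O (mkseq b m) ++ O (b m).
  by rewrite /slabs mkseqS map_rcons flatten_rcons.
have wt_div B o : 0 < radius B -> unit_slab o ->
    (width o / radius B) `^ gam * radius B `^ gam = wt o.
  move=> r0 [_ w0]; rewrite -powRM ?divfK ?gt_eqF // ?divr_ge0 // ltW //.
have sumO_hits B B' : 0 < radius B ->
    \sum_(o <- O B | hits B' o) wt o <= K * i2 * radius B `^ gam.
  move=> r0; apply: (@le_trans _ _ (\sum_(o <- O B) wt o)).
    by rewrite [leRHS](bigID (hits B')) /= lerDl sumr_ge0 // => o _; apply: powR_ge0.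
  apply: le_trans (ler_wpM2r (powR_ge0 _ _) (sumO B r0)).
  rewrite mulr_suml big_seq [leRHS]big_seq le_eqVlt; apply/orP; left; apply/eqP.
  by apply: eq_bigr => o oO; rewrite wt_div //; apply: unitO oO.
have slabsP m o : reflect (exists2 k, (k < m)%N & o \in O (b k)) (o \in slabs O (mkseq b m)).
  rewrite /slabs /mkseq -map_comp.
  by apply: (iffP flatten_mapP) => -[k km oO]; exists k; rewrite // mem_iota in km *.
have unit_slabs m : (forall k, (k < m)%N -> 0 < radius (b k)) ->
    forall o, o \in slabs O (mkseq b m) -> unit_slab o.
  by move=> rp o /slabsP [k km oO]; apply: unitO oO; apply: rp.
have width_le m : 0 < radius (b m) -> (forall o, o \in slabs O (mkseq b m.+1) -> unit_slab o) ->
    Phi m <= K * radius (b m) `^ gam ->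
    forall o, o \in slabs O (mkseq b m.+1) -> hits (b m) o -> width o <= kap * radius (b m).
  move=> r0 uL le o oL oB; have [_ w0] := uL o oL.
  rewrite leNgt; apply/negP => lt.
  have : wt o <= Phi m.
    rewrite /Phi (big_rem o) //= oB lerDl sumr_ge0 // => ? _; exact: powR_ge0.
  move/le_trans => /(_ _ le); rewrite leNgt => /negP; apply.
  rewrite /K -powRM ?(ltW kapp) ?(ltW r0) //.
  by apply: gt0_ltr_powR => //; rewrite nnegrE ?mulr_ge0 // ltW.
suff main m : (m <= n)%N -> (forall k, (k < n)%N -> hag_bob beta (b k) (a k) (b k.+1)) ->
    (forall k, (k <= m)%N -> 0 < radius (b k)) /\ Phi m <= K * radius (b m) `^ gam.
  move=> legal; have [rp lePhi] := main n (leqnn n) legal.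
  have uL := unit_slabs n.+1 rp; have rn := rp n (leqnn n).
  have wL := width_le n rn uL lePhi.
  have := sigmaP (mkseq b n.+1); rewrite [in last _ _]mkseqS last_rcons /spec_at.
  move=> /(_ rn uL wL) [aff eps _]; split => // k o x kn oO ro Bx.
  rewrite leNgt; apply/negP => lt.
  have oL : o \in slabs O (mkseq b n.+1).
    by apply/slabsP; exists k.
  have := wL o oL; have -> : hits (b n) o by apply/asboolP; exists x.
  move=> /(_ isT); rewrite leNgt => /negP; apply.
  by apply: lt_le_trans ro; rewrite gtr_pMl.
elim: m => [|m IH] mn legal.
  split => [[]//|]; rewrite /Phi /slabs /= cats0.
  apply: le_trans (sumO_hits _ _ b0) _; rewrite ler_wpM2r ?powR_ge0 //.
  by rewrite ler_piMr ?(ltW Kp) //; lra.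
have [rp lePhi] := IH (ltnW mn) legal.
have rm := rp m (leqnn m).
have [sub rS disj] := legal m mn.
have rSp : 0 < radius (b m.+1) by apply: lt_le_trans rS; apply: mulr_gt0.
split; first by move=> k; rewrite leq_eqVlt => /orP [/eqP -> //|]; apply: rp.
have uL := unit_slabs m.+1 rp.
have := sigmaP (mkseq b m.+1); rewrite [in last _ _]mkseqS last_rcons /spec_at.
move=> /(_ rm uL (width_le m rm uL lePhi)) [_ _ /(_ _ sub disj) le1].
rewrite /Phi slabsS big_cat /=.
apply: (le_trans (lerD le1 (sumO_hits _ _ rSp))).
have rg : (1 - i2) * radius (b m) `^ gam <= radius (b m.+1) `^ gam.
  apply: (@le_trans _ _ ((beta * radius (b m)) `^ gam)).
    by rewrite powRM ?(ltW rm) ?(ltW beta0) // ler_wpM2r ?powR_ge0.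
  by apply: ge0_ler_powR => //; rewrite ?nnegrE ?ltW // mulr_gt0.
rewrite i2E -/(Phi m).
have h1 : (1 - 2 * i2) * Phi m <= (1 - 2 * i2) * (K * radius (b m) `^ gam).
  by rewrite ler_wpM2l // subr_ge0.
have h2 : (1 - i2) * K * ((1 - i2) * radius (b m) `^ gam)
    <= (1 - i2) * K * radius (b m.+1) `^ gam.
  by rewrite ler_wpM2l // mulr_ge0 ?(ltW Kp) //; lra.
have h3 : 0 <= i2 ^+ 2 * (K * radius (b m) `^ gam).
  by rewrite mulr_ge0 ?sqr_ge0 // mulr_ge0 ?powR_ge0 // ltW.
move: h1 h2 h3; set p := _ `^ gam; set p' := radius (b m.+1) `^ gam.
by rewrite expr2; clearbody p p'; clear; lra.
Qed.
End Strategy.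

(** * The homogeneous lattice bound *)

Lemma intr_norm_lt1 (R : realType) (a : int) : `|a%:~R| < 1 :> R -> a = 0.
Proof.
rewrite -intr_norm -[1]/(1%:~R) ltr_int => a1; apply/eqP.
by rewrite -normr_le0; move: a1; lia.
Qed.

Section Time.
Context {R : realType} (n : nat) (w : 'I_n -> R).

Lemma small0 t s y rho (v : 'cV[int]_n.+1) : small w t s y rho v ->
  expR t * `|(v ord0 0)%:~R + \sum_i y i * (v (lift ord0 i) 0)%:~R| <= rho.
Proof. by move=> /(_ ord0); rewrite flow_ord0 normrM ger0_norm ?expR_ge0. Qed.

Lemma small_lift t s y rho (v : 'cV[int]_n.+1) i : small w t s y rho v ->
  `|(v (lift ord0 i) 0)%:~R| <= expR (texp w t s i) * rho.
Proof.
move=> /(_ (lift ord0 i)); rewrite flow_lift normrM ger0_norm ?expR_ge0 //.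
by rewrite expRN mulrC ler_pdivrMr ?expR_gt0 // mulrC.
Qed.

Lemma smallI t s y rho (v : 'cV[int]_n.+1) :
  expR t * `|(v ord0 0)%:~R + \sum_i y i * (v (lift ord0 i) 0)%:~R| <= rho ->
  (forall i, `|(v (lift ord0 i) 0)%:~R| <= expR (texp w t s i) * rho) ->
  small w t s y rho v.
Proof.
move=> h0 h r; case: (unliftP ord0 r) => [i|] ->.
  rewrite flow_lift normrM ger0_norm ?expR_ge0 //.
  by rewrite expRN mulrC ler_pdivrMr ?expR_gt0 // mulrC.
by rewrite flow_ord0 normrM ger0_norm ?expR_ge0.
Qed.

(** Between t' and t each [texp] rises by at most h, so lowering the time enlarges no row by more
    than [exp h]. This reduces all times to a grid. *)
Lemma small_time t t' s y rho rho' h (v : 'cV[int]_n.+1) :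
  (forall i, 0 <= w i <= 1) -> t' <= t <= t' + h -> expR h * rho <= rho' ->
  small w t s y rho v -> small w t' s y rho' v.
Proof.
move=> w01 /andP [t't tt'] rr' sm.
have h0 : 0 <= h by lra.
have rho0 : 0 <= rho by apply: le_trans (normr_ge0 _) (sm ord0).
have rr : rho <= rho'.
  by apply: le_trans rr'; rewrite ler_peMl // -expR0 ler_expR.
apply: smallI => [|i].
  apply: le_trans (le_trans (small0 sm) rr).
  by rewrite ler_wpM2r // ler_expR.
apply: (le_trans (small_lift i sm)).
apply: (@le_trans _ _ (expR (texp w t' s i + h) * rho)).
  rewrite ler_wpM2r // ler_expR /texp.
  have /andP [wi0 wi1] := w01 i.
  have : w i * (t - t') <= t - t' by rewrite ler_piMl // subr_ge0.
  rewrite mulrBr => hw.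
  rewrite -lerBlDr le_min !lerBlDr !ge_min; apply/andP; split; apply/orP.
    by left; lra.
  by right; lra.
by rewrite expRD -mulrA ler_wpM2l ?expR_ge0.
Qed.

(** Once every exponent is cut, a delay h multiplies each row of the flow by exactly [exp h], so
    late times follow from a single one. *)
Lemma small_late t s y rho rho' h (v : 'cV[int]_n.+1) :
  (forall i, s - t <= w i * t) -> (forall i, 0 <= w i) -> 0 <= h ->
  expR (- h) * rho <= rho' ->
  small w (t + h) s y rho v -> small w t s y rho' v.
Proof.
move=> late w0 h0 rr' sm; apply: smallI => [|i].
  have -> : expR t = expR (- h) * expR (t + h) by rewrite -expRD; congr expR; ring.
  rewrite -mulrA; apply: le_trans rr'; rewrite ler_wpM2l ?expR_ge0 //.
  exact: small0 sm.
apply: (le_trans (small_lift i sm)).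
have -> : texp w t s i = s - t by rewrite /texp min_r.
have -> : texp w (t + h) s i = s - t - h.
  rewrite /texp min_r; first by ring.
  have := late i; have : 0 <= w i * h by rewrite mulr_ge0.
  by rewrite mulrDr; lra.
by rewrite expRD -mulrA ler_wpM2l ?expR_ge0.
Qed.

(** The coordinates [a_i], and then b, are integers of absolute value below 1. This settles the
    first stages, where del can be taken small against [exp (- s)]. *)
Lemma small_nonzero t s y rho (v : 'cV[int]_n.+1) :
  0 <= t -> rho < 1 -> expR s * rho < 1 -> v != 0 -> ~ small w t s y rho v.
Proof.
move=> t0 rho1 srho nzv sm.
have rho0 : 0 <= rho by apply: le_trans (normr_ge0 _) (sm ord0).
have vi i : v (lift ord0 i) 0 = 0.
  apply: intr_norm_lt1; apply: le_lt_trans (small_lift i sm) _; apply: le_lt_trans srho.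
  rewrite ler_wpM2r // ler_expR; apply: (@le_trans _ _ (s - t)).
    by rewrite ge_min lexx orbT.
  by rewrite gerBl.
have v0 : v ord0 0 = 0.
  apply: intr_norm_lt1; apply: le_lt_trans rho1; have := small0 sm.
  rewrite big1 ?addr0 => [|i _]; last by rewrite vi mulr0.
  by apply: le_trans; rewrite ler_peMl // -expR0 ler_expR.
case/eqP: nzv; apply/matrixP => i j; rewrite (ord1 j) mxE.
by case: (unliftP ord0 i) => [l|] ->.
Qed.

(** The coordinate of largest weight is bounded by the cut [s - t], the others by [w i * t]. The
    right side is the logarithm of the covolume of the integer lattice. *)
Lemma sum_texp_le t s om i1 : (forall i, 0 <= w i) -> \sum_i w i = 1 ->
  w i1 = om -> s / (1 + om) <= t -> 0 <= s -> 
  t - s / (1 + om) <= t - \sum_i texp w t s i.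
Proof.
move=> w0 w1 wom tge s0.
have om0 : 0 <= om by rewrite -wom.
have t0 : 0 <= t by apply: le_trans tge; rewrite divr_ge0 // addr_ge0.
have : \sum_i texp w t s i <= (1 - om) * t + (s - t).
  rewrite (bigD1 i1) //= addrC; apply: lerD; last by rewrite ge_min lexx orbT.
  have -> : 1 - om = \sum_(i | i != i1) w i.
    by rewrite -w1 (bigD1 i1) //= wom addrAC subrr add0r.
  by rewrite mulr_suml; apply: ler_sum => i _; rewrite ge_min lexx.
have om1 : 0 < 1 + om by lra.
have : s <= t * (1 + om) by rewrite -ler_pdivrMr.
have : om * (s / (1 + om)) <= om * t by rewrite ler_wpM2l.
have : s / (1 + om) * (1 + om) = s by rewrite divfK // gt_eqF.
set q := s / (1 + om); rewrite !mulrDr !mulrDl mulrC; lra.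
Qed.

Lemma small_rank0 (B : set ('I_n -> R)) t s rho : small_rank_le w B t s rho 0 ->
  forall y v, B y -> v != 0 -> ~ small w t s y rho v.
Proof.
move=> rk y v By nzv sm; have /rk : forall j, small_on w B t s rho (col j v).
  move=> j; have -> : col j v = v by apply/matrixP => i i'; rewrite !mxE (ord1 i') (ord1 j).
  by exists y.
rewrite leqn0 mxrank_eq0 => /eqP v0; case/eqP: nzv; apply/matrixP => i j.
have := congr1 (fun A : 'M[R]_(_, _) => A i j) v0.
by rewrite !mxE => /eqP; rewrite intr_eq0 => /eqP.
Qed.
End Time.

(** * Projection onto a subset of the coordinates *)

Section Projection.
Context {R : realType} (d n : nat) (e : 'I_n -> 'I_d).
Hypothesis inje : injective e.

Definition proj (x : 'rV[R]_d) : 'I_n -> R := fun j => x ord0 (e j).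

Definition lift_vec (a : 'I_n -> R) : 'rV[R]_d := \row_i \sum_(j | e j == i) a j.

Lemma dotp_lift_vec a x : dotp (lift_vec a) x = \sum_j a j * proj x j.
Proof.
rewrite /dotp; under eq_bigr do rewrite mxE mulr_suml.
rewrite (exchange_big_dep predT) //=; apply: eq_bigr => j _.
by rewrite (bigD1 (e j)) //= big1 ?addr0 // => i /andP [/eqP ->]; rewrite eqxx.
Qed.

Lemma proj_lift_vec a : proj (lift_vec a) =1 a.
Proof.
move=> j; rewrite /proj mxE (bigD1 j) //= big1 ?addr0 // => i /andP [/eqP /inje ->].
by rewrite eqxx.
Qed.

Lemma l2norm_lift_vec a : \sum_j a j ^+ 2 = 1 -> l2norm (lift_vec a) = 1.
Proof.
move=> a1; rewrite -[RHS]sqrtr1 -a1 /l2norm; congr Num.sqrt.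
have := dotp_lift_vec a (lift_vec a); rewrite /dotp.
under eq_bigr do rewrite -expr2; move=> ->.
by apply: eq_bigr => j _; rewrite proj_lift_vec expr2.
Qed.
End Projection.

Lemma stage_half (S L S' S1 : nat) :
  (S1 <= S)%N -> (8 * L <= S)%N -> S = (S' + L)%N -> (S1 <= 2 * S')%N.
Proof. lia. Qed.

Lemma index_bound (P Qj Qp L S' j : nat) : (P <= S' + L)%N -> (L <= Qj + Qp)%N ->
  (2 * Qj <= P)%N -> (j <= Qj)%N -> (j <= S' + Qp)%N.
Proof. lia. Qed.

(** * Induction over stages, grid times and ranks *)

Section Chain.
Context {R : realType} (d n : nat) (e : 'I_n -> 'I_d) (w : 'I_n -> R).
Context (om wm u sig del : R) (A Lam p0 S1 : nat) (i1 : 'I_n).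
Hypotheses (inje : injective e) (wm0 : 0 < wm) (wmw : forall i, wm <= w i).
Hypotheses (w1 : \sum_i w i = 1) (wi1 : w i1 = om).
Hypotheses (u1 : 1 <= u) (sig0 : 0 < sig) (sigc : n.+1%:R * sig <= wm / 4).
Hypotheses (A2 : (2 <= A)%N) (Asig : 8 * n%:R <= sig * A%:R).
Hypotheses (LamA : (2 * (n.+1 * A ^ n) <= Lam)%N) (LamW : (16 * (n * A ^ n))%:R <= wm * Lam%:R).
(** The constants lost between the volume provided by [volume_gain] and the volume that k short
    vectors may have; p0 is so large that the gain over a lag absorbs them. *)
Let cst (k : nat) : R := 2 * n%:R * (k`!%:R * (2 * n%:R + 1) ^+ k)
  * (2 * (k`!%:R * 2 ^+ k * k`!%:R)) * ((2 * k%:R) ^+ k * expR (2 * u * Lam%:R) ^+ k).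
Hypothesis p0_gt0 : (0 < p0)%N.
Hypothesis p0_cst : forall k, (k <= n)%N -> cst k < expR (sig / 4 * p0%:R).
Hypothesis S1_large : (16 * (Lam + n * A ^ n * p0))%:R <= wm * S1%:R.
Hypothesis del0 : 0 < del.

(* The target (S, j) is the absence of vectors shorter than [grid_rho j] at time
   [grid_time S j] and stage S, where a stage S ball has radius about exp(- u S). Rank
   k is reached [u * lag k j] before, and to go from rank k + 1 to rank k a slab is
   chosen [lag k.+1 j] stages before S. *)
Definition grid_time (S j : nat) : R := u * S%:R / (1 + om) + u * (Lam * j)%:R.
Definition grid_rho (j : nat) : R := del * expR (sig * (u * (Lam * j)%:R)).
Definition lag (k j : nat) : nat := (A ^ k * (j + p0))%N.
Definition slab_width (S k j : nat) : R := expR (- (u * S%:R) - sig / 8 * (u * (lag k j)%:R)).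

Definition avoids (B : gball R d) (o : @slab R d) : Prop :=
  forall x, cball B x -> width o <= `|dotp (normal o) x - offset o|.

Definition good_slab (B : gball R d) (S k j : nat) (o : @slab R d) : Prop :=
  let S' := (S + lag k.+1 j)%N in
  forall B', cball B' `<=` cball B -> 0 <= radius B' ->
    radius B' <= expR (- (u * S'%:R - u * (lag k j)%:R)) -> avoids B' o ->
    small_rank_le w (proj e @` cball B') (grid_time S' j) (u * S'%:R) (grid_rho j) k.

Definition lattice_bounded (S : nat) (x : 'rV[R]_d) : Prop :=
  forall t v, u * S%:R / (1 + om) <= t -> v != 0 ->
    ~ small w t (u * S%:R) (proj e x)
       (del * expR (- (2 * u * Lam%:R)) * expR (sig * (t - u * S%:R / (1 + om)))) v.

Let w0 i : 0 <= w i. Proof. exact: le_trans (ltW wm0) (wmw i). Qed.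

Let w_le1 i : w i <= 1.
Proof. by rewrite -w1 (bigD1 i) //= lerDl sumr_ge0. Qed.

Let om01 : 0 <= om <= 1. Proof. by rewrite -wi1 w0 w_le1. Qed.

Let wm1 : wm <= 1. Proof. exact: le_trans (wmw i1) (w_le1 i1). Qed.

Let n0 : (0 < n)%N. Proof. by case: n i1 => [[]|]. Qed.

Let u0 : 0 < u. Proof. exact: lt_le_trans ltr01 u1. Qed.

Let half_le (s : R) : 0 <= s -> s / 2 <= s / (1 + om).
Proof.
by move=> s0; case/andP: om01 => ? ?; rewrite ler_wpM2l // lef_pV2 ?posrE; lra.
Qed.

Lemma lag_le k j : (k <= n)%N -> (lag k j <= A ^ n * (j + p0))%N.
Proof. by move=> kn; rewrite /lag leq_mul2r leq_pexp2l ?kn ?orbT // ltnW. Qed.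

(** From time [s / (1 + wm)] on every exponent is cut and [small_late] takes over, so only earlier
    times count, up to one grid step. For these j is small against S, because Lam is large against
    the powers of A; so the lags are short and [contraction] applies with [c0 = wm / 4]. *)
Lemma target_bounds S k j : (k <= n)%N -> (S1 <= S)%N ->
  grid_time S j <= u * S%:R / (1 + wm) + u * Lam%:R ->
  [/\ grid_time S j + n%:R * (u * (lag k j)%:R) <= u * S%:R - wm / 4 * (u * S%:R),
      forall i, wm / 4 * (u * S%:R) + n%:R * (u * (lag k j)%:R) <= w i * grid_time S j,
      u * (Lam * j)%:R <= u * S%:R & 8 * (u * (lag k j)%:R) <= u * S%:R].
Proof.
move=> kn S1S tle; set s := u * S%:R.
have wm0' := wm0; have wm1' := wm1; have u0' := u0.
have s0 : 0 <= s by rewrite mulr_ge0 // ltW.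
have lag1 : n%:R * (u * (lag k j)%:R) <= u * (n * A ^ n * j)%:R + u * (n * A ^ n * p0)%:R.
  rewrite -mulrDr mulrCA ler_pM2l // -natrM -natrD ler_nat -mulnDr -mulnA.
  by rewrite leq_mul2l lag_le ?orbT.
have hS : 16 * (u * Lam%:R) + 16 * (u * (n * A ^ n * p0)%:R) <= wm * s.
  rewrite /s [leRHS]mulrCA; have -> : 16 * (u * Lam%:R) + 16 * (u * (n * A ^ n * p0)%:R)
    = u * (16 * (Lam + n * A ^ n * p0))%:R by rewrite !(natrM, natrD); ring.
  rewrite ler_pM2l //; apply: le_trans S1_large _.
  by rewrite ler_pM2l // ler_nat.
have wms : wm * s <= s by rewrite ler_piMl.
have wms0 : 0 <= wm * s by rewrite mulr_ge0 // ltW.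
have p00 : 0 <= u * (n * A ^ n * p0)%:R by rewrite mulr_ge0 // ltW.
have h1wm : s / (1 + wm) <= s - wm / 2 * s.
  have wmp : 0 < 1 + wm by lra.
  have : 0 <= s * (wm * (1 - wm)) by rewrite !mulr_ge0 ?subr_ge0 // ltW.
  rewrite ler_pdivrMr //; lra.
have zs : u * (Lam * j)%:R <= s.
  have := half_le s0; move: tle; rewrite /grid_time -/s => h1 h2.
  have : wm / 2 * s >= 0 by rewrite mulr_ge0 ?divr_ge0 // ltW.
  lra.
have hj : 16 * (u * (n * A ^ n * j)%:R) <= wm * s.
  apply: (@le_trans _ _ (wm * (u * (Lam * j)%:R))); last by rewrite ler_pM2l.
  have -> : 16 * (u * (n * A ^ n * j)%:R) = u * j%:R * (16 * (n * A ^ n))%:R.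
    by rewrite !natrM; ring.
  have -> : wm * (u * (Lam * j)%:R) = u * j%:R * (wm * Lam%:R) by rewrite !natrM; ring.
  by rewrite ler_wpM2l // mulr_ge0 // ltW.
have tge : s / 2 <= grid_time S j.
  by apply: le_trans (half_le s0) _; rewrite lerDl mulr_ge0 // ltW.
split=> //.
- move: tle lag1 hS hj h1wm wms0; rewrite -/s.
  set L := n%:R * _; set X := u * _; set Y := u * _; set Z := u * _; set G := grid_time _ _.
  set Q := s / _; set P := wm * s; have -> : wm / 2 * s = P / 2 by rewrite /P; ring.
  have -> : wm / 4 * s = P / 4 by rewrite /P; ring.
  by clearbody L X Y Z G Q P; lra.
- move=> i; apply: (@le_trans _ _ (wm * (s / 2))); last first.
    by apply: ler_pM => //; rewrite ?(ltW wm0) ?divr_ge0.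
  have := mulr_ge0 (ltW u0) (ler0n R Lam); lra.
- have n1 : 1 <= n%:R :> R by rewrite ler1n.
  have : u * (lag k j)%:R <= n%:R * (u * (lag k j)%:R).
    by rewrite ler_peMl // mulr_ge0 // ltW.
  have := mulr_ge0 (ltW u0) (ler0n R Lam); lra.
Qed.

(** The covolume is at least [exp (u Lam j)]. Half of this exponent pays for the part of the lag
    proportional to j, a quarter for the growth of [grid_rho]; the part of the lag due to p0 is paid
    by del. *)
Lemma small_rank_init (B : gball R d) S j : (S1 <= S)%N ->
  grid_time S j <= u * S%:R / (1 + wm) + u * Lam%:R ->
  n.+1`!%:R * ((2 * n%:R + 1) * expR (u * (A ^ n * p0)%:R) * del) ^+ n.+1 < 1 ->
  radius B <= expR (- (u * S%:R - u * (lag n j)%:R)) ->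
  small_rank_le w (proj e @` cball B) (grid_time S j) (u * S%:R) (grid_rho j) n.
Proof.
move=> S1S tle delsmall rB.
have s0 : 0 <= u * S%:R by rewrite mulr_ge0 // ltW.
apply: (@small_rank_start _ _ _ _ (proj e (center B)) _ _ (u * (lag n j)%:R)).
- by rewrite mulr_ge0 // ltW.
- by move=> _ [x Bx <-] i; apply: le_trans rB; apply: cball_coord.
have zeta_ge : u * (Lam * j)%:R
    <= grid_time S j - \sum_i texp w (grid_time S j) (u * S%:R) i.
  have := sum_texp_le (t := grid_time S j) w0 w1 wi1 _ s0.
  rewrite {2}/grid_time addrAC subrr add0r; apply.
  by rewrite lerDl mulr_ge0 // ltW.
apply: lt_le_trans (_ : expR (u * (Lam * j)%:R) <= _); last by rewrite ler_expR.
set c := (2 * n%:R + 1) * _ * del in delsmall.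
have -> : (2 * n%:R + 1) * expR (u * (lag n j)%:R) * grid_rho j
    = c * expR (u * (A ^ n * j)%:R + sig * (u * (Lam * j)%:R)).
  have -> : u * (lag n j)%:R = u * (A ^ n * p0)%:R + u * (A ^ n * j)%:R.
    by rewrite /lag mulnDr natrD mulrDr addrC.
  rewrite /c /grid_rho !expRD; ring.
rewrite exprMn -expRM_natl [ltLHS]mulrA.
apply: (@lt_le_trans _ _ (1 * expR (n.+1%:R * (u * (A ^ n * j)%:R + sig * (u * (Lam * j)%:R))))).
  by rewrite ltr_pM2r ?expR_gt0.
rewrite mul1r ler_expR mulrDr.
have h1 : 2 * (n.+1%:R * (u * (A ^ n * j)%:R)) <= u * (Lam * j)%:R.
  have -> : 2 * (n.+1%:R * (u * (A ^ n * j)%:R)) = u * (2 * (n.+1 * A ^ n) * j)%:R.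
    by rewrite !natrM; ring.
  by rewrite ler_pM2l // ler_nat leq_mul2r LamA orbT.
have h2 : n.+1%:R * (sig * (u * (Lam * j)%:R)) <= 1 / 4 * (u * (Lam * j)%:R).
  rewrite mulrA ler_wpM2r ?mulr_ge0 ?(ltW u0) //; apply: le_trans sigc _; have := wm1; lra.
have h3 : 0 <= u * (Lam * j)%:R by rewrite mulr_ge0 // ltW.
move: h1 h2 h3; set X := n.+1%:R * (u * _); set Y := n.+1%:R * _.
by set Z := u * _; clearbody X Y Z; lra.
Qed.

Lemma good_slab_exists (B : gball R d) S k j : (k < n)%N -> 0 < radius B ->
  let S' := (S + lag k.+1 j)%N in (S1 <= S')%N ->
  grid_time S' j <= u * S'%:R / (1 + wm) + u * Lam%:R ->
  radius B <= expR (- (u * S%:R)) -> lattice_bounded S (center B) ->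
  small_rank_le w (proj e @` cball B) (grid_time S' j) (u * S'%:R) (grid_rho j) k.+1 ->
  exists o, [/\ unit_slab o, width o = slab_width S k.+1 j & good_slab B S k j o].
Proof.
move=> kn r0 S' S1S' tle rB PB rkB.
have [tns c0w zs m8] := target_bounds kn S1S' tle.
set s := u * S'%:R in tle tns c0w zs m8 rkB *.
set m := u * (lag k.+1 j)%:R in tns c0w m8 *.
set m' := u * (lag k j)%:R; set t := grid_time S' j in tle tns c0w zs rkB *.
set rho := grid_rho j in rkB *.
have sm : s - m = u * S%:R by rewrite /s /m /S' natrD mulrDr addrK.
have m'0 : 0 <= m' by rewrite mulr_ge0 // ltW.
have m0 : 0 < m.
  by rewrite mulr_gt0 // ltr0n muln_gt0 expn_gt0 (ltnW A2) addn_gt0 p0_gt0 orbT.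
have rho0 : 0 < rho by rewrite mulr_gt0 ?expR_gt0.
set K := k.+1; set cc := K`!%:R * 2 ^+ K * K`!%:R : R.
have cc0 : 0 < cc by rewrite !mulr_gt0 ?ltr0n ?fact_gt0 ?exprn_gt0.
pose M := (rho * expR (- (2 * u * Lam%:R)) / (2 * K%:R)) ^+ K * expR (sig / 2 * m) / (2 * cc).
have M0 : 0 < M.
  by rewrite divr_gt0 ?mulr_gt0 ?exprn_gt0 ?expR_gt0 // ?divr_gt0 ?mulr_gt0 ?expR_gt0 // ltr0n.
set nu := K`!%:R * ((2 * n%:R + 1) * expR m' * rho) ^+ K.
have n1 : 1 <= n%:R :> R by rewrite ler1n.
have mA : m = A%:R * m' by rewrite /m /m' /lag expnS -mulnA natrM; ring.
have p0m : p0%:R <= m.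
  rewrite /m -[leLHS]mul1r ler_pM // ler_nat /lag.
  by apply: leq_trans (leq_addl j p0) _; rewrite leq_pmull // expn_gt0 (ltnW A2).
have Km' : K%:R * m' <= sig / 8 * m.
  rewrite mA mulrA ler_wpM2r //; have : K%:R <= n%:R :> R by rewrite ler_nat.
  by have := Asig; lra.
have cstK : cst K * expR (K%:R * m') < expR (sig / 4 * m + sig / 8 * m).
  have cst0 : 0 <= cst K.
    by rewrite !mulr_ge0 ?exprn_ge0 ?mulr_ge0 ?addr_ge0 ?expR_ge0 ?ler0n ?ler01.
  rewrite expRD; apply: (@le_lt_trans _ _ (cst K * expR (sig / 8 * m))).
    by rewrite ler_wpM2l // ler_expR.
  rewrite ltr_pM2r ?expR_gt0 //; apply: lt_le_trans (p0_cst kn) _.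
  by rewrite ler_expR ler_wpM2l // divr_ge0 // ltW.
pose DD := expR (2 * u * Lam%:R) ^+ K * (2 * K%:R) ^+ K * (2 * cc).
have K0 : 0 < 2 * K%:R :> R by rewrite mulr_gt0 // ltr0n.
have DD0 : 0 < DD by rewrite !mulr_gt0 ?exprn_gt0 ?expR_gt0.
(* The gain [sig / 2 * m] is divided: [sig / 4 * m] absorbs the constants, [sig / 8 * m] the loss
   [exp (K m')] of the larger ball, which is where the ratio A of the lags enters, and [sig / 8 * m]
   is left for the width of the slab. *)
have nuM : 2 * n%:R * nu < M * expR (- (sig / 8 * m)).
  have -> : 2 * n%:R * nu = rho ^+ K / DD * (cst K * expR (K%:R * m')).
    rewrite /nu /cst /DD -/cc expRM_natl [(_ * _ * _) ^+ K]exprMn [(_ * expR m') ^+ K]exprMn.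
    have := exprn_gt0 K (expR_gt0 (2 * u * Lam%:R)); have := exprn_gt0 K K0.
    set x1 := expR _ ^+ K; set x2 := rho ^+ K; set x3 := expR (2 * u * Lam%:R) ^+ K.
    set x5 := (2 * K%:R) ^+ K; set x6 := (_ + _) ^+ K; move=> x50 x30.
    by field; rewrite !gt_eqF.
  have -> : M * expR (- (sig / 8 * m)) = rho ^+ K / DD * expR (sig / 4 * m + sig / 8 * m).
    have -> : sig / 4 * m + sig / 8 * m = sig / 2 * m - sig / 8 * m by field.
    rewrite [expR (_ - _)]expRD /M /DD expRN 2!exprMn !exprVn.
    have := exprn_gt0 K (expR_gt0 (2 * u * Lam%:R)); have := exprn_gt0 K K0.
    set x2 := rho ^+ K; set x3 := expR (2 * u * Lam%:R) ^+ K.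
    set x5 := (2 * K%:R) ^+ K; move=> x50 x30.
    by field; rewrite !gt_eqF.
  rewrite ltr_pM2l; first exact: cstK.
  by rewrite divr_gt0 // exprn_gt0.
have nuM2 : nu < M / 2.
  have nu0 : 0 <= nu.
    by rewrite mulr_ge0 // exprn_ge0 // !mulr_ge0 ?expR_ge0 ?addr_ge0 ?mulr_ge0 // ltW.
  have : M * expR (- (sig / 8 * m)) <= M.
    by rewrite ler_piMr ?(ltW M0) // -expR0 ler_expR oppr_le0 mulr_ge0 ?divr_ge0 // ltW.
  have : 2 * nu <= 2 * n%:R * nu by rewrite -mulrA ler_pM2l // ler_peMl.
  lra.
have By0 : forall y, (proj e @` cball B) y ->
    forall i, `|y i - proj e (center B) i| <= expR (- (s - m)).
  by move=> _ [x Bx <-] i; rewrite sm; apply: le_trans rB; apply: cball_coord.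
have [V [f0 nzf0] [H1 H2]||a [c [a1 far]]] := small_rank_step (m' := m')
    (eps := slab_width S K j) n0 m'0 M0 By0 rkB _ nuM2.
- have s0 : 0 < s by apply: lt_le_trans m8; rewrite mulr_gt0.
  have tE : t - s / (1 + om) = u * (Lam * j)%:R by rewrite /t /grid_time -/s; ring.
  have : (del * expR (- (2 * u * Lam%:R)) * expR (sig * (t - s / (1 + om))) / (2 * K%:R)) ^+ K
      * expR (sig / 2 * m) <= cc * M.
    apply: (@volume_gain _ _ w K V (proj e (center B)) t s m M _ sig om (wm / 4)) => //.
    - by have := m8; have := m0; lra.
    - by rewrite -subr_ge0 tE mulr_ge0 // ltW.
    - by rewrite divr_ge0 // ltW.
    - by rewrite mulr_ge0 ?expR_ge0 // ltW.
    - exact: ltW.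
    - by apply: le_trans sigc _; have := wm0; lra.
    - by rewrite sm => t' lt' v; apply: PB.
    - by exists f0.
    - exact: ltW.
  rewrite tE leNgt => /negP; apply.
  have -> : del * expR (- (2 * u * Lam%:R)) * expR (sig * (u * (Lam * j)%:R))
     = rho * expR (- (2 * u * Lam%:R)) by rewrite /rho /grid_rho; ring.
  rewrite /M; set X := _ ^+ K * _.
  have X0 : 0 < X.
    by rewrite mulr_gt0 ?exprn_gt0 ?expR_gt0 // ?divr_gt0 ?mulr_gt0 ?expR_gt0.
  have -> : cc * (X / (2 * cc)) = X / 2 by field; rewrite gt_eqF.
  by rewrite ltr_pdivrMr // ltr_pMr // ltr1n.
- suff -> : M * expR (s - m) * slab_width S K j = M * expR (- (sig / 8 * m)) by [].
  by rewrite -mulrA -expRD sm addrA subrr add0r.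
exists (lift_vec e a, c, slab_width S K j); split => //.
  by split; [apply: l2norm_lift_vec|apply: expR_gt0].
move=> B' B'B r'0 rB' av; apply: far.
- by move=> _ [x Bx <-]; exists x => //; apply: B'B.
- move=> _ _ [x Bx <-] [x' Bx' <-] i.
  apply: (@le_trans _ _ (radius B' + radius B')); last first.
    by rewrite mulr_natl mulr2n; apply: lerD; apply: rB'.
  rewrite -[_ - _](subrKA (proj e (center B') i)) (le_trans (ler_normD _ _)) // lerD //.
    exact: cball_coord.
  by rewrite distrC; apply: cball_coord.
- have B'c : cball B' (center B').
    by rewrite /cball /= subrr /l2norm big1 ?sqrtr0 // => i _; rewrite mxE expr0n.
  exists (proj e (center B')); first by exists (center B').
  by have := av _ B'c; rewrite /normal /offset /= dotp_lift_vec.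
Qed.
Definition at_stage (B : gball R d) (S : nat) : Prop :=
  expR (- (u * S.+1%:R)) < radius B <= expR (- (u * S%:R)).

Section Play.
Context (b : nat -> gball R d) (N : nat) (pick : gball R d -> nat -> nat -> nat -> @slab R d).
Hypothesis pick_good : forall B S k j,
  (exists o, [/\ unit_slab o, width o = slab_width S k.+1 j & good_slab B S k j o]) ->
  good_slab B S k j (pick B S k j).
Hypothesis sub_b : forall i, (i < N)%N -> cball (b i.+1) `<=` cball (b i).
Hypothesis rad_b : forall i, (i < N)%N -> expR (- u) * radius (b i) <= radius (b i.+1).
Hypothesis pos_b : forall i, (i <= N)%N -> 0 < radius (b i).
Hypothesis rad_b0 : expR (- (u * (S1%:R / 2))) < radius (b 0%N).
Hypothesis del_init :
  n.+1`!%:R * ((2 * n%:R + 1) * expR (u * (A ^ n * p0)%:R) * del) ^+ n.+1 < 1.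
Hypothesis del_start : del * expR (2 * (u * S1%:R) + u * Lam%:R) < 1.
Hypothesis cleared : forall i l S k j, (i <= l <= N)%N -> at_stage (b i) S ->
  (k < n)%N -> (j <= S + A ^ n * p0)%N -> radius (b l) <= slab_width S k.+1 j ->
  avoids (b l) (pick (b i) S k j).

Lemma cball_nested i l : (i <= l <= N)%N -> cball (b l) `<=` cball (b i).
Proof.
elim: l => [|l IH]; first by rewrite leqn0 => /andP [/eqP -> _].
case/andP; rewrite leq_eqVlt => /orP [/eqP -> _ //|il lN].
have il' : (i <= l <= N)%N by rewrite -ltnS il ltnW.
by move=> x /(sub_b lN) /(IH il').
Qed.

Lemma cball_center (B : gball R d) : 0 <= radius B -> cball B (center B).
Proof.
move=> r0; rewrite /cball /= subrr /l2norm big1 ?sqrtr0 // => i _.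
by rewrite mxE expr0n.
Qed.

(** A radius is at least [exp (- u)] times the preceding one and a stage spans a factor [exp u], so
    no stage is skipped; by [S1 <= 2 * S] ball 0 is still larger than the balls of stage S. *)
Lemma reach_stage i S : (i <= N)%N -> radius (b i) <= expR (- (u * S%:R)) ->
  (S1 <= 2 * S)%N -> exists2 l, (l <= i)%N & at_stage (b l) S.
Proof.
move=> iN ri S1S.
have ex : exists l, (l <= i)%N && (radius (b l) <= expR (- (u * S%:R))).
  by exists i; rewrite leqnn.
case: (ex_minnP ex) => l /andP [li rl] minl; exists l => //.
rewrite /at_stage rl andbT; case: l li rl minl => [|l] li rl minl.
  have : expR (- (u * S%:R)) <= expR (- (u * (S1%:R / 2))).
    rewrite ler_expR lerN2 ler_pM2l // ler_pdivrMr // mulrC.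
    by rewrite -natrM ler_nat.
  by move=> /(le_trans rl); rewrite leNgt rad_b0.
have lN : (l < N)%N := leq_trans li iN.
apply: lt_le_trans (rad_b lN).
rewrite -natr1 mulrDr mulr1 opprD expRD mulrC ltr_pM2l ?expR_gt0 //.
rewrite ltNge; apply/negP => rl'.
by have := minl l; rewrite (ltnW li) rl' ltnn => /(_ isT).
Qed.

Let sig_le : sig <= 1 / 4.
Proof.
apply: (@le_trans _ _ (n.+1%:R * sig)); first by rewrite ler_peMl ?ler1n // ltW.
by apply: le_trans sigc _; have := wm1; lra.
Qed.

Lemma small_rank_chain S j : (S1 <= S)%N ->
  grid_time S j <= u * S%:R / (1 + wm) + u * Lam%:R ->
  (forall S' i x, (S' < S)%N -> (i <= N)%N -> radius (b i) <= expR (- (u * S'%:R)) ->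
     cball (b i) x -> lattice_bounded S' x) ->
  forall q, (q <= n)%N -> forall i, (i <= N)%N ->
  radius (b i) <= expR (- (u * S%:R - u * (lag (n - q) j)%:R)) ->
  small_rank_le w (proj e @` cball (b i)) (grid_time S j) (u * S%:R) (grid_rho j) (n - q).
Proof.
move=> S1S tle IHS; elim=> [|q IHq] qn i iN ri.
  by rewrite subn0 in ri *; apply: small_rank_init.
set k := (n - q.+1)%N in ri *.
have kE : (n - q = k.+1)%N by rewrite /k -subnSK.
have kn : (k < n)%N by rewrite -kE leq_subr.
have [_ _ zs m8] := target_bounds kn S1S tle.
have m8' : (8 * lag k.+1 j <= S)%N.
  by rewrite -(ler_nat R) natrM -(ler_pM2l u0) mulrCA.
have lag0 : (0 < lag k.+1 j)%N.
  by rewrite muln_gt0 expn_gt0 (ltnW A2) addn_gt0 p0_gt0 orbT.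
set S' := (S - lag k.+1 j)%N.
have lagS : (lag k.+1 j <= S)%N by apply: leq_trans m8'; rewrite leq_pmull.
have SE : S = (S' + lag k.+1 j)%N by rewrite subnK.
have lagA : (2 * lag k j <= lag k.+1 j)%N.
  by rewrite /lag expnS -mulnA leq_mul2r A2 orbT.
have ri' : radius (b i) <= expR (- (u * S'%:R)).
  apply: le_trans ri _; rewrite ler_expR lerN2 -mulrBr ler_pM2l //.
  rewrite lerBrDr -natrD ler_nat [leqRHS]SE leq_add2l.
  by apply: leq_trans lagA; rewrite leq_pmull.
have [l li stage_l] : exists2 l, (l <= i)%N & at_stage (b l) S'.
  by apply: reach_stage => //; apply: stage_half S1S m8' SE.
have lN : (l <= N)%N := leq_trans li iN.
have /andP [rl1 rl2] := stage_l.
have good : good_slab (b l) S' k j (pick (b l) S' k j).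
  apply: pick_good; apply: good_slab_exists => //; rewrite -?SE //.
  - exact: pos_b.
  - apply: (IHS S' l) => //; first by rewrite ltn_subrL lag0 (leq_trans lag0).
    by apply: cball_center; apply: ltW; apply: pos_b.
  - rewrite -kE; apply: IHq => //; first exact: ltnW.
    by rewrite kE -mulrBr -natrB.
have := good (b i); rewrite -SE; apply => //.
- by apply: cball_nested; rewrite li.
- exact: ltW (pos_b iN).
apply: cleared => //; first by rewrite li.
  (* At stage S' only the indices up to [S' + A ^ n * p0] receive a slab; j is among them because
     [Lam * j <= S]. *)
  have hLam : (Lam * j <= S)%N by rewrite -(ler_nat R) -(ler_pM2l u0).
  have hlag := lag_le j kn; rewrite mulnDr in hlag.
  have a0 : (0 < A ^ n)%N by rewrite expn_gt0 (ltnW A2).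
  have h2 : (2 * (A ^ n * j) <= Lam * j)%N.
    rewrite mulnA leq_mul2r (leq_trans _ LamA) ?orbT // leq_mul2l /=.
    by rewrite leq_pmull.
  have h3 : (j <= A ^ n * j)%N by rewrite leq_pmull.
  by rewrite SE in hLam; apply: index_bound hLam hlag h2 h3.
(* The slab of rank k + 1 is already wider than a ball of radius [exp (- (u S - u lag k))]:
   [sig / 8] is below 1/2, and the lag of rank k is at most half that of rank k + 1. *)
apply: le_trans ri _; rewrite ler_expR /slab_width.
have -> : u * S%:R - u * (lag k j)%:R = u * S'%:R + u * (lag k.+1 j)%:R - u * (lag k j)%:R.
  by rewrite {1}SE natrD mulrDr.
have : 2 * (u * (lag k j)%:R) <= u * (lag k.+1 j)%:R.
  by rewrite mulrCA ler_pM2l // -natrM ler_nat.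
have : sig / 8 * (u * (lag k.+1 j)%:R) <= 1 / 2 * (u * (lag k.+1 j)%:R).
  by rewrite ler_wpM2r ?mulr_ge0 // ?(ltW u0) //; have := sig_le; lra.
set X := u * _; set Y := u * _; set Z := u * _; set T := sig / 8 * _.
by clearbody X Y Z T; lra.
Qed.

(** Strong induction on the stage, since the chain of ranks for S uses the full bound at earlier
    stages. Below S1 integrality suffices, by the choice of del; from S1 on the chain settles the
    grid times up to [s / (1 + wm)], and the later ones reduce to them. *)
Lemma lattice_bounded_play S i x : (i <= N)%N ->
  radius (b i) <= expR (- (u * S%:R)) -> cball (b i) x -> lattice_bounded S x.
Proof.
elim/ltn_ind: S i x => S IHS i x iN ri xi.
have s0 : 0 <= u * S%:R by rewrite mulr_ge0 // ltW.
have u0' := u0; have wm0' := wm0; have wm1' := wm1; have [om0 om1] := andP om01.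
have tge j : u * S%:R / (1 + om) <= grid_time S j.
  by rewrite lerDl mulr_ge0 // ltW.
have t0 j : 0 <= grid_time S j.
  by apply: le_trans (tge j); rewrite divr_ge0 // addr_ge0.
have gridS j : grid_time S j.+1 = grid_time S j + u * Lam%:R.
  by rewrite /grid_time mulnS natrD; ring.
have grid j v : v != 0 -> ~ small w (grid_time S j) (u * S%:R) (proj e x) (grid_rho j) v.
  move=> nzv; move: j; have early j : grid_time S j <= u * S%:R / (1 + wm) + u * Lam%:R ->
      ~ small w (grid_time S j) (u * S%:R) (proj e x) (grid_rho j) v.
    move=> tle; have [S1S|SS1] := leqP S1 S.
      have rk0 := small_rank_chain S1S tle
        (fun S' i' x' lt iN' => IHS S' lt i' x' iN') (leqnn n) iN.
      rewrite subnn in rk0; apply: small_rank0 (rk0 _) _ _ _ nzv; last by exists x.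
      by apply: le_trans ri _; rewrite ler_expR lerN2 gerBl mulr_ge0 // ltW.
    have zle : u * (Lam * j)%:R <= u * S1%:R + u * Lam%:R.
      have hS : u * S%:R <= u * S1%:R by rewrite ler_pM2l // ler_nat ltnW.
      have h1 : u * S%:R / (1 + wm) <= u * S%:R.
        by rewrite ler_pdivrMr ?ler_peMr //; lra.
      have h2 : 0 <= u * S%:R / (1 + om) by rewrite divr_ge0 // addr_ge0.
      move: tle hS h1 h2; rewrite /grid_time; set X := u * S%:R; set Y := X / (1 + om).
      set Z := X / _; set W := u * Lam%:R; set V := u * (Lam * j)%:R; set U := u * S1%:R.
      by clearbody Y Z W V U; clearbody X; lra.
    have rho_lt (a : R) : a <= u * S1%:R -> expR a * grid_rho j < 1.
      move=> aS; apply: le_lt_trans del_start; rewrite /grid_rho mulrCA ler_pM2l //.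
      rewrite -expRD ler_expR.
      have h1 : sig * (u * (Lam * j)%:R) <= u * (Lam * j)%:R.
        by rewrite ler_piMl ?mulr_ge0 ?(ltW u0) //; have := sig_le; lra.
      move: zle aS h1; set W := u * Lam%:R; set V := u * (Lam * j)%:R; set U := u * S1%:R.
      by set T := sig * V; clearbody T; clearbody W V U; lra.
    apply: small_nonzero => //.
      have := rho_lt 0; rewrite expR0 mul1r; apply.
      by rewrite mulr_ge0 // ltW.
    by apply: rho_lt; rewrite ler_pM2l // ler_nat ltnW.
  have wmp : 0 < 1 + wm by lra.
  elim=> [|j IH].
    apply: early; rewrite /grid_time muln0 mulr0 addr0.
    rewrite ler_wpDr ?mulr_ge0 ?(ltW u0) // ler_wpM2l // lef_pV2 ?posrE //; last by lra.
    by rewrite lerD2l -wi1 wmw.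
  have [tle|tgt] := leP (grid_time S j) (u * S%:R / (1 + wm)).
    by apply: early; rewrite gridS lerD2r.
  rewrite gridS => sm; apply/IH/(small_late _ w0 _ _ sm).
  - move=> i'; apply: (@le_trans _ _ (wm * grid_time S j)); last by rewrite ler_wpM2r.
    by move: tgt; rewrite ltr_pdivrMr //; lra.
  - by rewrite mulr_ge0 // ltW.
  - rewrite /grid_rho mulnS natrD mulrDr mulrDr mulrCA -expRD ler_pM2l // ler_expR.
    have : sig * (u * Lam%:R) <= u * Lam%:R.
      by rewrite ler_piMl ?mulr_ge0 ?(ltW u0) //; have := sig_le; lra.
    set P := sig * _; set Q := u * Lam%:R; set T := sig * _.
    by clearbody P Q T; lra.
move=> t v tt nzv sm.
have Lam0 : 0 < u * Lam%:R.
  rewrite mulr_gt0 // ltr0n; apply: leq_trans LamA.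
  by rewrite !muln_gt0 /= expn_gt0 (ltnW A2).
pose z := t - u * S%:R / (1 + om).
have z0 : 0 <= z by rewrite subr_ge0.
pose j := Num.truncn (z / (u * Lam%:R)).
have := truncn_itv (divr_ge0 z0 (ltW Lam0)); rewrite -/j -natr1.
rewrite ler_pdivlMr // ltr_pdivrMr // => /andP [jz zj].
have jE : u * (Lam * j)%:R = j%:R * (u * Lam%:R) by rewrite natrM; ring.
(* Rounding t down to the grid costs one factor [exp (u Lam)] in the length and at most another one
   in the bound; the factor [exp (- (2 u Lam))] of [lattice_bounded] pays for both. *)
apply: (grid j v nzv); apply: (small_time (h := u * Lam%:R)) sm.
- by move=> i'; rewrite w0 w_le1.
- rewrite /grid_time jE; move: jz zj; rewrite /z mulrDl mul1r.
  set X := u * S%:R / _; set Y := j%:R * _; set Z := u * Lam%:R.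
  by clearbody X Y Z; move=> *; apply/andP; split; lra.
rewrite -/z /grid_rho jE; clearbody z.
have -> : expR (u * Lam%:R) * (del * expR (- (2 * u * Lam%:R)) * expR (sig * z))
   = del * expR (u * Lam%:R - 2 * u * Lam%:R + sig * z).
  by rewrite !expRD; ring.
rewrite ler_pM2l // ler_expR.
have : sig * z <= sig * (j%:R * (u * Lam%:R) + u * Lam%:R).
  by rewrite ler_pM2l //; move: zj; rewrite mulrDl mul1r => /ltW.
have : sig * (u * Lam%:R) <= u * Lam%:R.
  by rewrite ler_piMl ?(ltW Lam0) //; have := sig_le; lra.
have -> : 2 * u * Lam%:R = 2 * (u * Lam%:R) by ring.
rewrite mulrDr; set Y := j%:R * _; set Z := u * Lam%:R.
by set T := sig * Y; set Q := sig * Z; clearbody T Q; clearbody Y Z; lra.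
Qed.
End Play.
End Chain.

(** * Choice of the constants and cost of the homogeneous slabs *)

Lemma expR_large (R : realType) (g C : R) : 0 < g ->
  exists P : nat, forall p, (P <= p)%N -> C < expR (g * p%:R).
Proof.
move=> g0; exists (Num.truncn (`|C| / g)).+1 => p Pp.
apply: le_lt_trans (ler_norm C) _.
have : `|C| < g * p%:R.
  rewrite mulrC -ltr_pdivrMr //; apply: lt_le_trans (truncnS_gt _) _.
  by rewrite ler_nat.
by have := expR_ge1Dx (g * p%:R); lra.
Qed.

Lemma sum_geometric_le (R : realType) (q : R) (J : nat) : 0 <= q < 1 ->
  \sum_(j <- iota 0 J) q ^+ j <= (1 - q)^-1.
Proof.
move=> /andP [q0 q1]; have q1' : 0 < 1 - q by rewrite subr_gt0.
rewrite -[leRHS]mul1r ler_pdivlMr //.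
have -> : \sum_(j <- iota 0 J) q ^+ j = \sum_(j < J) q ^+ j.
  by rewrite -{1}[J]subn0 -/(index_iota 0 J) big_mkord.
have := subrX1 q J; have : 0 <= q ^+ J by rewrite exprn_ge0.
by set Sg := \sum_(j < J) _; set qJ := q ^+ J; clearbody Sg qJ; lra.
Qed.

Definition stage {R : realType} {d : nat} (u : R) (B : gball R d) : nat :=
  Num.truncn (- ln (radius B) / u).

Lemma at_stage_truncn (R : realType) d (u : R) (B : gball R d) S : 0 < u ->
  0 < radius B -> at_stage u B S -> stage u B = S.
Proof.
move=> u0 r0 /andP [s1 s2]; apply/eqP; rewrite /stage truncn_eq.
  rewrite ler_pdivlMr // ltr_pdivrMr //; apply/andP; split.
    by move: s2; rewrite -{1}[radius _]lnK ?posrE // ler_expR; lra.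
  by move: s1; rewrite -{1}[radius _]lnK ?posrE // ltr_expR; lra.
rewrite divr_ge0 // ?(ltW u0) // oppr_ge0.
move: s2; rewrite -{1}[radius _]lnK ?posrE // ler_expR => /le_trans; apply.
by rewrite oppr_le0 mulr_ge0 // ltW.
Qed.

Lemma stage_lt_radius (R : realType) d (u : R) (B : gball R d) : 0 < u ->
  0 < radius B -> expR (- (u * (stage u B).+1%:R)) < radius B.
Proof.
move=> u0 r0; have := truncnS_gt (- ln (radius B) / u).
rewrite -/(stage u B) ltr_pdivrMr // => h.
by rewrite -[ltRHS]lnK ?posrE // ltr_expR; lra.
Qed.

Section Homogeneous.
Context {R : realType} (d n : nat) (e : 'I_n -> 'I_d) (w : 'I_n -> R).
Context (om wm u : R) (i1 : 'I_n).

Theorem homogeneous_slabs (gam kap r0 : R) :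
  injective e -> 0 < wm -> (forall i, wm <= w i) -> \sum_i w i = 1 -> w i1 = om ->
  1 <= u -> 0 < gam -> 0 < kap -> 0 < r0 ->
  exists2 del : R, 0 < del & exists O : gball R d -> seq (@slab R d),
  [/\ forall B, 0 < radius B -> forall o, o \in O B -> unit_slab o,
      forall B, 0 < radius B -> \sum_(o <- O B) (width o / radius B) `^ gam <= kap &
  forall (b : nat -> gball R d) (N : nat), radius (b 0%N) = r0 ->
    (forall i, (i < N)%N -> cball (b i.+1) `<=` cball (b i)) ->
    (forall i, (i < N)%N -> expR (- u) * radius (b i) <= radius (b i.+1)) ->
    (forall i, (i <= N)%N -> 0 < radius (b i)) ->
    (forall i l o, (i <= l <= N)%N -> o \in O (b i) -> radius (b l) <= width o ->
      avoids (b l) o) ->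
    forall S i x t v, (i <= N)%N -> radius (b i) <= expR (- (u * S%:R)) ->
      cball (b i) x -> u * S%:R / (1 + om) <= t -> v != 0 ->
      ~ small w t (u * S%:R) (proj e x) del v].
Proof.
move=> inje wm0 wmw w1 wi1 u1 gam0 kap0 r00.
have u0 : 0 < u by lra.
have n0 : (0 < n)%N by case: n i1 => [[]|].
have nR : 1 <= n%:R :> R by rewrite ler1n.
(* The constants are chosen in the order sig, A, Lam, p0, S1, del, each in terms of the preceding
   ones. *)
pose sig := wm / (4 * n.+1%:R).
have nS0 : 0 < n.+1%:R :> R by rewrite ltr0n.
have sig0 : 0 < sig by rewrite divr_gt0 // mulr_gt0.
have sigc : n.+1%:R * sig <= wm / 4.
  rewrite le_eqVlt /sig; apply/orP; left; apply/eqP; field.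
  by rewrite gt_eqF.
pose A := (Num.truncn (8 * n%:R / sig)).+2.
have Asig : 8 * n%:R <= sig * A%:R.
  rewrite [leRHS]mulrC -ler_pdivrMr // ltW //; apply: lt_le_trans (truncnS_gt _) _.
  by rewrite ler_nat.
pose Lam := (2 * (n.+1 * A ^ n) + (Num.truncn ((16 * (n * A ^ n))%:R / wm : R)).+1)%N.
have LamA : (2 * (n.+1 * A ^ n) <= Lam)%N by rewrite leq_addr.
have LamW : (16 * (n * A ^ n))%:R <= wm * Lam%:R.
  rewrite [leRHS]mulrC -ler_pdivrMr // ltW //; apply: lt_le_trans (truncnS_gt _) _.
  by rewrite ler_nat leq_addl.
pose cst (k : nat) : R := 2 * n%:R * (k`!%:R * (2 * n%:R + 1) ^+ k)
  * (2 * (k`!%:R * 2 ^+ k * k`!%:R)) * ((2 * k%:R) ^+ k * expR (2 * u * Lam%:R) ^+ k).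
have cst0 k : 0 <= cst k.
  by rewrite !mulr_ge0 ?exprn_ge0 ?mulr_ge0 ?addr_ge0 ?expR_ge0 ?ler0n ?ler01.
have [P1 hP1] := @expR_large R (sig / 4) (\sum_(k < n.+1) cst k) (divr_gt0 sig0 (ltr0n _ 4)).
(* The slab of index j costs at most a constant times [exp (- g (j + p0))]: the sum over j is
   geometric, and p0 brings the total below kap. *)
pose g := gam * (sig / 8).
have g0 : 0 < g by rewrite mulr_gt0 // divr_gt0.
have q1 : expR (- g) < 1 by rewrite -expR0 ltr_expR oppr_lt0.
have q1' : 0 < 1 - expR (- g) by rewrite subr_gt0.
pose tot := n%:R * (expR (gam * u) * (1 - expR (- g))^-1).
have [P2 hP2] := @expR_large R g (tot / kap) g0.
pose p0 := (P1 + P2).+1.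
have p0_cst k : (k <= n)%N -> cst k < expR (sig / 4 * p0%:R).
  move=> kn; apply: le_lt_trans (hP1 _ _); last by rewrite /p0 -addnS leq_addr.
  by rewrite (bigD1 (Ordinal (kn : (k < n.+1)%N))) //= lerDl sumr_ge0.
have p0_cost : tot * expR (- (g * p0%:R)) <= kap.
  rewrite expRN ler_pdivrMr ?expR_gt0 // [leRHS]mulrC -ler_pdivrMr // ltW //.
  by apply: hP2; rewrite /p0 -addSn leq_addl.
(* S1 and del are the only constants that depend on r0. Ball 0 is larger than [exp (- (u S1 / 2))],
   and the chain for a stage [S >= S1] never looks back beyond stage [S / 2]. *)
have [S2 hS2] := @expR_large R (u / 2) r0^-1 (divr_gt0 u0 (ltr0n _ 2)).
pose S1 := (S2 + (Num.truncn ((16 * (Lam + n * A ^ n * p0))%:R / wm : R)).+1)%N.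
have S1_large : (16 * (Lam + n * A ^ n * p0))%:R <= wm * S1%:R.
  rewrite [leRHS]mulrC -ler_pdivrMr // ltW //; apply: lt_le_trans (truncnS_gt _) _.
  by rewrite ler_nat leq_addl.
have rad_r0 : expR (- (u * (S1%:R / 2))) < r0.
  rewrite expRN invf_plt ?posrE ?expR_gt0 //.
  have -> : u * (S1%:R / 2) = u / 2 * S1%:R by ring.
  by apply: hS2; rewrite leq_addr.
pose C1 := (2 * n%:R + 1) * expR (u * (A ^ n * p0)%:R).
pose C2 := expR (2 * (u * S1%:R) + u * Lam%:R).
have C1_1 : 1 <= C1.
  rewrite -[leLHS]mulr1 ler_pM //; first by lra.
  by rewrite -expR0 ler_expR mulr_ge0 // ltW.
have C2_1 : 1 <= C2.
  by rewrite -expR0 ler_expR addr_ge0 ?mulr_ge0 // ltW.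
pose F : R := n.+1`!%:R.
have F1 : 1 <= F by rewrite ler1n fact_gt0.
have F0 : 0 < F := lt_le_trans ltr01 F1.
have C10 : 0 < C1 := lt_le_trans ltr01 C1_1.
have C20 : 0 < C2 := lt_le_trans ltr01 C2_1.
pose del := (2 * F * C1 * C2)^-1.
have F20 : 0 < 2 * F := mulr_gt0 (ltr0n R 2) F0.
have F2C : 0 < 2 * F * C1 := mulr_gt0 F20 C10.
have del0 : 0 < del by rewrite invr_gt0; apply: mulr_gt0 F2C C20.
have F2 : (2 * F)^-1 <= 1 by rewrite invf_le1 //; clearbody F; lra.
have c1 : C1 * del <= (2 * F)^-1.
  have -> : C1 * del = (2 * F)^-1 / C2 by rewrite /del; field; rewrite !gt_eqF.
  by rewrite ler_pdivrMr // ler_peMr // invr_ge0 ltW.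
have del_init : F * (C1 * del) ^+ n.+1 < 1.
  have c0 : 0 <= C1 * del by rewrite mulr_ge0 // ltW.
  have h : (C1 * del) ^+ n.+1 <= C1 * del.
    by rewrite -[leRHS]expr1 ler_wiXn2l // (le_trans c1).
  apply: (@le_lt_trans _ _ (F * (2 * F)^-1)).
    by rewrite ler_pM2l // (le_trans h).
  by rewrite invfM mulrCA divff ?gt_eqF // mulr1 invf_lt1 // ltr1n.
have del_start : del * C2 < 1.
  have -> : del * C2 = (2 * F * C1)^-1 by rewrite /del; field; rewrite !gt_eqF.
  rewrite invf_lt1 //; apply: lt_le_trans (_ : 2 * F <= _).
    by clearbody F; lra.
  by rewrite ler_peMr // ltW.
pose good := good_slab e w om u sig del A Lam p0.
have /choice [pick pickP] : forall q : gball R d * nat * nat * nat, exists o : @slab R d,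
    [/\ unit_slab o, width o = slab_width u sig A p0 q.1.1.2 q.1.2.+1 q.2 &
     (exists o, [/\ unit_slab o, width o = slab_width u sig A p0 q.1.1.2 q.1.2.+1 q.2
       & good q.1.1.1 q.1.1.2 q.1.2 q.2 o]) -> good q.1.1.1 q.1.1.2 q.1.2 q.2 o].
  move=> q; have [[sl [sl1 sl2 sl3]]|no] := pselect (exists o, [/\ unit_slab o,
       width o = slab_width u sig A p0 q.1.1.2 q.1.2.+1 q.2
       & good q.1.1.1 q.1.1.2 q.1.2 q.2 o]); first by exists sl.
  (* An arbitrary slab of the same width, so that the cost estimate needs no case distinction. *)
  exists (lift_vec e (fun j => (j == i1)%:R), 0, slab_width u sig A p0 q.1.1.2 q.1.2.+1 q.2).
  split=> //; split; last exact: expR_gt0.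
  apply: l2norm_lift_vec => //; rewrite (bigD1 i1) //= ?eqxx expr1n big1 ?addr0 //.
  by move=> i /negPf ->; rewrite expr0n.
pose stage := @stage R d u.
pose O B := [seq pick (B, stage B, k, j) | k <- iota 0 n,
               j <- iota 0 (stage B + A ^ n * p0).+1].
have OP B o : o \in O B -> exists k j, o = pick (B, stage B, k, j).
  by move=> /allpairsP [[k j] [_ _ ->]]; exists k, j.
exists (del * expR (- (2 * u * Lam%:R))); first by rewrite mulr_gt0 ?expR_gt0.
exists O; split.
- by move=> B _ o /OP [k [j ->]]; case: (pickP (B, stage B, k, j)).
- move=> B rB; rewrite /O big_allpairs_dep.
  have stageB := stage_lt_radius u0 rB; rewrite -/(stage B) in stageB.
  have term k j : (width (pick (B, stage B, k, j)) / radius B) `^ gam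
      <= expR (gam * u) * expR (- (g * p0%:R)) * expR (- g) ^+ j.
    have [_ -> _] := pickP (B, stage B, k, j); rewrite /slab_width /=.
    have le1 : expR (- (u * (stage B)%:R) - sig / 8 * (u * (lag A p0 k.+1 j)%:R)) / radius B
        <= expR (u - sig / 8 * (j%:R + p0%:R)).
      rewrite ler_pdivrMr //; apply: (@le_trans _ _ (expR (u - sig / 8 * (j%:R + p0%:R))
         * expR (- (u * (stage B).+1%:R)))); last by rewrite ler_pM2l ?expR_gt0 // ltW.
      rewrite -expRD ler_expR -[(stage B).+1%:R]natr1 [u * (_ + 1)]mulrDr mulr1.
      have : j%:R + p0%:R <= u * (lag A p0 k.+1 j)%:R.
        rewrite -natrD -[leLHS]mul1r ler_pM // ler_nat /lag.
        by rewrite leq_pmull // expn_gt0.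
      move=> h; have := ler_wpM2l (ltW (divr_gt0 sig0 (ltr0n R 8))) h.
      set X := sig / 8 * _; set Y := sig / 8 * _; set Z := u * _.
      by clearbody X Y Z; lra.
    apply: (@le_trans _ _ (expR (u - sig / 8 * (j%:R + p0%:R)) `^ gam)).
      apply: ge0_ler_powR => //; rewrite ?nnegrE ?expR_ge0 ?(ltW gam0) //.
      by rewrite divr_ge0 ?expR_ge0 // ltW.
    rewrite -expRM -expRM_natr -!expRD ler_expR le_eqVlt; apply/orP; left; apply/eqP.
    by rewrite /g; ring.
  apply: le_trans p0_cost; rewrite /tot.
  apply: (@le_trans _ _ (\sum_(k <- iota 0 n) (expR (gam * u) * expR (- (g * p0%:R))
      * (1 - expR (- g))^-1))).
    apply: ler_sum => k _; apply: le_trans (ler_sum _ (fun j _ => term k j)) _.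
    rewrite -mulr_sumr ler_wpM2l ?mulr_ge0 ?expR_ge0 //.
    by apply: sum_geometric_le; rewrite expR_ge0 q1.
  rewrite big_const_seq count_predT size_iota iter_addr_0 -mulr_natl.
  by rewrite le_eqVlt; apply/orP; left; apply/eqP; ring.
move=> b N b0 subb radb posb clear S i x t v iN ri xi tt nzv sm.
apply: (@lattice_bounded_play R d n e w om wm u sig del A Lam p0 S1 i1 inje wm0 wmw
  w1 wi1 u1 sig0 sigc isT Asig LamA LamW isT p0_cst S1_large del0 b N
  (fun B S k j => pick (B, S, k, j)) _ subb radb posb _ del_init del_start _
  S i x iN ri xi t v tt nzv).
- by move=> B S' k j ex; case: (pickP (B, S', k, j)) => _ _; apply.
- by rewrite b0.
- move=> i' l S' k j ilN /andP [s1 s2] kn jn rl; apply: (clear i') => //; last first.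
    by have [_ -> _] := pickP (b i', S', k, j).
  have ri' : 0 < radius (b i').
    by apply: posb; case/andP: ilN => h1 h2; apply: leq_trans h1 h2.
  have stE : stage (b i') = S' by apply: at_stage_truncn => //; apply/andP.
  rewrite /O stE; apply/allpairsP; exists (k, j).
  by split; [rewrite mem_iota|rewrite mem_iota ltnS|].
- move=> r; apply: le_trans (sm r) _; rewrite ler_peMr ?mulr_ge0 ?expR_ge0 ?(ltW del0) //.
  by rewrite -[leLHS]expR0 ler_expR mulr_ge0 ?(ltW sig0) // subr_ge0.
Qed.
End Homogeneous.

(** * The inhomogeneous slabs *)

Section Transference.
Context {R : realType} (n : nat) (w : 'I_n -> R) (u om : R).
Hypotheses (w0 : forall i, 0 <= w i) (wom : forall i, w i <= om).
Hypotheses (w1 : \sum_i w i = 1) (u0 : 0 < u).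

Definition bounded_upto (S : nat) (del : R) (y : 'I_n -> R) : Prop :=
  forall S' t v, (S' <= S)%N -> u * S'%:R / (1 + om) <= t -> v != 0 ->
    ~ small w t (u * S'%:R) y del v.

Let n0 : (0 < n)%N.
Proof.
rewrite lt0n; apply/eqP => n0; have := w1; rewrite big1; last first.
  by move=> i; have := ltn_ord i; rewrite {2}n0.
by move=> /eqP; rewrite eq_sym oner_eq0.
Qed.

Let om0 : 0 <= om. Proof. exact: le_trans (w0 (Ordinal n0)) (wom _). Qed.

(** Let S' be the first stage with [u S' > (1 + om) T]. Its time [t = u S' / (1 + om)] lies between
    T and [T + u], and there [om t = s - t]: no exponent is cut, so the box with exponents [w i * T]
    lies in the one that [bounded_upto] excludes. *)
Lemma dual_bounded S del y T (v : 'cV[int]_n.+1) : bounded_upto S del y -> 0 < del ->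
  0 <= T -> (1 + om) * T + u <= u * S%:R -> v != 0 ->
  expR T * `|(v ord0 0)%:~R + \sum_i y i * (v (lift ord0 i) 0)%:~R| <= del * expR (- u) ->
  (forall i, `|(v (lift ord0 i) 0)%:~R| <= expR (w i * T) * del) -> False.
Proof.
move=> bd del0 T0 TS nzv vz vi; have u0' := u0; have om0' := om0.
have om1 : 0 < 1 + om by lra.
pose S' := (Num.truncn ((1 + om) * T / u)).+1.
have x0 : 0 <= (1 + om) * T / u by rewrite divr_ge0 ?mulr_ge0 // ltW.
have /andP [h1 h2] := truncn_itv x0.
have S'1 : (1 + om) * T <= u * S'%:R by rewrite [leRHS]mulrC -ler_pdivrMr // ltW.
have S'2 : u * S'%:R <= (1 + om) * T + u.
  rewrite /S' -natr1 mulrDr mulr1 lerD2r [leLHS]mulrC.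
  by rewrite -ler_pdivlMr.
have S'S : (S' <= S)%N.
  by rewrite -(ler_nat R) -(ler_pM2l u0); apply: le_trans TS.
pose t := u * S'%:R / (1 + om).
have Tt : T <= t by rewrite /t ler_pdivlMr // mulrC.
have tT : t <= T + u.
  rewrite /t ler_pdivrMr //; apply: le_trans S'2 _.
  have : 0 <= om * u by rewrite mulr_ge0 // ltW.
  by rewrite !mulrDr !mulrDl; lra.
apply: (bd S' t v S'S (lexx _) nzv); apply: smallI => [|i].
  apply: (@le_trans _ _ (expR u * (del * expR (- u)))); last first.
    by rewrite mulrCA -expRD subrr expR0 mulr1.
  apply: le_trans (ler_wpM2l (expR_ge0 u) vz); rewrite mulrA -expRD.
  by rewrite ler_wpM2r // ler_expR addrC.
apply: le_trans (vi i) _; rewrite ler_pM2r // ler_expR /texp le_min ler_wpM2l //=.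
have -> : u * S'%:R - t = om * t by rewrite /t; field; rewrite gt_eqF.
by apply: ler_pM.
Qed.

(* If [q != 0], Minkowski's theorem gives an integer vector a for which q b + a.p,
   an integer, is less than 1 in absolute value, hence 0; so |b + a.y| is small,
   against [dual_bounded]. *)
Lemma transference del : 0 < del -> exists2 eps, 0 < eps < 1 &
  forall S y T (q : int) (p : 'I_n -> int), bounded_upto S del y ->
    0 <= T -> (1 + om) * T + u <= u * S%:R ->
    `|q%:~R| <= eps * expR T ->
    (forall i, `|q%:~R * y i - (p i)%:~R| <= eps * expR (- (w i * T))) ->
    q = 0 /\ forall i, p i = 0.
Proof.
move=> del0; have u0' := u0; have om0' := om0.
have nR : 1 <= n%:R :> R by rewrite ler1n n0.
pose D := Num.min del (del * expR (- u) / n%:R).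
have D0 : 0 < D by rewrite lt_min del0 divr_gt0 ?mulr_gt0 ?expR_gt0 //; lra.
pose K : R := n.+1`!%:R * 2 ^+ n.+1.
have K0 : 0 < K by rewrite mulr_gt0 ?exprn_gt0 // ltr0n fact_gt0.
pose eps := Num.min (1 / 2) ((D / 2) ^+ n.+1 / (K * (2 * D))).
have D2 : 0 < D / 2 by rewrite divr_gt0.
have eps0 : 0 < eps.
  by rewrite lt_min !divr_gt0 ?mulr_gt0 ?exprn_gt0.
have eps1 : eps <= 1 / 2 by rewrite ge_min lexx.
have epsK : K * (eps * (2 * D)) <= (D / 2) ^+ n.+1.
  have : eps <= (D / 2) ^+ n.+1 / (K * (2 * D)) by rewrite ge_min lexx orbT.
  by rewrite ler_pdivlMr ?mulr_gt0 // mulrCA.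
exists eps => [|S y T q p bd T0 TS qT py]; first by rewrite eps0; lra.
have q0 : q = 0.
  apply: contrapT => /eqP nzq.
  have q1 : 1 <= `|q%:~R| :> R by rewrite -intr_norm -[1]/(1%:~R) ler_int -gtz0_ge1 normr_gt0.
  have q0 : 0 < `|q%:~R| :> R by lra.
  (* With this T' the determinant of A is [2 D eps] in absolute value, whatever q is. The factor
     [2 D] in row 0 turns the bound D of Minkowski's theorem into 1/2 for the integer
     [q b + p.a]. *)
  pose T' := ln (`|q%:~R| / eps).
  have qe : 0 < `|q%:~R| / eps by rewrite divr_gt0.
  have eT' : expR T' = `|q%:~R| / eps by rewrite lnK.
  have T'0 : 0 <= T'.
    by rewrite ln_ge0 // ler_pdivlMr // mul1r; lra.
  have T'T : T' <= T by rewrite -ler_expR eT' ler_pdivrMr // mulrC.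
  pose A : 'M[R]_n.+1 := \matrix_(r, l) if r == ord0
    then 2 * D * (oapp p q (unlift ord0 l))%:~R
    else (r == l)%:R * oapp (fun i => expR (- (w i * T'))) 0 (unlift ord0 r).
  have detA : \det A = 2 * D * q%:~R * expR (- T').
    rewrite -det_tr det_trig; last first.
      apply/is_trig_mxP => i j ij; rewrite !mxE.
      case: eqP => [jE|_]; first by move: ij; rewrite jE.
      by rewrite gt_eqF ?mul0r.
    rewrite big_ord_recl !mxE eqxx unlift_none /=; congr (_ * _).
    have -> : expR (- T') = \prod_i expR (- (w i * T')).
      by rewrite -expR_sum sumrN -mulr_suml w1 mul1r.
    apply: eq_bigr => i _.
    by rewrite !mxE /= eqxx mul1r liftK.
  have nzA : \det A != 0.
    rewrite detA mulf_neq0 ?(gt_eqF (expR_gt0 _)) //.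
    by rewrite mulf_neq0 ?intr_eq0 // gt_eqF // mulr_gt0.
  have leA : K * `|\det A| <= (D / 2) ^+ n.+1.
    apply: le_trans epsK; rewrite ler_pM2l // detA !normrM.
    rewrite (ger0_norm (expR_ge0 _)) (gtr0_norm D0) ger0_norm // expRN eT'.
    by rewrite le_eqVlt; apply/orP; left; apply/eqP; field; rewrite !gt_eqF.
  have [c nzc small_c] := real_minkowski (ltn0Sn n) (ltW D2) nzA leA.
  have D2E : 2 * (D / 2) = D by field.
  rewrite D2E in small_c.
  have intE : q%:~R * (c ord0 0)%:~R + \sum_(i < n) (p i)%:~R * (c (lift ord0 i) 0)%:~R
      = (q * c ord0 0 + \sum_i p i * c (lift ord0 i) 0)%:~R :> R.
    rewrite intrD intrM; congr (_ + _).
    by rewrite -[RHS]/(intr _) raddf_sum /=; apply: eq_bigr => i _; rewrite -intrM.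
  have c0 : q * c ord0 0 + \sum_i p i * c (lift ord0 i) 0 = 0.
    have := small_c ord0.
    have -> : (A *m map_mx intr c) ord0 0 = 2 * D * (q%:~R * (c ord0 0)%:~R
        + \sum_(i < n) (p i)%:~R * (c (lift ord0 i) 0)%:~R).
      rewrite mxE big_ord_recl !mxE eqxx unlift_none /= mulrDr mulr_sumr !mulrA.
      by congr (_ + _); apply: eq_bigr => i _; rewrite !mxE eqxx liftK /= !mulrA.
    rewrite normrM gtr0_norm ?mulr_gt0 //.
    rewrite intE.
    set z := q * _ + _ => h; apply: (@intr_norm_lt1 R).
    have : 2 * `|z%:~R| <= 1 :> R by rewrite -(ler_pM2l D0) mulr1 mulrCA mulrA.
    by have := normr_ge0 (z%:~R : R); lra.
  have ci i : `|(c (lift ord0 i) 0)%:~R| <= expR (w i * T') * D.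
    have := small_c (lift ord0 i).
    rewrite mxE (bigD1 (lift ord0 i)) //= !mxE eqxx mul1r liftK /= big1 ?addr0.
      rewrite normrM (ger0_norm (expR_ge0 _)) expRN mulrC ler_pdivrMr ?expR_gt0 //.
      by rewrite mulrC.
    by move=> l; rewrite !mxE /= eq_sym => /negPf ->; rewrite !mul0r.
  apply: (dual_bounded bd del0 T'0 _ nzc).
  - by apply: le_trans TS; rewrite lerD2r ler_wpM2l //; lra.
  - rewrite eT' mulrAC ler_pdivrMr // -normrM.
    have -> : q%:~R * ((c ord0 0)%:~R + \sum_i y i * (c (lift ord0 i) 0)%:~R)
        = \sum_i (q%:~R * y i - (p i)%:~R) * (c (lift ord0 i) 0)%:~R.
      have := intE; rewrite c0.
      move=> /eqP; rewrite addr_eq0 => /eqP c0E; rewrite mulrDr c0E addrC mulr_sumr -sumrB.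
      by apply: eq_bigr => i _; ring.
    apply: (le_trans (ler_norm_sum _ _ _)).
    apply: (@le_trans _ _ (\sum_(i < n) eps * D)).
      apply: ler_sum => i _; rewrite normrM.
      apply: le_trans (ler_pM (normr_ge0 _) (normr_ge0 _) (py i) (ci i)) _.
      have -> : eps * expR (- (w i * T)) * (expR (w i * T') * D)
        = eps * D * (expR (- (w i * T)) * expR (w i * T')) by ring.
      rewrite ler_piMr ?mulr_ge0 ?(ltW eps0) ?(ltW D0) //.
      by rewrite -expRD -[leRHS]expR0 ler_expR addrC subr_le0 ler_wpM2l.
    rewrite sumr_const card_ord -mulr_natl mulrCA mulrC ler_pM2r // mulrC.
    rewrite -ler_pdivlMr; last by lra.
    by rewrite ge_min lexx orbT.
  - by move=> i; apply: le_trans (ci i) _; rewrite ler_wpM2l ?expR_ge0 // ge_min lexx.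
split=> // i; have := py i; rewrite q0 mul0r sub0r normrN => h.
apply: (@intr_norm_lt1 R).
apply: le_lt_trans h _; apply: (@le_lt_trans _ _ eps); last by lra.
by rewrite ler_piMr ?(ltW eps0) // -expR0 ler_expR oppr_le0 mulr_ge0.
Qed.
End Transference.

Section Inhomogeneous.
Context {R : realType} (d n : nat) (e : 'I_n -> 'I_d) (w : 'I_n -> R).
Context (u om wm L : R) (i1 : 'I_n) (theta : 'I_n -> R -> R).
Hypotheses (inje : injective e) (wm0 : 0 < wm) (wmw : forall i, wm <= w i).
Hypotheses (wom : forall i, w i <= om) (wi1 : w i1 = om) (w1 : \sum_i w i = 1).
Hypotheses (u0 : 0 < u) (L0 : 0 <= L).
Hypothesis lip : forall i x y, `|theta i x - theta i y| <= L * `|x - y|.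

Ltac goal_lra := clear -inje wm0 wmw wom wi1 w1 u0 L0 lip; lra.

Let err (q : int) (p : 'I_n -> int) (x : 'rV[R]_d) j : R :=
  q%:~R * proj e x j - theta j (proj e x j) - (p j)%:~R.

Let err_shift q p x y j :
  `|err q p x j| <= `|err q p y j| + (`|q%:~R| + L) * `|proj e x j - proj e y j|.
Proof.
have -> : err q p x j = err q p y j + (q%:~R * (proj e x j - proj e y j)
   - (theta j (proj e x j) - theta j (proj e y j))) by rewrite /err; ring.
apply: (le_trans (ler_normD _ _)); rewrite lerD2l mulrDl -normrM.
by apply: (le_trans (ler_normB _ _)); rewrite lerD2l.
Qed.

(* [cl B q] numbers the short intervals that cover the range of q; by transference
   all dangerous (q, p) with q in the same interval coincide, so that one slab
   orthogonal to the coordinate of largest weight suffices for each. *)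
Theorem inhomogeneous_slabs (del gam kap : R) : 0 < del -> 0 < gam -> 0 < kap ->
  exists c C Q : R, 0 < c /\ exists O : gball R d -> seq (@slab R d),
  [/\ forall B, 0 < radius B -> forall o, o \in O B -> unit_slab o,
      forall B, 0 < radius B -> \sum_(o <- O B) (width o / radius B) `^ gam <= kap &
  forall (B B' : gball R d) S x q p T, 0 < radius B -> at_stage u B S ->
    bounded_upto w u om S del (proj e (center B)) ->
    cball B' `<=` cball B -> (forall o, o \in O B -> avoids B' o) -> cball B' x ->
    (1 + om) * T = u * S%:R - C -> expR T <= `|q%:~R| <= expR (T + u) ->
    Q <= `|q%:~R| ->
    ~ forall j, `|err q p x j| <= (c / `|q%:~R|) `^ (w j)].
Proof.
move=> del0 gam0 kap0; have u0' := u0; have wm0' := wm0; have L0' := L0.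
have w0 i : 0 <= w i by apply: le_trans (wmw i); apply: ltW.
have om0 : 0 < om by rewrite -wi1 (lt_le_trans wm0).
have [eps /andP [eps0 eps1] trans] := transference w0 wom w1 u0 del0.
have [P hP] := @expR_large R 1 (4 * (expR u + L) / eps) ltr01.
(* C shifts the stage against the time of q: the radius is at most [exp (- (1 + om) T - C)], so
   moving to the centre of the ball changes each error by at most [eps / 4 * exp (- (om T))]. *)
pose C := u + P%:R.
have uL0 : 0 <= expR u + L by rewrite addr_ge0 ?expR_ge0.
have hC : (expR u + L) * expR (- C) <= eps / 4.
  rewrite expRN ler_pdivrMr ?expR_gt0 // -ler_pdivrMl ?divr_gt0 //.
  have := hP P (leqnn P); rewrite mul1r => /ltW h.
  apply: (@le_trans _ _ (expR P%:R)); last by rewrite ler_expR lerDr ltW.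
  apply: le_trans h; rewrite le_eqVlt; apply/orP; left; apply/eqP; field.
  by rewrite gt_eqF.
pose K := Num.truncn (2 * expR u / eps).
have [G hG] := @expR_large R gam (K.+1%:R * expR (gam * u) / kap) gam0.
(* The first bound makes the differences of two dangerous pairs fit [transference]; the second makes
   [4 c1 exp (- (om T))] smaller than [exp T] times the width of a slab. *)
pose c1 := Num.min (eps / 4) (expR (- (C + G%:R)) / 8).
have c10 : 0 < c1 by rewrite lt_min !divr_gt0 ?expR_gt0.
have c1e : c1 <= eps / 4 by rewrite ge_min lexx.
have c1G : c1 <= expR (- (C + G%:R)) / 8 by rewrite ge_min lexx orbT.
(* Since [wm <= w j] and [c1 <= 1], this gives [c ^ (w j) <= c1] for every j. *)
pose c := expR (ln c1 / wm).
pose time (B : gball R d) : R := (u * (stage u B)%:R - C) / (1 + om).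
pose cl (B : gball R d) (q : int) :=
  Num.truncn ((q%:~R + expR (time B + u)) / (eps * expR (time B))).
pose danger (B : gball R d) q p x := [/\ cball B x,
   expR (time B) <= `|q%:~R| <= expR (time B + u) &
   forall j, `|err q p x j| <= c1 * expR (- (w j * time B))].
pose wid (B : gball R d) : R := expR (- (u * (stage u B)%:R) - G%:R).
(* In the coordinate of weight om, an error of order [exp (- (om T))] with [|q| >= exp T] confines x
   to a width of order [exp (- ((1 + om) T))], which is the order of the radius; smaller weights
   confine x less. *)
pose ei1 := lift_vec e (fun j => (j == i1)%:R : R).
have ei1_unit : l2norm ei1 = 1.
  apply: l2norm_lift_vec => //; rewrite (bigD1 i1) //= ?eqxx expr1n big1 ?addr0 //.
  by move=> i /negPf ->; rewrite expr0n.
have dotp_ei1 x : dotp ei1 x = proj e x i1.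
  rewrite dotp_lift_vec (bigD1 i1) //= ?eqxx mul1r big1 ?addr0 //.
  by move=> i /negPf ->; rewrite mul0r.
have /choice [pick pickP] : forall Bk : gball R d * nat, exists o : @slab R d,
    [/\ unit_slab o, width o = wid Bk.1 & (exists q p x, danger Bk.1 q p x /\ cl Bk.1 q = Bk.2) ->
     exists q p x, [/\ danger Bk.1 q p x, cl Bk.1 q = Bk.2 & o = (ei1, proj e x i1, wid Bk.1)]].
  move=> [B k] /=.
  have [[q [p [x [dx clq]]]]|no] := pselect (exists q p x, danger B q p x /\ cl B q = k).
    exists (ei1, proj e x i1, wid B); split => //; first by split; last exact: expR_gt0.
    by exists q, p, x.
  by exists (ei1, 0, wid B); split => //; split; last exact: expR_gt0.
(* [|q| >= 2 L] lets the variation of theta take up at most half of [|q| Delta]; [|q| >= exp u]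
   makes T nonnegative. *)
exists c, C, (2 * L + expR u); split; first exact: expR_gt0.
exists (fun B => [seq pick (B, k) | k <- iota 0 K.+1]); split.
- by move=> B _ o /mapP [k _ ->]; case: (pickP (B, k)).
- move=> B rB; rewrite big_map.
  have term k : (width (pick (B, k)) / radius B) `^ gam <= expR (gam * u) * expR (- (gam * G%:R)).
    have [_ -> _] := pickP (B, k); rewrite /wid /=.
    have le1 : expR (- (u * (stage u B)%:R) - G%:R) / radius B <= expR (u - G%:R).
      rewrite ler_pdivrMr //; apply: (@le_trans _ _ (expR (u - G%:R)
         * expR (- (u * (stage u B).+1%:R)))).
        rewrite -expRD ler_expR -[(stage u B).+1%:R]natr1 [u * (_ + 1)]mulrDr mulr1.
        by set X := u * _; clearbody X; lra.
      by rewrite ler_pM2l ?expR_gt0 // ltW // stage_lt_radius.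
    apply: (@le_trans _ _ (expR (u - G%:R) `^ gam)).
      apply: ge0_ler_powR => //; rewrite ?nnegrE ?expR_ge0 ?(ltW gam0) //.
      by rewrite divr_ge0 ?expR_ge0 // ltW.
    rewrite -expRM -expRD ler_expR le_eqVlt; apply/orP; left; apply/eqP; ring.
  apply: le_trans (ler_sum _ (fun k _ => term k)) _.
  rewrite big_const_seq count_predT size_iota iter_addr_0 -[_ *+ K.+1]mulr_natl mulrA.
  rewrite expRN ler_pdivrMr ?expR_gt0 // [leRHS]mulrC -ler_pdivrMr // ltW //.
  exact: hG.
move=> B B' S x q p T rB stB bd B'B av xB' TS qT qQ small_err.
have stE := at_stage_truncn u0 rB stB.
have TE : time B = T.
  by rewrite /time stE -TS mulrAC divff ?mul1r // gt_eqF //; lra.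
have T0 : 0 <= T.
  have : expR u <= expR (T + u) by apply: le_trans (andP qT).2; apply: le_trans qQ; lra.
  by rewrite ler_expR; lra.
have /andP [_ rS] := stB.
have c11 : c1 <= 1 by lra.
have cw j : c `^ w j <= c1.
  rewrite -expRM -[leRHS]lnK ?posrE // ler_expR mulrAC ler_pdivrMr //.
  by rewrite ler_wnM2l // -ln1 ler_ln ?posrE.
have eT0 : 1 <= expR T by rewrite -expR0 ler_expR.
have /andP [qT1 qT2] := qT.
have q0 : 0 < `|q%:~R| :> R by apply: lt_le_trans qT1; apply: expR_gt0.
have small_x j : `|err q p x j| <= c1 * expR (- (w j * T)).
  apply: le_trans (small_err j) _.
  apply: (@le_trans _ _ ((c * expR (- T)) `^ w j)).
    apply: ge0_ler_powR; rewrite ?nnegrE ?mulr_ge0 ?invr_ge0 ?expR_ge0 //.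
    by rewrite expRN ler_pM2l ?expR_gt0 // lef_pV2 ?posrE ?expR_gt0.
  rewrite powRM ?expR_ge0 // -expRM mulNr [T * _]mulrC.
  by rewrite ler_wpM2r ?expR_ge0.
have dq : danger B q p x by split; [exact: B'B|rewrite TE|move=> j; rewrite TE].
have uSE : u * S%:R = T + om * T + C by rewrite -[u * _](subrK C) -TS; ring.
have err_center q' p' x' j : danger B q' p' x' ->
    `|err q' p' (center B) j| <= eps / 2 * expR (- (w j * T)).
  move=> [Bx']; rewrite TE => /andP [_ qT'] ex'.
  apply: le_trans (err_shift _ _ _ x' _) _.
  have h1 : `|err q' p' x' j| <= eps / 4 * expR (- (w j * T)).
    by apply: le_trans (ex' j) _; rewrite ler_wpM2r ?expR_ge0.
  have h2 : (`|q'%:~R| + L) * `|proj e (center B) j - proj e x' j|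
      <= eps / 4 * expR (- (w j * T)).
    apply: (@le_trans _ _ (expR T * (expR u + L) * expR (- (u * S%:R)))).
      apply: ler_pM => //; first by rewrite addr_ge0.
        rewrite mulrDr -expRD lerD // ler_peMl //.
      by rewrite distrC; apply: le_trans (cball_coord _ Bx') rS.
    have -> : expR T * (expR u + L) * expR (- (u * S%:R))
      = (expR u + L) * expR (- C) * expR (- (om * T)).
      have -> : - (u * S%:R) = - C + - (om * T) - T by rewrite uSE; ring.
      rewrite expRD [expR (- C + _)]expRD.
      have : expR T * expR (- T) = 1 by rewrite -expRD subrr expR0.
      set a := expR T; set a' := expR (- T) => aa'.
      rewrite [RHS](_ : _ = a * a' * ((expR u + L) * expR (- C) * expR (- (om * T))));
        last by rewrite aa' mul1r.
      by ring.
    apply: ler_pM => //; rewrite ?mulr_ge0 ?expR_ge0 //.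
    by rewrite ler_expR lerN2 ler_wpM2r.
  have -> : eps / 2 * expR (- (w j * T))
    = eps / 4 * expR (- (w j * T)) + eps / 4 * expR (- (w j * T)).
    by field.
  exact: lerD.
have den0 : 0 < eps * expR T by rewrite mulr_gt0 ?expR_gt0.
have clK : (cl B q <= K)%N.
  rewrite /cl TE; apply: le_truncn; rewrite ler_pdivrMr //.
  have -> : 2 * expR u / eps * (eps * expR T) = 2 * expR (T + u).
    by rewrite expRD; field; rewrite gt_eqF.
  by move: (ler_norm (q%:~R : R)) qT2; goal_lra.
have [un_o wid_o ex] := pickP (B, cl B q).
have [q' [p' [x' [dq' clq' oE]]]] :=
  ex (ex_intro _ q (ex_intro _ p (ex_intro _ x (conj dq erefl)))).
have [qq' pp'] : q - q' = 0 /\ forall j, p j - p' j = 0.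
  apply: (trans S (proj e (center B)) T) => //.
  - by rewrite uSE /C; move: (ler0n R P); goal_lra.
  - rewrite rmorphB /=; have [_ + _] := dq'; rewrite TE => /andP [_ qT2'].
    move: clq'; rewrite /cl TE => /esym /(truncn_close den0).
    have -> : q%:~R + expR (T + u) - (q'%:~R + expR (T + u)) = q%:~R - q'%:~R :> R by ring.
    move: qT2 qT2'; rewrite !ler_norml => /andP [h1 _] /andP [h2 _]; apply;
      move: h1 h2; goal_lra.
  - move=> j.
    (* Both errors are taken at the centre of the ball, so theta cancels and a homogeneous
       approximation is left. *)
    have -> : (q - q')%:~R * proj e (center B) j - (p j - p' j)%:~R
        = err q p (center B) j - err q' p' (center B) j.
      by rewrite /err !rmorphB /=; ring.
    apply: (le_trans (ler_normB _ _)).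
    have := lerD (err_center _ _ _ j dq) (err_center _ _ _ j dq').
    by congr (_ <= _); field.
have {qq'}qq' : q = q' by apply/eqP; rewrite -subr_eq0 qq'.
have {pp'}pp' : p = p' by apply/funext => j; apply/eqP; rewrite -subr_eq0 pp'.
have : avoids B' (pick (B, cl B q)).
  by apply: av; apply: map_f; rewrite mem_iota ltnS.
move=> /(_ x xB'); rewrite wid_o oE /normal /offset /= dotp_ei1 leNgt => /negP; apply.
rewrite /wid stE; rewrite -qq' -pp' in dq'.
have [_ _ /(_ i1)] := dq'; rewrite TE wi1 => ex'.
have ex0 := small_x i1; rewrite wi1 in ex0.
set Delta := `|_|.
have D0 : 0 <= Delta by apply: normr_ge0.
have qD : `|q%:~R| * Delta <= L * Delta + 2 * (c1 * expR (- (om * T))).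
  rewrite /Delta -normrM.
  have -> : q%:~R * (proj e x i1 - proj e x' i1) = (theta i1 (proj e x i1) - theta i1 (proj e x' i1))
     + (err q p x i1 - err q p x' i1) by rewrite /err; ring.
  apply: (le_trans (ler_normD _ _)); apply: lerD; first exact: lip.
  by apply: (le_trans (ler_normB _ _)); move: ex0 ex'; goal_lra.
have h1 : expR T * Delta <= `|q%:~R| * Delta by rewrite ler_wpM2r.
have h2 : 2 * L * Delta <= `|q%:~R| * Delta.
  by rewrite ler_wpM2r //; apply: le_trans qQ; rewrite lerDl expR_ge0.
have h3 : expR T * Delta <= 4 * (c1 * expR (- (om * T))).
  move: qD h1 h2; set X := `|q%:~R| * Delta; set Y := expR T * Delta.
  set Z := c1 * _; have -> : 2 * L * Delta = 2 * (L * Delta) by ring.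
  by set V := L * Delta; clearbody X Y Z V; goal_lra.
rewrite -(ltr_pM2l (expR_gt0 T)); apply: le_lt_trans h3 _.
apply: (@le_lt_trans _ _ (4 * (expR (- (C + G%:R)) / 8 * expR (- (om * T))))).
  by rewrite ler_pM2l // ler_wpM2r ?expR_ge0.
have -> : expR T * expR (- (u * S%:R) - G%:R) = expR (- (C + G%:R)) * expR (- (om * T)).
  by rewrite -!expRD uSE; congr expR; ring.
have : 0 < expR (- (C + G%:R)) * expR (- (om * T)) by rewrite mulr_gt0 ?expR_gt0.
by set X := expR _; set Y := expR _; clearbody X Y; goal_lra.
Qed.
End Inhomogeneous.

(** * Euclidean balls *)

Section Euclid.
Context {R : realType} (d : nat).
Implicit Types x y a : 'rV[R]_d.

Lemma l2norm_ge0 x : 0 <= l2norm x. Proof. exact: sqrtr_ge0. Qed.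

Lemma l2norm0 : l2norm (0 : 'rV[R]_d) = 0.
Proof. by rewrite /l2norm big1 ?sqrtr0 // => i _; rewrite mxE expr0n. Qed.

Lemma l2normN x : l2norm (- x) = l2norm x.
Proof. by rewrite -scaleN1r l2normZ normrN1 mul1r. Qed.

Lemma l2norm_gt0 x : x != 0 -> 0 < l2norm x.
Proof.
move=> x0; rewrite lt_neqAle l2norm_ge0 andbT eq_sym; apply: contraNneq x0 => lx.
apply/eqP/rowP => i; rewrite mxE; apply/eqP; rewrite -normr_le0 -lx.
exact: coord_le_l2norm.
Qed.

Lemma dotpZl k a x : dotp (k *: a) x = k * dotp a x.
Proof. by rewrite /dotp mulr_sumr; apply: eq_bigr => i _; rewrite mxE mulrA. Qed.

Lemma dotpZr k a x : dotp a (k *: x) = k * dotp a x.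
Proof. by rewrite /dotp mulr_sumr; apply: eq_bigr => i _; rewrite mxE mulrCA. Qed.

Lemma dotpDr a x y : dotp a (x + y) = dotp a x + dotp a y.
Proof. by rewrite /dotp -big_split /=; apply: eq_bigr => i _; rewrite mxE mulrDr. Qed.

Lemma dotpxx x : dotp x x = l2norm x ^+ 2.
Proof. by rewrite l2norm_sqr /dotp; apply: eq_bigr => i _; rewrite expr2. Qed.

Lemma dotp_le_l2norm a x : l2norm a = 1 -> `|dotp a x| <= l2norm x.
Proof.
move=> a1; rewrite -(@ler_pXn2r _ 2) ?nnegrE ?l2norm_ge0 // l2norm_sqr real_normK ?num_real //.
have : 0 <= \sum_(i < d) (x ord0 i - dotp a x * a ord0 i) ^+ 2.
  by apply: sumr_ge0 => i _; apply: sqr_ge0.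
under eq_bigr do rewrite sqrrB exprMn.
rewrite big_split sumrB /= -mulr_sumr -(l2norm_sqr a) a1 expr1n mulr1.
have -> : \sum_(i < d) x ord0 i * (dotp a x * a ord0 i) *+ 2 = dotp a x ^+ 2 *+ 2.
  rewrite sumrMnl expr2 {3}/dotp mulr_sumr; congr (_ *+ 2).
  by apply: eq_bigr => i _; ring.
by set D := dotp a x; rewrite -mulr_natl; lra.
Qed.

Lemma l2normD x y : l2norm (x + y) <= l2norm x + l2norm y.
Proof.
have [->|nz] := eqVneq (x + y) 0; first by rewrite l2norm0 addr_ge0 ?l2norm_ge0.
have l0 := l2norm_gt0 nz; set a := (l2norm (x + y))^-1 *: (x + y).
have a1 : l2norm a = 1.
  by rewrite l2normZ ger0_norm ?invr_ge0 ?l2norm_ge0 // mulVf // gt_eqF.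
have -> : l2norm (x + y) = dotp a x + dotp a y.
  by rewrite -dotpDr dotpZl dotpxx expr2 mulKf // gt_eqF.
apply: lerD; apply: le_trans (ler_norm _) _; exact: dotp_le_l2norm.
Qed.

Lemma l2norm_le_coord x m : (forall i, `|x ord0 i| <= m) -> 0 <= m -> l2norm x <= d%:R * m.
Proof.
move=> xm m0; rewrite -(@ler_pXn2r _ 2) ?nnegrE ?l2norm_ge0 ?mulr_ge0 // l2norm_sqr.
apply: (@le_trans _ _ (\sum_(i < d) m ^+ 2)).
  by apply: ler_sum => i _; rewrite -[x _ _ ^+ 2]real_normK ?num_real // lerXn2r ?nnegrE.
rewrite sumr_const card_ord -[m ^+ 2 *+ d]mulr_natl exprMn ler_wpM2r ?sqr_ge0 // -natrX ler_nat.
by case: d => // d'; rewrite leq_pmulr.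
Qed.

Lemma cball_sub (B B' : gball R d) :
  l2norm (center B' - center B) + radius B' <= radius B -> cball B' `<=` cball B.
Proof.
move=> h x B'x; apply: le_trans h; rewrite [leRHS]addrC.
have -> : x - center B = (x - center B') + (center B' - center B) by rewrite addrA subrK.
by apply: le_trans (l2normD _ _) _; rewrite lerD2r.
Qed.

(** The point of B' farthest from the centre of B lies on the line through both centres; if they
    coincide, any unit vector gives one, which takes [0 < d]. *)
Lemma cball_sub_radius (B B' : gball R d) : (0 < d)%N -> 0 <= radius B' ->
  cball B' `<=` cball B -> l2norm (center B' - center B) + radius B' <= radius B.
Proof.
move=> d0 r0 sub; set v := center B' - center B.
have [v0|nz] := eqVneq v 0.
  pose u : 'rV[R]_d := delta_mx ord0 (Ordinal d0).
  have u1 : l2norm u = 1.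
    rewrite /l2norm (bigD1 (Ordinal d0)) //= mxE !eqxx expr1n big1 ?addr0 ?sqrtr1 //.
    by move=> i /negPf i0; rewrite mxE i0 andbF expr0n.
  rewrite v0 l2norm0 add0r.
  have /sub : cball B' (center B' + radius B' *: u).
    by rewrite /cball /= addrAC subrr add0r l2normZ u1 mulr1 ger0_norm.
  rewrite /cball /= addrAC -/v v0 add0r l2normZ u1 mulr1 ger0_norm //.
have l0 := l2norm_gt0 nz.
have /sub : cball B' (center B' + (radius B' / l2norm v) *: v).
  rewrite /cball /= addrAC subrr add0r l2normZ ger0_norm ?divr_ge0 ?l2norm_ge0 //.
  by rewrite divfK // gt_eqF.
rewrite /cball /= addrAC -/v -{1}[v]scale1r -scalerDl l2normZ ger0_norm.
  by rewrite mulrDl mul1r divfK // gt_eqF.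
by rewrite addr_ge0 // divr_ge0 // l2norm_ge0.
Qed.

(* A ball of radius rho r pushed to the boundary of B on the side of the
   center away from the hyperplane. *)
Lemma escape_ball (B : gball R d) H eps rho del : 0 < radius B ->
  affine_hyperplane H -> 0 < rho <= 1 -> del + rho <= 1 - rho -> eps <= del * radius B ->
  exists B' : gball R d, [/\ radius B' = rho * radius B, cball B' `<=` cball B &
    cball B' `&` neighbourhood H eps = set0].
Proof.
move=> r0 [a [c [a0 HE]]] /andP [rho0 rho1] dr er.
have l0 := l2norm_gt0 a0; pose a' := (l2norm a)^-1 *: a.
have a'1 : l2norm a' = 1.
  by rewrite l2normZ ger0_norm ?invr_ge0 ?l2norm_ge0 // mulVf // gt_eqF.
pose c' := c / l2norm a; pose sg : R := if 0 <= dotp a' (center B) - c' then 1 else -1.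
have sgn : `|sg| = 1 by rewrite /sg; case: ifP; rewrite ?normrN1 ?normr1.
have sgE : sg * (dotp a' (center B) - c') = `|dotp a' (center B) - c'|.
  rewrite /sg; case: ifP => [h|/negbT]; first by rewrite mul1r ger0_norm.
  by rewrite -ltNge => h; rewrite mulN1r ltr0_norm.
have sg2 : sg * sg = 1 by rewrite /sg; case: ifP; rewrite ?mulr1 ?mulrN1 ?opprK.
pose B' := GBall (center B + (sg * ((1 - rho) * radius B)) *: a') (rho * radius B).
have k0 : 0 <= (1 - rho) * radius B by rewrite mulr_ge0 ?subr_ge0 // ltW.
exists B'; split => //.
  apply: cball_sub; rewrite /B' /= addrAC subrr add0r l2normZ a'1 mulr1 normrM sgn mul1r.
  by rewrite ger0_norm // -mulrDl subrK mul1r.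
rewrite -subset0 => x [B'x [y Hy xy]].
have yH : dotp a' y = c'.
  by move: Hy; rewrite HE /= dotpZl /c' mulrC => <-.
have : `|dotp a' (x - y)| < eps by apply: le_lt_trans xy; apply: dotp_le_l2norm.
rewrite ltNge => /negP; apply; apply: (le_trans er).
have -> : dotp a' (x - y) = (dotp a' (center B) - c') + sg * ((1 - rho) * radius B)
    + dotp a' (x - center B').
  rewrite !dotpBr yH /B' /= dotpDr dotpZr dotpxx a'1; ring.
set z := _ - c'; set k := (1 - rho) * _; set f := dotp a' (x - _).
have fle : `|f| <= rho * radius B by apply: le_trans (dotp_le_l2norm _ a'1) B'x.
have -> : `|z + sg * k + f| = Num.norm (`|z| + k + sg * f).
  have sgz : sg * z = `|z| := sgE.
  rewrite -[LHS]mul1r -sgn -normrM (mulrDr sg (z + _)) (mulrDr sg z).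
  rewrite sgz [sg * (sg * k)]mulrA sg2 mul1r.
  by [].
apply: le_trans (ler_norm _).
have : - (rho * radius B) <= sg * f.
  have : `|sg * f| <= rho * radius B by rewrite normrM sgn mul1r.
  by rewrite ler_norml => /andP [].
have h := ler_wpM2r (ltW r0) dr; rewrite mulrDl in h.
by have := normr_ge0 z; rewrite /k; lra.
Qed.

Lemma nested_sub (b : nat -> gball R d) i j : (forall k, cball (b k.+1) `<=` cball (b k)) ->
  (i <= j)%N -> cball (b j) `<=` cball (b i).
Proof.
move=> sub; elim: j => [|j IH]; first by rewrite leqn0 => /eqP ->.
by rewrite leq_eqVlt => /orP [/eqP -> //|ij] x /sub /(IH ij).
Qed.

Lemma nested_point (b : nat -> gball R d) : (0 < d)%N ->
  (forall k, cball (b k.+1) `<=` cball (b k)) -> (forall k, 0 < radius (b k)) ->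
  (forall eps, 0 < eps -> exists k, radius (b k) < eps) ->
  exists x, forall k, cball (b k) x.
Proof.
move=> d0 sub r0 rlim.
have cdist i j : (i <= j)%N -> l2norm (center (b j) - center (b i)) + radius (b j) <= radius (b i).
  by move=> ij; apply: cball_sub_radius (ltW (r0 j)) (nested_sub sub ij).
have cdi i j l : (i <= j)%N ->
    `|center (b j) ord0 l - center (b i) ord0 l| + radius (b j) <= radius (b i).
  move=> /cdist; apply: le_trans; rewrite lerD2r.
  by have := coord_le_l2norm (center (b j) - center (b i)) l; rewrite !mxE.
pose E l : set R := [set z | exists k, z = center (b k) ord0 l - radius (b k)].
have ubE l k z : E l z -> z <= center (b k) ord0 l + radius (b k).
  move=> [k' ->].
  case: (leqP k k') => [/cdi|/ltnW /cdi] /(_ l); rewrite -lerBrDr ler_norml.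
    by move=> /andP [h1 h2]; have := r0 k'; have := r0 k; lra.
  by move=> /andP [h1 h2]; have := r0 k'; have := r0 k; lra.
have E0 l : E l !=set0 by exists (center (b 0%N) ord0 l - radius (b 0%N)), 0%N.
have supE l : has_sup (E l).
  by split => //; exists (center (b 0%N) ord0 l + radius (b 0%N)) => z; apply: ubE.
pose x : 'rV[R]_d := \row_l sup (E l).
have xc k l : `|x ord0 l - center (b k) ord0 l| <= radius (b k).
  rewrite mxE ler_norml; apply/andP; split.
    have : center (b k) ord0 l - radius (b k) <= sup (E l).
      by apply: ub_le_sup; [exact: (supE l).2|exists k].
    lra.
  rewrite lerBlDl; apply: ge_sup => // z; exact: ubE.
(* The coordinates only place x within [d * radius] of a centre. In a ball so late that
   [(d + 1) * radius] is below the supposed excess, this contradicts the nesting of the balls. *)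
exists x => k; rewrite /cball /= leNgt; apply/negP => lt.
have d1 : 0 < d%:R + 1 :> R by rewrite ltr_wpDl.
rewrite -subr_gt0 in lt; have [j rj] := rlim _ (divr_gt0 lt d1).
have kj : (k <= maxn j k)%N by rewrite leq_maxr.
have rj' : radius (b (maxn j k)) <= radius (b j).
  by apply: le_trans (cdist _ _ (leq_maxl j k)); rewrite lerDr l2norm_ge0.
have h1 := cdist _ _ kj.
have h2 : l2norm (x - center (b (maxn j k))) <= d%:R * radius (b (maxn j k)).
  by apply: l2norm_le_coord => [l|]; [have := xc (maxn j k) l; rewrite !mxE|apply: ltW].
have := l2normD (x - center (b (maxn j k))) (center (b (maxn j k)) - center (b k)).
rewrite addrA subrK => h3; rewrite ltr_pdivlMr // in rj.
have h4 : radius (b (maxn j k)) * (d%:R + 1) <= radius (b j) * (d%:R + 1).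
  by rewrite ler_pM2r.
have := r0 (maxn j k); move: h1 h2 h3 h4 rj; rewrite mulrDr mulr1 [_ * d%:R]mulrC.
set A := l2norm _; set A2 := l2norm _; set A3 := l2norm _.
set P := d%:R * _; set Q := radius (b j) * _; clearbody A A2 A3 P Q; lra.
Qed.
End Euclid.

(** * The two games *)

Lemma positive_part (R : realType) d (w : 'I_d -> R) : is_weight w ->
  exists n (e : 'I_n -> 'I_d), [/\ (0 < n)%N, injective e, forall j, 0 < w (e j),
    forall i, w i != 0 -> exists j, e j = i & \sum_j w (e j) = 1].
Proof.
move=> [w0 w1]; pose A := [pred i | 0 < w i].
have wA : \sum_(j < #|A|) w (enum_val j) = 1.
  rewrite -big_enum_val -w1 [RHS](bigID (mem A)) /= [X in _ + X]big1 ?addr0 //.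
  by move=> i; rewrite inE -leNgt => wi; apply/eqP; rewrite eq_le wi w0.
exists #|A|, (@enum_val _ A); split => //.
- by rewrite lt0n; apply: contraPneq wA => A0; rewrite big1 => [/esym/eqP|j _];
    [rewrite oner_eq0|have := ltn_ord j; rewrite {2}A0].
- exact: enum_val_inj.
- by move=> j; have := enum_valP j; rewrite inE.
- move=> i wi; have iA : i \in A by rewrite inE lt_neqAle eq_sym wi w0.
  by exists (enum_rank_in iA i); rewrite enum_rankK_in.
Qed.

Lemma distZ_lt (R : realType) (x y : R) : distZ x < y -> exists m : int, `|x - m%:~R| < y.
Proof.
by move=> /inf_lt [|_ [m _ <-] lt]; [exists (`|x - 0%:~R|), 0|exists m].
Qed.

Lemma distZ_ge0 (R : realType) (x : R) : 0 <= distZ x.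
Proof.
apply: lb_le_inf; first by exists (`|x - 0%:~R|), 0.
by move=> _ [m _ <-]; apply: normr_ge0.
Qed.

(** Coordinates of weight 0 contribute 0 to the maximum, so it is enough that for each large q one
    coordinate of positive weight is at distance at least [(c / |q|) ^ w]; then c bounds the lower
    limit from below. *)
Lemma Bad_of_approx (R : realType) d n (e : 'I_n -> 'I_d) (w : 'I_d -> R)
    (theta : 'I_d -> R -> R) (x : 'rV[R]_d) (c Q : R) : 0 < c ->
  (forall j, 0 < w (e j)) ->
  (forall (q : int) (p : 'I_n -> int), Q <= `|q%:~R| ->
     ~ forall j, `|q%:~R * x ord0 (e j) - theta (e j) (x ord0 (e j)) - (p j)%:~R|
       <= (c / `|q%:~R|) `^ w (e j)) ->
  Bad theta w x.
Proof.
move=> c0 wpos far; rewrite /Bad /= limf_einfE.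
pose N := (Num.truncn Q).+1.
set f := (fun q : int => _).
apply: (@lt_le_trans _ _ c%:E); first by rewrite lte_fin.
apply: (@le_trans _ _ (ereal_inf [set f q | q in [set q : int | (N < `|q|)%N]])); last first.
  apply: ereal_sup_ubound; exists [set q : int | (N < `|q|)%N] => //.
  by exists N.
apply: le_ereal_inf_tmp => _ [q /= Nq <-]; rewrite /f lee_fin.
have qE : `|q%:~R| = `|q|%N%:R :> R by rewrite natr_absz intr_norm.
have Qq : Q <= `|q%:~R|.
  rewrite qE ltW // (lt_le_trans (truncnS_gt _)) // ler_nat ltnW //.
have q0 : 0 < `|q%:~R| :> R by rewrite qE ltr0n (leq_trans _ Nq).
have [j hj] : exists j, (c / `|q%:~R|) `^ w (e j)
    <= distZ (q%:~R * x ord0 (e j) - theta (e j) (x ord0 (e j))).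
  apply: contrapT => no.
  have /choice [p hp] : forall j, exists m : int,
     `|q%:~R * x ord0 (e j) - theta (e j) (x ord0 (e j)) - m%:~R| < (c / `|q%:~R|) `^ w (e j).
    by move=> j; apply: distZ_lt; rewrite ltNge; apply/negP => h; apply: no; exists j.
  by apply: (far q p Qq) => j; apply: ltW.
rewrite -ler_pdivrMr //; apply: le_trans (le_bigmax _ _ (e j)).
rewrite /distZ_pow (gt_eqF (wpos j)).
have -> : c / `|q%:~R| = ((c / `|q%:~R|) `^ w (e j)) `^ (w (e j))^-1.
  by rewrite -powRrM divff ?gt_eqF // powRr1 // divr_ge0 // ltW.
by apply: ge0_ler_powR; rewrite ?nnegrE ?powR_ge0 ?distZ_ge0 // invr_ge0 ltW.
Qed.

Lemma common_lipschitz (R : realType) d (theta : 'I_d -> R -> R) :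
  (forall i, lipschitz (theta i)) ->
  exists2 L : R, 0 <= L & forall i x y, `|theta i x - theta i y| <= L * `|x - y|.
Proof.
move=> lip; have /choice [L hL] : forall i, exists L : R, 0 <= L /\
    forall x y, `|theta i x - theta i y| <= L * `|x - y|.
  move=> i; have [M [_ hM]] := lip i; exists (`|M| + 1).
  split; first by rewrite addr_ge0.
  move=> x y; apply: (hM (`|M| + 1) _ (x, y)) => //.
  by apply: le_lt_trans (ler_norm M) _; rewrite ltrDl.
exists (\sum_i L i); first by apply: sumr_ge0 => i _; case: (hL i).
move=> i x y; have [L0 /(_ x y) h] := hL i; apply: le_trans h _.
rewrite ler_wpM2r // (bigD1 i) //= lerDl sumr_ge0 // => l _.
by case: (hL l).
Qed.

(** A stage offers finitely many slabs, so a sufficiently late ball is smaller than the width of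
    each of them and has to avoid them all. *)
Lemma slab_width_lb (R : realType) d (s : seq (@slab R d)) :
  (forall o, o \in s -> unit_slab o) ->
  exists2 m : R, 0 < m & forall o, o \in s -> m <= width o.
Proof.
elim: s => [|o s IH] us; first by exists 1.
have [m m0 hm] : exists2 m : R, 0 < m & forall o, o \in s -> m <= width o.
  by apply: IH => o' os; apply: us; rewrite inE os orbT.
have [_ wo] := us o (mem_head _ _).
exists (Num.min m (width o)); first by rewrite lt_min m0.
move=> o'; rewrite inE => /orP [/eqP ->|/hm h]; rewrite ge_min ?lexx ?orbT //.
by rewrite h.
Qed.

Section Shrinking.
Context {R : realType} (d : nat) (w : 'I_d -> R) (theta : 'I_d -> R -> R).
Hypotheses (hd : (0 < d)%N) (hw : is_weight w).
Hypothesis htheta : forall i : 'I_d, lipschitz (theta i).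

(** In the hyperplane game Bob may keep the radii away from 0, and then only finitely many stages
    are reached. Such plays are left aside here: their intersection contains a ball, and [Bad] is
    dense. *)
Definition wins_shrinking (beta : R) (sigma : seq (gball R d) -> set 'rV[R]_d * R)
    (b : nat -> gball R d) : Prop :=
  let a n := sigma (mkseq b n.+1) in
  (forall n, (forall k, (k < n)%N -> hag_bob beta (b k) (a k) (b k.+1)) ->
    [/\ 0 < radius (b n), affine_hyperplane (a n).1 & (a n).2 = beta * radius (b n)]) /\
  ((forall k, hag_bob beta (b k) (a k) (b k.+1)) ->
   (forall eps, 0 < eps -> exists k, radius (b k) < eps) ->
   forall x, (forall k, cball (b k) x) -> Bad theta w x).

Lemma hag_shrinking_radius (beta r0 : R) : 0 < beta < 1 -> 0 < r0 ->
  exists sigma, forall b, radius (b 0%N) = r0 -> wins_shrinking beta sigma b.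
Proof.
move=> beta01 r00; have [beta0 beta1] := andP beta01.
have [n [e [n0 inje wpos _ w1]]] := positive_part hw.
have [i1 _ maxw] := @arg_maxP _ _ _ (Ordinal n0) predT (fun j => w (e j)) isT.
have [i2 _ minw] := @arg_minP _ _ _ (Ordinal n0) predT (fun j => w (e j)) isT.
pose om := w (e i1); pose wm := w (e i2); pose w' j := w (e j).
have wm0 : 0 < wm by apply: wpos.
have wmw j : wm <= w' j by apply: minw.
have wom j : w' j <= om by apply: maxw.
have om0 : 0 < om by apply: wpos.
have [L L0 lip] := common_lipschitz htheta.
(* [exp (- u) <= beta], so no move of Bob skips a stage. *)
pose u := Num.max 1 (- ln beta).
have u1 : 1 <= u by rewrite le_max lexx.
have u0 : 0 < u by lra.
have ub : expR (- u) <= beta.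
  rewrite -[leRHS]lnK ?posrE // ler_expR lerNl le_max lexx orbT //.
have [gam [kap [gam0 kap0 strat]]] := potential_strategy hd beta01.
have kap20 : 0 < kap / 2 by rewrite divr_gt0.
have [del del0 [sl1 [unit1 cost1 play1]]] :=
  homogeneous_slabs inje wm0 wmw w1 (erefl om : w' i1 = om) u1 gam0 kap20 r00.
have [c [C [Q [c0 [sl2 [unit2 cost2 play2]]]]]] :=
  inhomogeneous_slabs inje wm0 wmw wom (erefl om : w' i1 = om) w1 u0 L0
    (fun j => lip (e j)) del0 gam0 kap20.
have [||sigma hs] := strat (fun B => sl1 B ++ sl2 B).
- by move=> B rB o; rewrite mem_cat => /orP [/(unit1 B rB)|/(unit2 B rB)].
- by move=> B rB; rewrite big_cat /=; have := cost1 B rB; have := cost2 B rB; lra.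
exists sigma => b b0; have b0' : 0 < radius (b 0%N) by rewrite b0.
split.
  by move=> n' legal; have [h1 h2 h3 _] := hs b b0' n' legal.
move=> legal shrink x xb.
have H n' := hs b b0' n' (fun k _ => legal k).
have rb n' : 0 < radius (b n') by have [] := H n'.
have sub k : cball (b k.+1) `<=` cball (b k) by have [] := legal k.
have rad k : expR (- u) * radius (b k) <= radius (b k.+1).
  have [_ h _] := legal k; apply: le_trans h.
  by rewrite ler_pM2r.
have mono i j : (i <= j)%N -> radius (b j) <= radius (b i).
  move=> ij; have := cball_sub_radius hd (ltW (rb j)) (nested_sub sub ij).
  by apply: le_trans; rewrite lerDr l2norm_ge0.
have om1 : 0 < 1 + om by lra.
(* The last two bounds make the stage of q nonnegative and place it after ball 0. *)
pose Q' := Num.max Q (Num.max 1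
  (Num.max (expR (`|C| / (1 + om))) (expR ((u - C - ln r0) / (1 + om))))).
apply: (@Bad_of_approx R d n e w theta x c Q') => // q p.
rewrite !ge_max => /and4P [qQ q1 qC qr].
have q0 : 0 < `|q%:~R| :> R by apply: lt_le_trans q1.
set lq : R := ln `|q%:~R|.
have lqE : `|q%:~R| = expR lq by rewrite /lq lnK ?posrE.
have arg0 : `|C| <= (1 + om) * lq.
  by move: qC; rewrite lqE ler_expR ler_pdivrMr // [lq * _]mulrC.
have argr : u - C - ln r0 <= (1 + om) * lq.
  by move: qr; rewrite lqE ler_expR ler_pdivrMr // [lq * _]mulrC.
have aC0 : 0 <= (1 + om) * lq + C by have := ler_norm (- C); rewrite normrN; lra.
(* S is the last stage whose time T satisfies [exp T <= |q|]; the next one being too late,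
   [|q| <= exp (T + u)]. *)
pose S := Num.truncn (((1 + om) * lq + C) / u).
have /andP [S1 S2] : S%:R <= ((1 + om) * lq + C) / u < S.+1%:R.
  by apply: truncn_itv; rewrite divr_ge0 // ltW.
move: S1 S2; rewrite ler_pdivlMr // ltr_pdivrMr // => S1 S2.
have {}S2 : (1 + om) * lq + C < u * S%:R + u.
  by move: S2; rewrite -natr1 [(_ + 1) * u]mulrDl mul1r [S%:R * u]mulrC.
pose T := (u * S%:R - C) / (1 + om).
have TE : (1 + om) * T = u * S%:R - C by rewrite /T mulrC divfK // gt_eqF.
have T1 : T <= lq by rewrite ler_pdivrMr // [lq * _]mulrC; lra.
have T2 : lq <= T + u.
  have : (1 + om) * lq <= (1 + om) * (T + u).
    rewrite mulrDr TE.
    have := mulr_ge0 (ltW om0) (ltW u0).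
    rewrite [(1 + om) * u]mulrDl mul1r; lra.
  by rewrite ler_pM2l.
have eS : expR (- (u * S%:R)) < radius (b 0%N).
  rewrite b0 -[ltRHS]lnK ?posrE // ltr_expR; lra.
have exi : exists i, radius (b i) <= expR (- (u * S%:R)).
  by have [i /ltW] := shrink _ (expR_gt0 (- (u * S%:R))); exists i.
case: (ex_minnP exi) => [[|i] ri mini]; first by have := lt_le_trans eS ri; rewrite ltxx.
have rS : expR (- (u * S%:R)) < radius (b i).
  by rewrite ltNge; apply/negP => /mini; rewrite ltnn.
have st : at_stage u (b i.+1) S.
  rewrite /at_stage ri andbT; apply: lt_le_trans (rad i).
  by rewrite -natr1 mulrDr mulr1 opprD expRD mulrC ltr_pM2l ?expR_gt0.
have bdd : bounded_upto w' u om S del (proj e (center (b i.+1))).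
  move=> S' t v S'S tl v0; apply: (play1 b i.+1 b0 _ _ _ _ S' i.+1 (center (b i.+1)) t v) => //.
  - move=> i' l o /andP [i'l _] oO rl y yl.
    have [_ _ _ /(_ i' o y i'l)] := H l; apply => //.
    by rewrite mem_cat oO.
  - apply: le_trans ri _; rewrite ler_expR lerN2 ler_pM2l // ler_nat //.
  - by rewrite /cball /= subrr l2norm0 ltW.
have [m m0 hm] := slab_width_lb (unit2 _ (rb i.+1)).
have [l rl] : exists l, radius (b l) < Num.min m (radius (b i.+1)).
  by apply: shrink; rewrite lt_min m0 rb.
move: rl; rewrite lt_min => /andP [rlm rli].
have il : (i.+1 <= l)%N.
  by rewrite leqNgt; apply/negP => /ltnW /mono; rewrite leNgt rli.
apply: (play2 (b i.+1) (b l) S x q p T (rb i.+1) st bdd) => //.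
- exact: nested_sub.
- move=> o oO y yl; have [_ _ _ /(_ i.+1 o y il)] := H l; apply => //.
    by rewrite mem_cat oO orbT.
  by apply: le_trans (hm o oO); apply: ltW.
- by rewrite lqE !ler_expR T1.
Qed.

(* The slabs depend on the initial radius, read off the first ball of the history. *)
Lemma hag_shrinking (beta : R) : 0 < beta < 1 ->
  exists sigma, forall b, 0 < radius (b 0%N) -> wins_shrinking beta sigma b.
Proof.
move=> beta01; have /choice [f hf] : forall r0 : R, exists sigma, 0 < r0 ->
    forall b, radius (b 0%N) = r0 -> wins_shrinking beta sigma b.
  move=> r0; have [r00|r00] := ltP 0 r0; last by exists (fun=> (set0, 0)).
  by have [sigma h] := hag_shrinking_radius beta01 r00; exists sigma.
exists (fun h => f (radius (head (GBall 0 0) h)) h) => b b0.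
exact: hf _ b0 b erefl.
Qed.

Lemma escape_choice (rho del : R) : 0 < rho <= 1 -> del + rho <= 1 - rho ->
  exists f : gball R d -> set 'rV[R]_d * R -> gball R d,
  forall B A, 0 < radius B -> affine_hyperplane A.1 -> A.2 = del * radius B ->
    [/\ radius (f B A) = rho * radius B, cball (f B A) `<=` cball B &
      cball (f B A) `&` neighbourhood A.1 A.2 = set0].
Proof.
move=> rho01 dr; have /choice [f hf] : forall BA : gball R d * (set 'rV[R]_d * R),
    exists B' : gball R d, 0 < radius BA.1 -> affine_hyperplane BA.2.1 ->
    BA.2.2 = del * radius BA.1 -> [/\ radius B' = rho * radius BA.1,
      cball B' `<=` cball BA.1 & cball B' `&` neighbourhood BA.2.1 BA.2.2 = set0].
  move=> [B [H eps]] /=; have [h|h] := pselect (0 < radius B /\ affine_hyperplane H /\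
      eps = del * radius B); last by exists B => ? ? ?; case: h.
  have [r0 [aH ->]] := h.
  by have [B' hB'] := escape_ball r0 aH rho01 dr (lexx _); exists B'.
by exists (fun B A => f (B, A)) => B A; apply: (hf (B, A)).
Qed.

Lemma geometric_lt (q r eps : R) : 0 < q < 1 -> 0 < eps -> exists k, q ^+ k * r < eps.
Proof.
move=> /andP [q0 q1] eps0; have r1 : 0 < `|r| + 1 by rewrite ltr_wpDl.
have /cvgrPdist_lt /(_ (eps / (`|r| + 1)) (divr_gt0 eps0 r1)) [k _ hk] :
    (fun n => q ^+ n) @ \oo --> (0 : R) by apply: cvg_expr; rewrite gtr0_norm.
exists k; have := hk k (leqnn k); rewrite /= sub0r normrN gtr0_norm ?exprn_gt0 //.
rewrite ltr_pdivlMr //; apply: le_lt_trans; rewrite ler_pM2l ?exprn_gt0 //.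
by apply: le_trans (ler_norm r) _; rewrite lerDl.
Qed.

Lemma radius_geometric (b : nat -> gball R d) (q eps : R) : 0 < q < 1 -> 0 < eps ->
  (forall k, radius (b k.+1) = q * radius (b k)) -> exists k, radius (b k) < eps.
Proof.
move=> q01 eps0 step.
have powE k : radius (b k) = q ^+ k * radius (b 0%N).
  by elim: k => [|k IH]; rewrite ?expr0 ?mul1r // step IH exprS mulrA.
by have [k hk] := geometric_lt (radius (b 0%N)) q01 eps0; exists k; rewrite powE.
Qed.

(* Alice plays her strategy against a Bob who shrinks his balls as in [escape_choice]. *)
Lemma Bad_dense (B : gball R d) : 0 < radius B -> exists2 x, cball B x & Bad theta w x.
Proof.
move=> B0; have q01 : 0 < (4^-1 : R) < 1 by apply/andP; split; lra.
have [||f hf] := @escape_choice 4^-1 4^-1; [by apply/andP; split; lra|by lra|].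
have [sigma hs] := hag_shrinking q01.
pose h := fix h n := if n is n'.+1 then rcons (h n') (f (last B (h n')) (sigma (h n'))) else [:: B].
pose b n := last B (h n).
have hE n : mkseq b n.+1 = h n.
  by elim: n => // n IH; rewrite mkseqS IH /= /b /= last_rcons.
have bS n : b n.+1 = f (b n) (sigma (h n)) by rewrite /b /= last_rcons.
have [arule win] := hs b B0.
have legal n : forall k, (k < n)%N -> hag_bob 4^-1 (b k) (sigma (mkseq b k.+1)) (b k.+1).
  elim: n => // n IH k; rewrite ltnS leq_eqVlt => /orP [/eqP ->|/IH //].
  have [r0 aH eH] := arule n IH; rewrite hE in aH eH *; rewrite bS.
  by have [h1 h2 h3] := hf _ _ r0 aH eH; split; rewrite ?h1.
have {}legal k := legal k.+1 k (leqnn _).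
have arul k := arule k (fun i _ => legal i).
have shrink eps : 0 < eps -> exists k, radius (b k) < eps.
  move=> eps0; apply: (radius_geometric q01 eps0) => k.
  have [r0 aH eH] := arul k; rewrite hE in aH eH; rewrite bS.
  by have [] := hf _ _ r0 aH eH.
have [x xb] : exists x, forall k, cball (b k) x.
  by apply: nested_point => // k; [have [] := legal k|have [] := arul k].
by exists x; [exact: (xb 0%N)|exact: win].
Qed.

(** Let r be the infimum of the radii. From a ball of radius below [3 r / 2] on, the centres move by
    less than [r / 2], so the ball of radius [r / 2] around its centre lies in all later ones. *)
Lemma nested_contains_ball (b : nat -> gball R d) (eps : R) : 0 < eps ->
  (forall k, cball (b k.+1) `<=` cball (b k)) -> (forall k, eps <= radius (b k)) ->
  exists2 B : gball R d, 0 < radius B & forall k, cball B `<=` cball (b k).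
Proof.
move=> eps0 sub lb; pose r := inf (range (fun k => radius (b k))).
have rlb k : r <= radius (b k).
  by apply: inf_lbound; [exists eps => _ [i _ <-]|exists k].
have r0 : 0 < r.
  apply: lt_le_trans eps0 _; apply: lb_le_inf; first by exists (radius (b 0%N)), 0%N.
  by move=> _ [i _ <-].
have [_ [m _ <-] rm] : exists2 y, range (fun k => radius (b k)) y & y < r + r / 2.
  apply: inf_lt; last by rewrite ltrDl divr_gt0.
  by exists (radius (b 0%N)), 0%N.
exists (GBall (center (b m)) (r / 2)); first by rewrite /= divr_gt0.
move=> k; have [mk|/ltnW km] := leqP m k.
  have rk : 0 <= radius (b k) by apply: le_trans (lb k); apply: ltW.
  have := cball_sub_radius hd rk (nested_sub sub mk); have := rlb k => h1 h2.
  by apply: cball_sub => /=; rewrite -l2normN opprB; lra.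
move=> x hx; apply: (nested_sub sub km); apply: cball_sub hx => /=.
by rewrite subrr l2norm0; have := rlb m; lra.
Qed.

Lemma Bad_hyperplane_absolute_winning : hyperplane_absolute_winning (Bad theta w).
Proof.
move=> beta beta0 beta3; have beta01 : 0 < beta < 1 by apply/andP; split; lra.
have [sigma hs] := hag_shrinking beta01.
exists sigma => b b0 a; have [arule win] := hs b b0; split.
  move=> n legal; have [r0 aH ->] := arule n legal; split => //.
  by rewrite lexx andbT mulr_gt0.
move=> legal; have arul k := arule k (fun i _ => legal i).
have sub k : cball (b k.+1) `<=` cball (b k) by have [] := legal k.
have pos k : 0 < radius (b k) by have [] := arul k.
have [shrink|] := pselect (forall eps, 0 < eps -> exists k, radius (b k) < eps).
  have [x xb] := nested_point hd sub pos shrink.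
  by exists x; split; [move=> k _; apply: xb|exact: win].
move=> /existsNP [eps /not_implyP [eps0 noshrink]].
have [k|B B0 Bb] := nested_contains_ball eps0 sub.
  by rewrite leNgt; apply/negP => h; apply: noshrink; exists k.
have [x Bx badx] := Bad_dense B0.
by exists x; split => // k _; apply: Bb.
Qed.

(** Alice simulates the hyperplane game with parameter [beta / 4]: she answers with a ball of a
    quarter of the radius off the neighbourhood that her strategy there removes, and Bob's next ball
    is a legal move of that game. The quarter leaves enough room for every beta, as
    [beta / 4 + 1 / 4 <= 3 / 4]. *)
Lemma Bad_schmidt_winning : schmidt_winning (Bad theta w).
Proof.
exists 4^-1; split; first by apply/andP; split; lra.
move=> beta /andP [beta0 beta1]; pose q := beta / 4.
have q01 : 0 < q < 1 by rewrite /q; apply/andP; split; lra.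
have [||f hf] := @escape_choice 4^-1 q; [by apply/andP; split; lra|by rewrite /q; lra|].
have [sigma hs] := hag_shrinking q01.
exists (fun h => f (last (GBall 0 0) h) (sigma h)) => b b0 a.
have aE n : a n = f (b n) (sigma (mkseq b n.+1)) by rewrite /a {1}mkseqS last_rcons.
have [arule win] := hs b b0.
have legal n : (forall k, (k < n)%N -> cball (b k.+1) `<=` cball (a k) /\
      radius (b k.+1) = beta * radius (a k)) ->
    forall k, (k < n)%N -> hag_bob q (b k) (sigma (mkseq b k.+1)) (b k.+1).
  elim: n => // n IH leg k; rewrite ltnS leq_eqVlt => /orP [/eqP -> {k}|kn]; last first.
    by apply: IH kn => i /ltnW; apply: leg.
  have [r0 aH eH] := arule n (IH (fun i (il : (i < n)%N) => leg i (ltnW il))).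
  have [f1 f2 f3] := hf _ _ r0 aH eH; rewrite -aE in f1 f2 f3.
  have [l1 l2] := leg n (leqnn _); split.
  - by move=> x /l1 /f2.
  - by rewrite l2 f1 /q le_eqVlt mulrA eqxx.
  - by rewrite -subset0 -f3; apply: setSI.
split=> [n leg|leg].
  have [r0 aH eH] := arule n (legal n leg).
  by have [f1 f2 _] := hf _ _ r0 aH eH; rewrite aE.
have {}legal k := legal k.+1 (fun i _ => leg i) k (leqnn _).
have arul k := arule k (fun i _ => legal i).
have sub k : cball (b k.+1) `<=` cball (b k) by have [] := legal k.
have pos k : 0 < radius (b k) by have [] := arul k.
have shrink eps : 0 < eps -> exists k, radius (b k) < eps.
  move=> eps0; apply: (radius_geometric q01 eps0) => k.
  have [r0 aH eH] := arul k; have [_ ->] := leg k.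
  by have [f1 _ _] := hf _ _ r0 aH eH; rewrite aE f1 /q mulrA.
have [x xb] := nested_point hd sub pos shrink.
exists x; last exact: win.
apply/seteqP; split => [y yb|_ -> k _]; last exact: xb.
apply/eqP; rewrite -subr_eq0; apply/negPn/negP => /l2norm_gt0 yx.
have [k] := shrink (l2norm (y - x) / 2) (divr_gt0 yx (ltr0n _ 2)).
have := l2normD (y - center (b k)) (center (b k) - x).
rewrite addrA subrK -(l2normN (center (b k) - x)) (opprB (center (b k))).
by have := xb k; have := yb k I; rewrite /cball /=; lra.
Qed.
End Shrinking.

Theorem theorem1 (R : realType) (d : nat) (w : 'I_d -> R)
    (theta : 'I_d -> R -> R) (hd : (0 < d)%N) (hw : is_weight w)
    (htheta : forall i : 'I_d, lipschitz (theta i)) :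
  hyperplane_absolute_winning (Bad theta w) /\ schmidt_winning (Bad theta w).
Proof.
by split; [apply: Bad_hyperplane_absolute_winning|apply: Bad_schmidt_winning].
Qed.
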